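(* Assume that $N>1$. Let $r(v)$ be a nondegenerate unitary solution of the AYBE for $A=\mathrm{Mat}(N,\mathbb{C})$ not depending on the variable $u$. Then $$r(v)=\overline{r}(v)+b\otimes 1-1\otimes b+\frac{c\cdot 1\otimes 1}{Nv},$$ where $\overline{r}(v)$ is equivalent to a rational nondegenerate solution of the CYBE for $\mathfrak{sl}_N$, $b\in\mathfrak{sl}_N$ is an infinitesimal symmetry of $\overline{r}(v)$, and $c\in\mathbb{C}^*$. Also, $$R(u,v)=\left(1+\frac{cu}{v}\right)^{-1}\cdot\left(1+u\,r(v)\right)$$ is, for fixed $u$, a unitary solution of the QYBE with spectral parameter (hence, the same is true for $\frac{v}{c}r(v)=\lim_{u\to\infty}R(u,v)$).
   Context: For $r\in A\otimes A$: $r^{12}=r\otimes 1\in A\otimes A\otimes A$, $r^{13}$ and $r^{23}$ are defined similarly, and $r^{21}\in A\otimes A$ is obtained from $r$ by exchanging the factors. A nondegenerate unitary solution of the AYBE not depending on $u$ is an $A\otimes A$-valued meromorphic function $r(v)$ in a neighborhood of $0$ such that $$r^{12}(v)r^{13}(v+v')-r^{23}(v')r^{12}(v)+r^{13}(v+v')r^{23}(v')=0,\qquad r^{21}(-v)=-r(v),$$ and $r(v)$ is a nondegenerate tensor for generic $v$. The CYBE for $\mathfrak{sl}_N$ is the equation $[r^{12}(v),r^{13}(v+v')]-[r^{23}(v'),r^{12}(v)]+[r^{13}(v+v'),r^{23}(v')]=0$ for functions with values in $\mathfrak{sl}_N\otimes\mathfrak{sl}_N$; a solution is nondegenerate if it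 is a nondegenerate tensor in $\mathfrak{sl}_N\otimes\mathfrak{sl}_N$ for generic $v$, and rational if it is a rational function of $v$. Two solutions $\rho,\tilde\rho$ of the CYBE are equivalent (in the sense of Belavin-Drinfeld) if $\tilde\rho(v_1-v_2)=(\varphi(v_1)\otimes\varphi(v_2))\rho(v_1-v_2)$ for a holomorphic function $\varphi$ with values in $\mathrm{Aut}(\mathfrak{sl}_N)$. An infinitesimal symmetry of an $A\otimes A$-valued function $f(x)$ is an element $a\in A$ with $[a\otimes 1+1\otimes a,f(x)]=0$ for all $x$. The QYBE with spectral parameter (for fixed $u$) is $R^{12}(u,v)R^{13}(u,v+v')R^{23}(u,v')=R^{23}(u,v')R^{13}(u,v+v')R^{12}(u,v)$; unitarity of $R$ means $R(u,v)R^{21}(u,-v)=1\otimes 1$. In the formula for $R$, $1$ in the second factor denotes $1\otimes 1$. *)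

(* Defs.v *)
From HB Require Import structures.
From mathcomp Require Import all_boot all_order all_algebra.
From mathcomp Require Import all_classical all_reals all_analysis.
From mathcomp Require Import complex mxtens.

Set Implicit Arguments.
Unset Strict Implicit.
Unset Printing Implicit Defensive.

Import Order.TTheory GRing.Theory Num.Theory.
Import numFieldNormedType.Exports.

Local Open Scope classical_set_scope.
Local Open Scope ring_scope.

(* R[i] seen through its numClosedFieldType structure, which gives it the      *)
(* topology and the normed space structure of MathComp-Analysis (over itself). *)
Definition Cplx (R : realType) : numClosedFieldType := complex R.

Section Analysis.
Variable R : realType.
Local Notation C := (Cplx R).

Definition disc (e : R) : set C := ball (0 : C) (e%:C)%C.

(* The filter of neighbourhoods of infinity in the complex plane. *)
Definition cinfty : set_system C :=
  [set P | exists M : R, forall u : C, (M%:C)%C < `|u| -> P u].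

Section Holomorphic.
Variable V : normedModType C.
Implicit Types (f g : C -> V) (U : set C).

(* [derivable] over the field C is complex differentiability. *)
Definition holomorphic_at f (z : C) := \forall w \near z, derivable f w 1.

Definition meromorphic_at f (z : C) :=
  exists (k : nat) (g : C -> V), holomorphic_at g z /\
    \forall v \near z^', (v - z) ^+ k *: f v = g v.

(* A meromorphic function on U is encoded by a total function whose values at  *)
(* the poles are irrelevant: every identity between meromorphic functions is   *)
(* stated on the points [holo_pts U f] of U at which f is holomorphic.         *)
Definition meromorphic_on U f := forall z, U z -> meromorphic_at f z.

Definition holo_pts U f : set C := [set v | U v /\ holomorphic_at f v].

End Holomorphic.

(* P holds on U outside a subset without accumulation point in U. *)
Definition generically_on (U : set C) (P : C -> Prop) :=
  forall z, U z -> \forall v \near z^', P v.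

Definition rational n (f : C -> 'M[C]_n) :=
  exists (q : {poly C}) (P : 'M[{poly C}]_n), q != 0 /\
    forall v, q.[v] != 0 -> f v = \matrix_(i, j) ((P i j).[v] / q.[v]).

End Analysis.

Arguments disc {R} e.
Arguments cinfty R : clear implicits.

(* A (x) A is 'M_(N * N) and A (x) A (x) A is 'M_(N * N * N), the tensor       *)
(* product of elements being the Kronecker product [*t] of matrices.           *)
Section Tensors.
Variables (F : fieldType) (N : nat).
Local Notation A := 'M[F]_N.
Local Notation AA := 'M[F]_(N * N).
Local Notation AAA := 'M[F]_(N * N * N).
Implicit Types (t : AA) (a b : A).

(* The coefficient of E_ij (x) E_kl in t. *)
Definition tcoef t (i j k l : 'I_N) : F :=
  t (mxtens_index (i, k)) (mxtens_index (j, l)).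

Definition flip t : AA :=
  \matrix_(p, q) let p' := mxtens_unindex p in let q' := mxtens_unindex q in
    tcoef t p'.2 q'.2 p'.1 q'.1.

Definition leg1 (p : 'I_(N * N * N)) := (mxtens_unindex (mxtens_unindex p).1).1.
Definition leg2 (p : 'I_(N * N * N)) := (mxtens_unindex (mxtens_unindex p).1).2.
Definition leg3 (p : 'I_(N * N * N)) := (mxtens_unindex p).2.

Definition t12 t : AAA := \matrix_(p, q)
  (tcoef t (leg1 p) (leg1 q) (leg2 p) (leg2 q) * (leg3 p == leg3 q)%:R).
Definition t13 t : AAA := \matrix_(p, q)
  (tcoef t (leg1 p) (leg1 q) (leg3 p) (leg3 q) * (leg2 p == leg2 q)%:R).
Definition t23 t : AAA := \matrix_(p, q)
  (tcoef t (leg2 p) (leg2 q) (leg3 p) (leg3 q) * (leg1 p == leg1 q)%:R).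

Lemma flip_tens a b : flip (a *t b) = b *t a.
Proof. by apply/matrixP => p q; rewrite !mxE /tcoef !mxE !mxtens_indexK mulrC. Qed.

Lemma t12_tens a b : t12 (a *t b) = a *t b *t 1%:M.
Proof. by apply/matrixP => p q; rewrite !mxE /tcoef !mxE !mxtens_indexK. Qed.

Lemma t13_tens a b : t13 (a *t b) = a *t 1%:M *t b.
Proof. by apply/matrixP => p q; rewrite !mxE /tcoef !mxE !mxtens_indexK mulrAC. Qed.

Lemma t23_tens a b : t23 (a *t b) = 1%:M *t a *t b.
Proof. by apply/matrixP => p q; rewrite !mxE /tcoef !mxE !mxtens_indexK mulrC mulrA. Qed.

(* phi (x) psi, and f (x) id for a linear form f. *)
Definition tens_map (phi psi : 'End(A)) t : AA :=
  \sum_i \sum_j \sum_k \sum_l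
    tcoef t i j k l *: (phi (delta_mx i j) *t psi (delta_mx k l)).

Definition contract (f : 'Hom(A, F^o)) t : A :=
  \sum_i \sum_j \sum_k \sum_l
    (tcoef t i j k l * f (delta_mx i j)) *: delta_mx k l.

Definition in_tens (V : {vspace A}) t :=
  exists s : seq (A * A),
    (forall p, p \in s -> p.1 \in V /\ p.2 \in V) /\
    t = \sum_(p <- s) p.1 *t p.2.

(* t lies in V (x) V and the induced map V^* -> V is injective, that is        *)
(* bijective since V^* and V have the same dimension; every linear form on V   *)
(* is the restriction of a linear form f on A.                                 *)
Definition nondegenerate (V : {vspace A}) t :=
  in_tens V t /\
  forall f : 'Hom(A, F^o), contract f t = 0 -> forall a, a \in V -> f a = 0.

Definition lie n (x y : 'M[F]_n) : 'M[F]_n := x *m y - y *m x.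

Definition sl : {vspace A} := lker (linfun (@mxtrace F N : A -> F^o)).

Lemma mem_sl a : (a \in sl) = (\tr a == 0).
Proof. by rewrite memv_ker lfunE. Qed.

(* phi restricts to a Lie algebra automorphism of sl_N; its values outside     *)
(* sl_N are irrelevant.                                                        *)
Definition aut_sl (phi : 'End(A)) :=
  (phi @: sl)%VS = sl /\
  {in sl &, forall a b, phi (lie a b) = lie (phi a) (phi b)}.

Lemma tcoef_tens a b i j k l : tcoef (a *t b) i j k l = a i j * b k l.
Proof. by rewrite /tcoef mxE !mxtens_indexK. Qed.

Lemma tens_map_tens (phi psi : 'End(A)) a b :
  tens_map phi psi (a *t b) = phi a *t psi b.
Proof.
rewrite {2}[a]matrix_sum_delta {2}[b]matrix_sum_delta !raddf_sum /tens_map.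
apply/matrixP => p q; rewrite !mxE !summxE big_distrl; apply: eq_bigr => i _ /=.
rewrite raddf_sum !summxE big_distrl; apply: eq_bigr => j _ /=.
rewrite summxE big_distrr; apply: eq_bigr => k _ /=.
rewrite raddf_sum !summxE big_distrr; apply: eq_bigr => l _ /=.
by rewrite !linearZ /= !mxE tcoef_tens mulrACA.
Qed.

Lemma contract_tens (f : 'Hom(A, F^o)) a b : contract f (a *t b) = f a *: b.
Proof.
pose g a' : F := f a'.
have gD : {morph g : x y / x + y} by move=> x y; rewrite /g linearD.
have g0 : g 0 = 0 by rewrite /g linear0.
have gZ k x : g (k *: x) = k * g x by rewrite /g linearZ.
rewrite -[f a]/(g a) {2}[a]matrix_sum_delta {2}[b]matrix_sum_delta.
rewrite (big_morph g gD g0) scaler_suml; apply: eq_bigr => i _.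
rewrite (big_morph g gD g0) scaler_suml; apply: eq_bigr => j _.
rewrite scaler_sumr; apply: eq_bigr => k _.
rewrite scaler_sumr; apply: eq_bigr => l _.
by rewrite gZ scalerA tcoef_tens mulrAC.
Qed.

End Tensors.

Arguments sl {F N}.

Section YangBaxter.
Variables (R : realType) (N : nat).
Local Notation C := (Cplx R).
Local Notation A := 'M[C]_N.
Local Notation AA := 'M[C]_(N * N).
Implicit Types (U D : set C) (r rho : C -> AA).

Definition AYBE D r := forall v v', D v -> D v' -> D (v + v') ->
  t12 (r v) *m t13 (r (v + v')) - t23 (r v') *m t12 (r v)
    + t13 (r (v + v')) *m t23 (r v') = 0.

Definition nondegenerate_unitary_AYBE_solution U r :=
  [/\ meromorphic_on U r,
      AYBE (holo_pts U r) r,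
      forall v, holo_pts U r v -> holo_pts U r (- v) -> flip (r (- v)) = - r v
    & generically_on U (fun v => nondegenerate fullv (r v))].

Definition CYBE D rho := forall v v', D v -> D v' -> D (v + v') ->
  lie (t12 (rho v)) (t13 (rho (v + v'))) - lie (t23 (rho v')) (t12 (rho v))
    + lie (t13 (rho (v + v'))) (t23 (rho v')) = 0.

Definition CYBE_sl_solution U rho :=
  [/\ meromorphic_on U rho,
      forall v, holo_pts U rho v -> in_tens sl (rho v)
    & CYBE (holo_pts U rho) rho].

Definition rational_nondegenerate_CYBE_sl_solution rho :=
  [/\ CYBE_sl_solution setT rho, rational rho
    & generically_on setT (fun v => nondegenerate sl (rho v))].

Definition BD_equivalent U rho rho' :=
  exists phi : C -> 'End(A),
    [/\ forall v, U v -> aut_sl (phi v),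
        forall a, a \in sl ->
          forall v, U v -> holomorphic_at (fun w => phi w a) v
      & forall v1 v2, U v1 -> U v2 ->
          holo_pts setT rho (v1 - v2) -> holo_pts U rho' (v1 - v2) ->
          rho' (v1 - v2) = tens_map (phi v1) (phi v2) (rho (v1 - v2))].

Definition infinitesimal_symmetry D r (a : A) :=
  forall x, D x -> lie (a *t 1%:M + 1%:M *t a) (r x) = 0.

Definition unitary_QYBE_solution D (Q : C -> AA) :=
  (forall v v', D v -> D v' -> D (v + v') ->
     t12 (Q v) *m t13 (Q (v + v')) *m t23 (Q v') =
     t23 (Q v') *m t13 (Q (v + v')) *m t12 (Q v)) /\
  (forall v, D v -> D (- v) -> Q v *m flip (Q (- v)) = 1%:M *t 1%:M).

Definition quantumR r (c u v : C) : AA :=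
  (1 + c * u / v)^-1 *: (1%:M *t 1%:M + u *: r v).

Definition quantumR_dom D (c u : C) : set C :=
  [set v | D v /\ 1 + c * u / v != 0].

End YangBaxter.

(* Main.v *)
Require Import Defs.
From HB Require Import structures.
From mathcomp Require Import all_boot all_order all_algebra.
From mathcomp Require Import all_classical all_reals all_analysis.
From mathcomp Require Import complex mxtens.
From mathcomp Require Import ring lra.

Set Implicit Arguments.
Unset Strict Implicit.
Unset Printing Implicit Defensive.

Import Order.TTheory GRing.Theory Num.Theory.
Import numFieldNormedType.Exports.

Local Open Scope classical_set_scope.
Local Open Scope ring_scope.

(** Let P be the permutation of the two tensor factors.

  The pole. Unitarity turns the AYBE into a second equation with all products
  reversed (AYB_flip). At a point v where r(v) is nondegenerate, the equations
  at (v, h) and (v, - h) form a linear system for r(h) whose coefficients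
  converge as h tends to 0 and which is injective in the limit (pole_op_inj).
  Hence its solution converges after the scalar part of r(h) P is multiplied by
  h, and r(h) = c P / h + s + o(1) with c nonzero (simple_pole); no Laurent
  expansion is involved. The limit of the AYBE is
    r12 r13 = s23 r12 - r13 s23 - c r13' P23          (AYBE_at_pole).

  Multiplying the last two factors in this identity, in the two possible orders,
  gives two differential equations. The first (sqr_ptr2) says that r(v)^2 lies
  in A (x) 1, hence is scalar by unitarity. The second (riccati) is
    N c r' = [1 (x) k, r] - r * r,
  where * is the product of A (x) A^op and k comes from s; unitarity also makes
  k a symmetry of r (kk_sym). Near 0 the tensor (v / c) r(v) squares to a scalar
  and is close to P, so its trace is known up to a function satisfying a scalar
  Riccati equation. This yields r(v)^2 = (c / v)^2 and shows that the partial
  trace of r(v) is N b + c / v, with b a symmetry of r (near_tr, near_alpha,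
  beta_comm).

  Rationality. Let F(v) = exp(- v k / (N c)). Conjugation by 1 (x) F(v) removes
  the commutator from the Riccati equation, and transposition of the second
  factor turns * into the matrix product: the equation becomes Y' = - Y^2 / (N c),
  which is solved by a resolvent, rational in v (resolvent). The uniqueness of
  solutions is available because a disc without a discrete set is connected
  (linear_ode_global), and it also propagates the formulas above from a
  neighbourhood of 0. All this is collected in AYBE_normal_form.

  Conclusion. The difference of the two associative equations is the classical
  one (AYB_CYB). It survives the subtraction of b (x) 1 - 1 (x) b and of scalars
  (CYB_shift), and what remains, rbar, has vanishing partial traces. Since
  F(w) (x) F(w) commutes with rbar, the rational function
  rhobar(v) = (1 (x) F(v)) rbar(v) (1 (x) F(- v)) is equivalent to rbar. It
  satisfies the CYBE by a polynomial identity, and it is nondegenerate because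
  v (rhobar(v) + c / (N v)) tends to c P. Finally the scalar square of r makes
  the cubic terms of the QYBE agree (AYB_QYB), and the quadratic ones agree by
  the CYBE (QYB_affine). *)

(** * Tensor calculus in A (x) A *)

Section TensorCalculus.
Variables (F : fieldType) (N : nat).
Local Notation A := 'M[F]_N.
Local Notation AA := 'M[F]_(N * N).
Implicit Types (s t : AA) (a b x y : A).

Lemma tcoefD s t i j k l : tcoef (s + t) i j k l = tcoef s i j k l + tcoef t i j k l.
Proof. by rewrite /tcoef mxE. Qed.

Lemma tcoefZ c t i j k l : tcoef (c *: t) i j k l = c * tcoef t i j k l.
Proof. by rewrite /tcoef mxE. Qed.

Lemma tens_ext s t :
  (forall i j k l, tcoef s i j k l = tcoef t i j k l) -> s = t.
Proof.
move=> st; apply/matrixP => p q.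
by case: (mxtens_indexP p) => i k; case: (mxtens_indexP q) => j l; exact: st.
Qed.

Lemma tens_delta_sum t :
  t = \sum_i \sum_j \sum_k \sum_l
        (tcoef t i j k l *: delta_mx i j) *t delta_mx k l.
Proof.
apply: tens_ext => i j k l.
have E p (f : 'I_p -> AA) : tcoef (\sum_z f z) i j k l = \sum_z tcoef (f z) i j k l.
  by rewrite /tcoef summxE.
rewrite E (bigD1 i) //= [X in _ = _ + X]big1 ?addr0; last first.
  move=> i' ne; rewrite E big1 // => j' _; rewrite E big1 // => k' _.
  rewrite E big1 // => l' _.
  by rewrite tcoef_tens !mxE eq_sym (negbTE ne) /= mulr0 mul0r.
rewrite E (bigD1 j) //= [X in _ = _ + X]big1 ?addr0; last first.
  move=> j' ne; rewrite E big1 // => k' _; rewrite E big1 // => l' _.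
  by rewrite tcoef_tens !mxE [j == _]eq_sym (negbTE ne) /= andbF mulr0 mul0r.
rewrite E (bigD1 k) //= [X in _ = _ + X]big1 ?addr0; last first.
  move=> k' ne; rewrite E big1 // => l' _.
  by rewrite tcoef_tens !mxE [k == _]eq_sym (negbTE ne) /= mulr0.
rewrite E (bigD1 l) //= [X in _ = _ + X]big1 ?addr0; last first.
  move=> l' ne.
  by rewrite tcoef_tens !mxE [l == _]eq_sym (negbTE ne) /= andbF mulr0.
by rewrite tcoef_tens !mxE !eqxx /= !mulr1.
Qed.

(** Pure tensors span, so an additive property need only be checked on them. *)
Lemma tens_ind (Q : AA -> Prop) :
  (forall a b, Q (a *t b)) -> (forall s t, Q s -> Q t -> Q (s + t)) ->
  forall t, Q t.
Proof.
move=> Qt QD t.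
have Q0 : Q 0 by rewrite -(tens0mx (0 : A)); exact: Qt.
have Qs p (f : 'I_p -> AA) : (forall z, Q (f z)) -> Q (\sum_z f z).
  by move=> Qf; elim/big_ind: _ => // s' t'; exact: QD.
rewrite (tens_delta_sum t); do 4!(apply: (Qs) => ?); exact: Qt.
Qed.

Lemma tensDl a a' b : (a + a') *t b = a *t b + a' *t b.
Proof. by apply/matrixP => i j; rewrite !mxE mulrDl. Qed.

Lemma tensDr a b b' : a *t (b + b') = a *t b + a *t b'.
Proof. by apply/matrixP => i j; rewrite !mxE mulrDr. Qed.

Lemma tensZl c a b : (c *: a) *t b = c *: (a *t b).
Proof. by apply/matrixP => i j; rewrite !mxE mulrA. Qed.

Lemma tensZr c a b : a *t (c *: b) = c *: (a *t b).
Proof. by apply/matrixP => i j; rewrite !mxE mulrCA. Qed.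

Lemma tensNl a b : (- a) *t b = - (a *t b).
Proof. by rewrite -scaleN1r tensZl scaleN1r. Qed.

Lemma tensNr a b : a *t (- b) = - (a *t b).
Proof. by rewrite -scaleN1r tensZr scaleN1r. Qed.

Lemma tens11 : (1%:M : A) *t (1%:M : A) = 1%:M.
Proof.
apply/matrixP => p q.
case: (mxtens_indexP p) => i k; case: (mxtens_indexP q) => j l.
rewrite !mxE !mxtens_indexK /= (can_eq (@mxtens_indexK N N)) xpair_eqE.
by case: (i == j); case: (k == l); rewrite ?mul1r ?mul0r ?mulr0.
Qed.

Lemma tensmxM a a' b b' : (a *m a') *t (b *m b') = (a *t b) *m (a' *t b').
Proof. by rewrite tensmx_mul. Qed.

Lemma flipD s t : flip (s + t) = flip s + flip t.
Proof. by apply/matrixP => p q; rewrite !mxE /tcoef !mxE. Qed.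

Lemma flipZ c t : flip (c *: t) = c *: flip t.
Proof. by apply/matrixP => p q; rewrite !mxE /tcoef !mxE. Qed.

Lemma flipN t : flip (- t) = - flip t.
Proof. by rewrite -scaleN1r flipZ scaleN1r. Qed.

Lemma flipK : involutive (@flip F N).
Proof.
by elim/tens_ind => [a b|s t hs ht]; rewrite ?flip_tens // !flipD hs ht.
Qed.

Lemma flip1 : flip (1%:M : AA) = 1%:M.
Proof. by rewrite -tens11 flip_tens. Qed.

Lemma flipM s t : flip (s *m t) = flip s *m flip t.
Proof.
elim/tens_ind: s => [a b|s s' hs hs']; last by rewrite mulmxDl !flipD hs hs' mulmxDl.
elim/tens_ind: t => [a' b'|t t' ht ht']; last by rewrite mulmxDr !flipD ht ht' mulmxDr.
by rewrite -tensmxM !flip_tens tensmxM.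
Qed.

(** The permutation operator of the two tensor factors. *)
Definition swap : AA := \sum_i \sum_j (delta_mx i j : A) *t (delta_mx j i : A).

Lemma tcoef_swap i j k l : tcoef swap i j k l = ((i == l) && (k == j))%:R.
Proof.
rewrite /tcoef /swap summxE (bigD1 i) //= summxE (bigD1 j) //=.
rewrite big1 => [|j' ne]; last first.
  by rewrite mxE !mxtens_indexK !mxE [j == _]eq_sym (negbTE ne) andbF mul0r.
rewrite big1 => [|i' ne]; last first.
  rewrite summxE big1 // => j' _.
  by rewrite mxE !mxtens_indexK !mxE eq_sym (negbTE ne) mul0r.
by rewrite mxE !mxtens_indexK !mxE !eqxx /= mul1r !addr0 andbC [l == i]eq_sym.
Qed.

Lemma tcoefM s t i j k l :
  tcoef (s *m t) i j k l = \sum_m \sum_n tcoef s i m k n * tcoef t m j n l.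
Proof.
rewrite /tcoef mxE pair_bigA /=.
rewrite (reindex (@mxtens_index N N)) /=; last first.
  exists (@mxtens_unindex N N) => x _; [exact: mxtens_indexK|exact: mxtens_unindexK].
by apply: eq_bigr => -[m n] _.
Qed.

Lemma tcoef_mul_swap t i j k l : tcoef (t *m swap) i j k l = tcoef t i l k j.
Proof.
rewrite tcoefM (bigD1 l) //= [X in _ + X]big1 ?addr0 => [|m ne]; last first.
  by rewrite big1 // => n _; rewrite tcoef_swap (negbTE ne) mulr0.
rewrite (bigD1 j) //= big1 ?addr0 => [|n ne]; first by rewrite tcoef_swap !eqxx mulr1.
by rewrite tcoef_swap eqxx (negbTE ne) mulr0.
Qed.

Lemma tcoef_swap_mul t i j k l : tcoef (swap *m t) i j k l = tcoef t k j i l.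
Proof.
rewrite tcoefM (bigD1 k) //= [X in _ + X]big1 ?addr0 => [|m ne]; last first.
  rewrite big1 // => n _.
  by rewrite tcoef_swap [k == _]eq_sym (negbTE ne) andbF mul0r.
rewrite (bigD1 i) //= big1 ?addr0 => [|n ne]; first by rewrite tcoef_swap !eqxx mul1r.
by rewrite tcoef_swap [i == _]eq_sym (negbTE ne) mul0r.
Qed.

Lemma tens_swap a b : (a *t b) *m swap = swap *m (b *t a).
Proof.
apply: tens_ext => i j k l.
by rewrite tcoef_mul_swap tcoef_swap_mul !tcoef_tens mulrC.
Qed.

Lemma swapK : swap *m swap = 1%:M.
Proof.
apply: tens_ext => i j k l; rewrite tcoef_mul_swap tcoef_swap -tens11 tcoef_tens !mxE.
by case: (i == j); case: (k == l); rewrite ?mul0r ?mul1r.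
Qed.

Lemma mul_swap t : t *m swap = swap *m flip t.
Proof.
elim/tens_ind: t => [a b|s t hs ht]; first by rewrite flip_tens tens_swap.
by rewrite mulmxDl flipD mulmxDr hs ht.
Qed.

Lemma flipE t : flip t = swap *m t *m swap.
Proof. by rewrite -mulmxA mul_swap mulmxA swapK mul1mx. Qed.

Lemma flip_swap : flip swap = swap.
Proof. by rewrite flipE swapK mul1mx. Qed.

(** The partial traces over the first and over the second factor, and the
  multiplication of A. *)

Definition ptr1 t : A := \matrix_(k, l) \sum_i tcoef t i i k l.
Definition mu t : A := \matrix_(i, l) \sum_j tcoef t i j j l.
Definition ptr2 t : A := ptr1 (flip t).

Lemma ptr1_tens a b : ptr1 (a *t b) = \tr a *: b.
Proof.
apply/matrixP => k l; rewrite !mxE /mxtrace mulr_suml; apply: eq_bigr => i _.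
by rewrite tcoef_tens.
Qed.

Lemma ptr1_is_linear : linear ptr1.
Proof.
move=> c s t; apply/matrixP => k l; rewrite !mxE mulr_sumr -big_split /=.
by apply: eq_bigr => i _; rewrite tcoefD tcoefZ.
Qed.
HB.instance Definition _ := GRing.isLinear.Build F AA A _ ptr1 ptr1_is_linear.

Lemma flip_is_linear : linear (@flip F N).
Proof. by move=> c s t; rewrite flipD flipZ. Qed.
HB.instance Definition _ := GRing.isLinear.Build F AA AA _ (@flip F N) flip_is_linear.

Lemma ptr2_is_linear : linear ptr2.
Proof. by move=> c s t; rewrite /ptr2 !linearP. Qed.
HB.instance Definition _ := GRing.isLinear.Build F AA A _ ptr2 ptr2_is_linear.

Lemma mu_is_linear : linear mu.
Proof.
move=> c s t; apply/matrixP => k l; rewrite !mxE mulr_sumr -big_split /=.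
by apply: eq_bigr => i _; rewrite tcoefD tcoefZ.
Qed.
HB.instance Definition _ := GRing.isLinear.Build F AA A _ mu mu_is_linear.

Lemma ptr2_tens a b : ptr2 (a *t b) = \tr b *: a.
Proof. by rewrite /ptr2 flip_tens ptr1_tens. Qed.

Lemma mu_tens a b : mu (a *t b) = a *m b.
Proof.
by apply/matrixP => i l; rewrite !mxE; apply: eq_bigr => j _; rewrite tcoef_tens.
Qed.

Lemma ptr2_swap : ptr2 swap = 1%:M.
Proof.
apply/matrixP => k l; rewrite /ptr2 flip_swap !mxE (bigD1 l) //= big1.
  by rewrite addr0 tcoef_swap eqxx.
by move=> i ne; rewrite tcoef_swap (negbTE ne).
Qed.

Lemma trace_tens a b : \tr (a *t b) = \tr a * \tr b.
Proof.
rewrite /mxtrace big_distrlr /= pair_bigA /=.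
rewrite (reindex (@mxtens_index N N)) /=; last first.
  exists (@mxtens_unindex N N) => x _; [exact: mxtens_indexK|exact: mxtens_unindexK].
by apply: eq_bigr => -[m n] _; rewrite mxE !mxtens_indexK.
Qed.

Lemma trace_ptr1 t : \tr (ptr1 t) = \tr t.
Proof.
elim/tens_ind: t => [a b|s t hs ht]; last by rewrite linearD /= !mxtraceD hs ht.
by rewrite ptr1_tens mxtraceZ trace_tens.
Qed.

Lemma trace_flip t : \tr (flip t) = \tr t.
Proof.
elim/tens_ind: t => [a b|s t hs ht]; last by rewrite flipD !mxtraceD hs ht.
by rewrite flip_tens !trace_tens mulrC.
Qed.

Lemma trace_ptr2 t : \tr (ptr2 t) = \tr t.
Proof. by rewrite /ptr2 trace_ptr1 trace_flip. Qed.

Lemma trace_swap : \tr swap = N%:R.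
Proof. by rewrite -trace_ptr2 ptr2_swap mxtrace1. Qed.

(** Transposition of the second factor; it exchanges the products of A (x) A and
  of A (x) A^op. *)
Definition pt t : AA :=
  \matrix_(p, q) let p' := mxtens_unindex p in let q' := mxtens_unindex q in
    tcoef t p'.1 q'.1 q'.2 p'.2.

Lemma pt_tens a b : pt (a *t b) = a *t b^T.
Proof.
by apply/matrixP => p q; rewrite !mxE /tcoef !mxE !mxtens_indexK.
Qed.

Lemma pt_is_linear : linear pt.
Proof. by move=> c s t; apply/matrixP => p q; rewrite !mxE /tcoef !mxE. Qed.
HB.instance Definition _ := GRing.isLinear.Build F AA AA _ pt pt_is_linear.

Lemma ptK : involutive pt.
Proof.
by elim/tens_ind => [a b|s t hs ht]; rewrite ?pt_tens ?trmxK // !linearD /= hs ht.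
Qed.

Lemma trace_pt t : \tr (pt t) = \tr t.
Proof.
elim/tens_ind: t => [a b|s t hs ht]; last by rewrite linearD /= !mxtraceD hs ht.
by rewrite pt_tens !trace_tens mxtrace_tr.
Qed.

(** The product of A (x) A^op. *)
Definition pmul s t := pt (pt s *m pt t).

Lemma pmul_tens a b a' b' : pmul (a *t b) (a' *t b') = (a *m a') *t (b' *m b).
Proof. by rewrite /pmul !pt_tens -tensmxM pt_tens -trmx_mul trmxK. Qed.

Lemma pmulDl s s' t : pmul (s + s') t = pmul s t + pmul s' t.
Proof. by rewrite /pmul linearD /= mulmxDl linearD. Qed.

Lemma pmulDr s t t' : pmul s (t + t') = pmul s t + pmul s t'.
Proof. by rewrite /pmul linearD /= mulmxDr linearD. Qed.

(** The flip maps the product of A (x) A^op to that of A^op (x) A, which is the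
  former one with its arguments exchanged; in particular it preserves squares. *)
Lemma flip_pmul s t : flip (pmul s t) = pmul (flip t) (flip s).
Proof.
elim/tens_ind: s => [a b|s s' hs hs']; last by rewrite pmulDl !flipD hs hs' pmulDr.
elim/tens_ind: t => [a' b'|t t' ht ht']; last by rewrite pmulDr !flipD ht ht' pmulDl.
by rewrite pmul_tens !flip_tens pmul_tens.
Qed.

Lemma tens1_inj : (0 < N)%N -> injective (fun a => 1%:M *t a : AA).
Proof.
move=> N0 a b ab; apply/matrixP => k l.
have := congr1 (fun t => tcoef t (Ordinal N0) (Ordinal N0) k l) ab.
by rewrite !tcoef_tens !mxE eqxx !mul1r.
Qed.

(** The two sides vary with different factors, so both are constant; the entry
  (o, o) of the second factor reads the constant off. *)
Lemma tens1_scalar (o : 'I_N) a b : a *t 1%:M = 1%:M *t b :> AA ->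
  a = (b o o)%:M.
Proof.
move=> ab; apply/matrixP => i j.
have := congr1 (fun t => tcoef t i j o o) ab.
by rewrite !tcoef_tens !mxE eqxx mulr1 => ->; rewrite mulr_natl.
Qed.

(** The commutant of 1 (x) A is A (x) 1: commuting with the elementary matrices
  E_lo of the second factor determines all coefficients from those at (o, o). *)
Lemma tens1_comm (o : 'I_N) t :
  (forall b, t *m (1%:M *t b) = (1%:M *t b) *m t) ->
  exists a, t = a *t 1%:M.
Proof.
move=> tC; exists (\matrix_(i, j) tcoef t i j o o).
apply: tens_ext => i j k l; rewrite tcoef_tens !mxE.
have R b p q : tcoef (t *m (1%:M *t b)) i j p q = \sum_n tcoef t i j p n * b n q.
  rewrite tcoefM (bigD1 j) //= [X in _ + X]big1 ?addr0 => [|m ne].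
    by apply: eq_bigr => n _; rewrite tcoef_tens mxE eqxx mul1r.
  by rewrite big1 // => n _; rewrite tcoef_tens mxE (negbTE ne) mul0r mulr0.
have L b p q : tcoef ((1%:M *t b) *m t) i j p q = \sum_n b p n * tcoef t i j n q.
  rewrite tcoefM (bigD1 i) //= [X in _ + X]big1 ?addr0 => [|m ne].
    by apply: eq_bigr => n _; rewrite tcoef_tens mxE eqxx mul1r.
  by rewrite big1 // => n _; rewrite tcoef_tens mxE eq_sym (negbTE ne) !mul0r.
have := congr1 (fun t => tcoef t i j k o) (tC (delta_mx l o)).
rewrite R L (bigD1 l) //= big1 => [|n ne]; last by rewrite mxE (negbTE ne) mulr0.
rewrite mxE !eqxx mulr1 addr0 => ->.
rewrite (bigD1 o) //= big1 => [|n ne]; last by rewrite mxE (negbTE ne) andbF mul0r.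
by rewrite mxE eqxx andbT addr0 mulrC.
Qed.

End TensorCalculus.

Arguments swap {F N}.
(** * Three tensor factors and the Yang-Baxter identities *)

Section ThreeLegs.
Variables (F : fieldType) (N : nat).
Local Notation A := 'M[F]_N.
Local Notation AA := 'M[F]_(N * N).
Local Notation AAA := 'M[F]_(N * N * N).
Local Notation ix p q := (mxtens_index (p, q)).
Implicit Types (r s t x y z : AA) (a b c X Y : A) (S T : AAA).

Lemma t12_is_linear : linear (@t12 F N).
Proof. by move=> c s t; apply/matrixP => p q; rewrite !mxE /tcoef !mxE; ring. Qed.
HB.instance Definition _ := GRing.isLinear.Build F AA AAA _ (@t12 F N) t12_is_linear.

Lemma t13_is_linear : linear (@t13 F N).
Proof. by move=> c s t; apply/matrixP => p q; rewrite !mxE /tcoef !mxE; ring. Qed.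
HB.instance Definition _ := GRing.isLinear.Build F AA AAA _ (@t13 F N) t13_is_linear.

Lemma t23_is_linear : linear (@t23 F N).
Proof. by move=> c s t; apply/matrixP => p q; rewrite !mxE /tcoef !mxE; ring. Qed.
HB.instance Definition _ := GRing.isLinear.Build F AA AAA _ (@t23 F N) t23_is_linear.

Lemma tens3M a b c a' b' c' :
  (a *t b *t c) *m (a' *t b' *t c') = (a *m a') *t (b *m b') *t (c *m c').
Proof. by rewrite !tensmx_mul. Qed.

Lemma tens3E a b c i j k l m n :
  (a *t b *t c) (ix (ix i k) m) (ix (ix j l) n) = a i j * b k l * c m n.
Proof. by rewrite !tensmxE. Qed.

Lemma t12M s t : t12 (s *m t) = t12 s *m t12 t.
Proof.
elim/tens_ind: s => [a b|s s' hs hs']; last by rewrite ?mulmxDl ?linearD /= ?mulmxDl hs hs'.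
elim/tens_ind: t => [a' b'|t t' ht ht']; last by rewrite ?mulmxDr ?linearD /= ?mulmxDr ht ht'.
by rewrite -tensmxM !t12_tens tens3M mulmx1.
Qed.

Lemma t13M s t : t13 (s *m t) = t13 s *m t13 t.
Proof.
elim/tens_ind: s => [a b|s s' hs hs']; last by rewrite ?mulmxDl ?linearD /= ?mulmxDl hs hs'.
elim/tens_ind: t => [a' b'|t t' ht ht']; last by rewrite ?mulmxDr ?linearD /= ?mulmxDr ht ht'.
by rewrite -tensmxM !t13_tens tens3M mulmx1.
Qed.

Lemma t23M s t : t23 (s *m t) = t23 s *m t23 t.
Proof.
elim/tens_ind: s => [a b|s s' hs hs']; last by rewrite ?mulmxDl ?linearD /= ?mulmxDl hs hs'.
elim/tens_ind: t => [a' b'|t t' ht ht']; last by rewrite ?mulmxDr ?linearD /= ?mulmxDr ht ht'.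
by rewrite -tensmxM !t23_tens tens3M mulmx1.
Qed.

Lemma tens111 : (1%:M : A) *t (1%:M : A) *t (1%:M : A) = 1%:M.
Proof.
rewrite tens11; apply/matrixP => p q.
case: (mxtens_indexP p) => i k; case: (mxtens_indexP q) => j l.
rewrite !mxE !mxtens_indexK /= (can_eq (@mxtens_indexK (N * N) N)) xpair_eqE.
by case: (i == j); case: (k == l); rewrite ?mul1r ?mul0r ?mulr0.
Qed.

Lemma t12_1 : t12 (1%:M : AA) = 1%:M.
Proof. by rewrite -tens11 t12_tens tens111. Qed.
Lemma t13_1 : t13 (1%:M : AA) = 1%:M.
Proof. by rewrite -tens11 t13_tens tens111. Qed.
Lemma t23_1 : t23 (1%:M : AA) = 1%:M.
Proof. by rewrite -tens11 t23_tens tens111. Qed.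

(** The exchange of the outer factors of A (x) A (x) A, as conjugation by a
  permutation of the basis. *)
Definition rev_index (p : 'I_(N * N * N)) : 'I_(N * N * N) :=
  ix (ix (leg3 p) (leg2 p)) (leg1 p).

Lemma rev_indexK : involutive rev_index.
Proof.
move=> p; case: (mxtens_indexP p) => p' m; case: (mxtens_indexP p') => i k.
by rewrite /rev_index /leg1 /leg2 /leg3 !mxtens_indexK /= ?mxtens_indexK.
Qed.

Definition sw13 T : AAA := mxsub rev_index rev_index T.

Lemma sw13_is_linear : linear sw13.
Proof. by move=> c S T; apply/matrixP => p q; rewrite !mxE. Qed.
HB.instance Definition _ := GRing.isLinear.Build F AAA AAA _ sw13 sw13_is_linear.

Lemma sw13M S T : sw13 (S *m T) = sw13 S *m sw13 T.
Proof.
apply/matrixP => p q; rewrite !mxE (reindex rev_index) /=; last first.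
  by exists rev_index => ? _; exact: rev_indexK.
by apply: eq_bigr => m _; rewrite !mxE.
Qed.

Lemma sw13_tens a b c : sw13 (a *t b *t c) = c *t b *t a.
Proof.
apply/matrixP => p q.
case: (mxtens_indexP p) => p' m; case: (mxtens_indexP p') => i k.
case: (mxtens_indexP q) => q' n; case: (mxtens_indexP q') => j l.
rewrite mxE /rev_index /leg1 /leg2 /leg3 !mxtens_indexK /= ?mxtens_indexK /=.
by rewrite !tens3E; ring.
Qed.

Lemma sw13_t12 t : sw13 (t12 t) = t23 (flip t).
Proof.
elim/tens_ind: t => [a b|s t hs ht]; last by rewrite flipD ?linearD /= hs ht.
by rewrite t12_tens sw13_tens flip_tens t23_tens.
Qed.

Lemma sw13_t13 t : sw13 (t13 t) = t13 (flip t).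
Proof.
elim/tens_ind: t => [a b|s t hs ht]; last by rewrite flipD ?linearD /= hs ht.
by rewrite t13_tens sw13_tens flip_tens t13_tens.
Qed.

Lemma sw13_t23 t : sw13 (t23 t) = t12 (flip t).
Proof.
elim/tens_ind: t => [a b|s t hs ht]; last by rewrite flipD ?linearD /= hs ht.
by rewrite t23_tens sw13_tens flip_tens t12_tens.
Qed.

(** Maps A (x) A (x) A -> A (x) A: the products a (x) b c and a (x) c b, the
  trace of the last factor, and the pairing of the first factor with X. *)

Definition mu23 T : AA := \matrix_(p, q)
  let p' := mxtens_unindex p in let q' := mxtens_unindex q in
  \sum_m T (ix (ix p'.1 p'.2) m) (ix (ix q'.1 m) q'.2).

Definition mu32 T : AA := \matrix_(p, q)
  let p' := mxtens_unindex p in let q' := mxtens_unindex q in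
  \sum_m T (ix (ix p'.1 m) p'.2) (ix (ix q'.1 q'.2) m).

Definition tr3 T : AA := \matrix_(p, q) \sum_m T (ix p m) (ix q m).

Definition comb1 X T : AA := \matrix_(p, q)
  let p' := mxtens_unindex p in let q' := mxtens_unindex q in
  \sum_i \sum_j X j i * T (ix (ix i p'.1) p'.2) (ix (ix j q'.1) q'.2).

Lemma mu23_is_linear : linear mu23.
Proof.
move=> c S T; apply/matrixP => p q; rewrite !mxE mulr_sumr -big_split /=.
by apply: eq_bigr => m _; rewrite !mxE.
Qed.
HB.instance Definition _ := GRing.isLinear.Build F AAA AA _ mu23 mu23_is_linear.

Lemma mu32_is_linear : linear mu32.
Proof.
move=> c S T; apply/matrixP => p q; rewrite !mxE mulr_sumr -big_split /=.
by apply: eq_bigr => m _; rewrite !mxE.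
Qed.
HB.instance Definition _ := GRing.isLinear.Build F AAA AA _ mu32 mu32_is_linear.

Lemma tr3_is_linear : linear tr3.
Proof.
move=> c S T; apply/matrixP => p q; rewrite !mxE mulr_sumr -big_split /=.
by apply: eq_bigr => m _; rewrite !mxE.
Qed.
HB.instance Definition _ := GRing.isLinear.Build F AAA AA _ tr3 tr3_is_linear.

Lemma comb1_is_linear X : linear (comb1 X).
Proof.
move=> c S T; apply/matrixP => p q; rewrite !mxE mulr_sumr -big_split /=.
apply: eq_bigr => i _; rewrite mulr_sumr -big_split /=.
by apply: eq_bigr => j _; rewrite !mxE; ring.
Qed.
HB.instance Definition _ X :=
  GRing.isLinear.Build F AAA AA _ (comb1 X) (comb1_is_linear X).

Lemma mu23_tens a b c : mu23 (a *t b *t c) = a *t (b *m c).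
Proof.
apply: tens_ext => i j k l; rewrite tcoef_tens /tcoef !mxE !mxtens_indexK /=.
by rewrite mulr_sumr; apply: eq_bigr => m _; rewrite tens3E mulrA.
Qed.

Lemma mu32_tens a b c : mu32 (a *t b *t c) = a *t (c *m b).
Proof.
apply: tens_ext => i j k l; rewrite tcoef_tens /tcoef !mxE !mxtens_indexK /=.
by rewrite mulr_sumr; apply: eq_bigr => m _; rewrite tens3E; ring.
Qed.

Lemma tr3_tens a b c : tr3 (a *t b *t c) = \tr c *: (a *t b).
Proof.
apply: tens_ext => i j k l; rewrite tcoefZ tcoef_tens /tcoef !mxE /mxtrace.
by rewrite mulr_suml; apply: eq_bigr => m _; rewrite tens3E; ring.
Qed.

Lemma comb1_tens X a b c : comb1 X (a *t b *t c) = \tr (X *m a) *: (b *t c).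
Proof.
apply: tens_ext => i j k l; rewrite tcoefZ tcoef_tens /tcoef !mxE !mxtens_indexK /=.
rewrite /mxtrace exchange_big /= mulr_suml; apply: eq_bigr => m _.
rewrite mxE mulr_suml; apply: eq_bigr => n _; rewrite tens3E; ring.
Qed.

Lemma mu23_12_13 s t : mu23 (t12 s *m t13 t) = s *m t.
Proof.
elim/tens_ind: s => [a b|s s' hs hs']; last by rewrite ?linearD ?mulmxDl ?linearD /= hs hs'.
elim/tens_ind: t => [a' b'|t t' ht ht']; last by rewrite ?linearD ?mulmxDr ?linearD /= ht ht'.
by rewrite t12_tens t13_tens tens3M mu23_tens -tensmxM mulmx1 mul1mx.
Qed.

Lemma mu32_12_13 s t : mu32 (t12 s *m t13 t) = pmul s t.
Proof.
elim/tens_ind: s => [a b|s s' hs hs'].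
  elim/tens_ind: t => [a' b'|t t' ht ht'].
    by rewrite t12_tens t13_tens tens3M mu32_tens pmul_tens mulmx1 mul1mx.
  by rewrite ?linearD ?mulmxDr ?linearD /= ht ht' pmulDr.
by rewrite ?linearD ?mulmxDl ?linearD /= hs hs' pmulDl.
Qed.

Lemma mu23_23_12 s t : mu23 (t23 s *m t12 t) = mu23 (t13 t *m t23 s).
Proof.
elim/tens_ind: s => [a b|s s' hs hs'].
  elim/tens_ind: t => [a' b'|t t' ht ht'].
    rewrite t23_tens t12_tens t13_tens !tens3M !mu23_tens !mulmx1 !mul1mx.
    by rewrite mulmxA.
  by rewrite ?linearD /= ?mulmxDr ?mulmxDl ?linearD /= ht ht'.
by rewrite ?linearD /= ?mulmxDr ?mulmxDl ?linearD /= hs hs'.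
Qed.

Lemma mu32_23_12 s t : mu32 (t23 s *m t12 t) = (1%:M *t mu (flip s)) *m t.
Proof.
elim/tens_ind: s => [a b|s s' hs hs'].
  elim/tens_ind: t => [a' b'|t t' ht ht'].
    rewrite t23_tens t12_tens !tens3M !mu32_tens flip_tens mu_tens -tensmxM.
    by rewrite mulmx1 mulmxA.
  by rewrite ?linearD /= ?mulmxDr ?linearD /= ht ht' ?mulmxDr.
by rewrite ?linearD /= ?mulmxDl ?linearD /= hs hs' tensDr ?mulmxDl.
Qed.

Lemma mu32_13_23 s t : mu32 (t13 t *m t23 s) = t *m (1%:M *t mu (flip s)).
Proof.
elim/tens_ind: s => [a b|s s' hs hs'].
  elim/tens_ind: t => [a' b'|t t' ht ht'].
    rewrite t23_tens t13_tens !tens3M !mu32_tens flip_tens mu_tens -tensmxM.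
    by rewrite !mul1mx !mulmx1 mulmxA.
  by rewrite ?linearD /= ?mulmxDl ?linearD /= ht ht' ?mulmxDl.
by rewrite ?linearD /= ?mulmxDr ?linearD /= hs hs' tensDr ?mulmxDr.
Qed.

Lemma mu_swap_mul (b : A) : mu ((1%:M *t b) *m swap) = (\tr b)%:M.
Proof.
apply/matrixP => i l; rewrite !mxE.
under eq_bigr do rewrite tcoef_mul_swap tcoef_tens mxE.
by rewrite -mulr_sumr mulr_natl.
Qed.

Lemma mu_flip_swap : mu (flip (swap : AA)) = N%:R%:M.
Proof.
rewrite flip_swap -[swap]mul1mx -tens11 mu_swap_mul; congr (_%:M).
by rewrite mxtrace1.
Qed.

Lemma mu23_13_swap t : mu23 (t13 t *m t23 swap) = ptr2 t *t 1%:M.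
Proof.
elim/tens_ind: t => [a b|t t' ht ht']; last first.
  by rewrite ?linearD /= ?mulmxDl ?linearD /= ht ht' tensDl.
have E s : mu23 (t13 (a *t b) *m t23 s) = a *t mu ((1%:M *t b) *m s).
  elim/tens_ind: s => [c d|s s' hs hs']; last first.
    by rewrite ?linearD /= ?mulmxDr ?linearD /= hs hs' tensDr.
  rewrite t13_tens t23_tens tens3M mu23_tens -tensmxM mu_tens.
  by rewrite mulmx1 !mul1mx.
by rewrite E mu_swap_mul ptr2_tens tensZl -tensZr scalemx1.
Qed.

(** The associative Yang-Baxter equation for x = r(v), y = r(v + v'),
  z = r(v'), and the equation obtained from it by reversing the products. *)
Definition AYB x y z :=
  t12 x *m t13 y - t23 z *m t12 x + t13 y *m t23 z = 0.
Definition AYB' x y z :=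
  t13 y *m t12 x - t12 x *m t23 z + t23 z *m t13 y = 0.
Definition CYB x y z :=
  lie (t12 x) (t13 y) - lie (t23 z) (t12 x) + lie (t13 y) (t23 z) = 0.

(** Exchanging the outer factors maps r12, r13, r23 to the flips of r in the
  positions 23, 13, 12, which reverses every product of the equation. *)
Lemma AYB_flip x y z : AYB x y z -> AYB' (- flip z) (- flip y) (- flip x).
Proof.
move=> /(congr1 sw13); rewrite linear0 !linearD linearN /= !sw13M.
rewrite !sw13_t12 !sw13_t13 !sw13_t23 /AYB' => <-.
have [n12 n13 n23] : [/\ forall t, t12 (- t) = - t12 t :> AAA,
    forall t, t13 (- t) = - t13 t :> AAA & forall t, t23 (- t) = - t23 t :> AAA].
  by split=> t; rewrite linearN.
rewrite n12 n13 n23 !mulNmx !mulmxN !opprK.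
by apply/matrixP => i j; rewrite !mxE; ring.
Qed.

(** The classical equation is the difference of the two associative ones. *)
Lemma AYB_CYB x y z : AYB x y z -> AYB' x y z -> CYB x y z.
Proof.
rewrite /CYB /lie => h h'.
have E (p1 p2 p3 q1 q2 q3 : AAA) :
    (p1 - q1) - (p2 - q2) + (p3 - q3) = (p1 - p2 + p3) - (q1 - q2 + q3).
  by apply/matrixP => i j; rewrite !mxE; ring.
by rewrite E h h' subr0.
Qed.

Lemma tr3_12_13 s t : tr3 (t12 s *m t13 t) = s *m (ptr2 t *t 1%:M).
Proof.
elim/tens_ind: s => [a b|s s' hs hs']; last by rewrite ?linearD ?mulmxDl ?linearD /= hs hs'.
elim/tens_ind: t => [a' b'|t t' ht ht'].
  rewrite t12_tens t13_tens tens3M tr3_tens ptr2_tens -tensmxM !mulmx1 mul1mx.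
  by rewrite -scalemxAr tensZl.
by rewrite ?linearD ?mulmxDr ?linearD /= ht ht' tensDl ?mulmxDr.
Qed.

Lemma tr3_13_12 s t : tr3 (t13 t *m t12 s) = (ptr2 t *t 1%:M) *m s.
Proof.
elim/tens_ind: s => [a b|s s' hs hs']; last by rewrite ?linearD ?mulmxDr ?linearD /= hs hs'.
elim/tens_ind: t => [a' b'|t t' ht ht'].
  rewrite t12_tens t13_tens tens3M tr3_tens ptr2_tens -tensmxM !mulmx1 mul1mx.
  by rewrite -scalemxAl tensZl.
by rewrite ?linearD ?mulmxDl ?linearD /= ht ht' tensDl ?mulmxDl.
Qed.

Lemma tr3_12_23 s t : tr3 (t12 s *m t23 t) = s *m (1%:M *t ptr2 t).
Proof.
elim/tens_ind: s => [a b|s s' hs hs']; last by rewrite ?linearD ?mulmxDl ?linearD /= hs hs'.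
elim/tens_ind: t => [a' b'|t t' ht ht'].
  rewrite t12_tens t23_tens tens3M tr3_tens ptr2_tens -tensmxM !mulmx1 mul1mx.
  by rewrite -scalemxAr tensZr.
by rewrite ?linearD ?mulmxDr ?linearD /= ht ht' tensDr ?mulmxDr.
Qed.

Lemma tr3_23_12 s t : tr3 (t23 t *m t12 s) = (1%:M *t ptr2 t) *m s.
Proof.
elim/tens_ind: s => [a b|s s' hs hs']; last by rewrite ?linearD ?mulmxDr ?linearD /= hs hs'.
elim/tens_ind: t => [a' b'|t t' ht ht'].
  rewrite t12_tens t23_tens tens3M tr3_tens ptr2_tens -tensmxM !mul1mx mulmx1.
  by rewrite -scalemxAl tensZr.
by rewrite ?linearD ?mulmxDl ?linearD /= ht ht' tensDr ?mulmxDl.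
Qed.

Lemma tr3_13_23 s t : tr3 (t13 t *m t23 s) = tr3 (t23 s *m t13 t).
Proof.
elim/tens_ind: s => [a b|s s' hs hs']; last first.
  by rewrite ?linearD ?mulmxDr ?mulmxDl ?linearD /= hs hs'.
elim/tens_ind: t => [a' b'|t t' ht ht'].
  by rewrite t13_tens t23_tens !tens3M !tr3_tens !mulmx1 !mul1mx mxtrace_mulC.
by rewrite ?linearD ?mulmxDl ?mulmxDr ?linearD /= ht ht'.
Qed.

(** In the trace over the last factor of the difference of the two equations, the
  terms with r13 and r23 cancel by cyclicity. *)
Lemma AYB_ptr2 x y z : AYB x y z -> AYB' x y z ->
  lie (ptr2 y *t 1%:M + 1%:M *t ptr2 z) x = 0.
Proof.
move=> /(congr1 tr3) h /(congr1 tr3); move: h.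
rewrite !linear0 ?linearD ?linearN /= !tr3_12_13 !tr3_13_12 !tr3_12_23 !tr3_23_12.
rewrite tr3_13_23 /lie ?mulmxDl ?mulmxDr.
move: (tr3 _) => w h h'.
have E (p q p' q' : AA) : p' + q' - (p + q) = (p' - q + w) - (p - q' + w).
  by apply/matrixP => i j; rewrite !mxE; ring.
by rewrite E h h' subrr.
Qed.

(** Unitarity makes z^2 scalar, and then the cubic terms of the quantum
  Yang-Baxter equation cancel. *)
Lemma AYB_QYB x y z (f : F) : AYB x y z -> AYB' x y z -> z *m z = f%:M ->
  t12 x *m t13 y *m t23 z = t23 z *m t13 y *m t12 x.
Proof.
move=> h h' zz.
have zz3 : t23 z *m t23 z = f%:M.
  by rewrite -t23M zz -scalemx1 linearZ /= t23_1 scalemx1.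
have xy : t12 x *m t13 y = t23 z *m t12 x - t13 y *m t23 z.
  by apply/eqP; rewrite -subr_eq0 opprB addrCA addrC; apply/eqP.
have yx : t13 y *m t12 x = t12 x *m t23 z - t23 z *m t13 y.
  by apply/eqP; rewrite -subr_eq0 opprB addrCA addrC; apply/eqP.
rewrite xy mulmxBl -(mulmxA (t13 y)) zz3 -mulmxA yx mulmxBr !mulmxA zz3.
by rewrite mul_scalar_mx mul_mx_scalar.
Qed.

(** The quantum Yang-Baxter equation for 1 + u r is the sum of the classical one
  (degree two in u) and of the cubic identity above. *)
Lemma QYB_affine x y z (u : F) : CYB x y z ->
  t12 x *m t13 y *m t23 z = t23 z *m t13 y *m t12 x ->
  t12 (1%:M + u *: x) *m t13 (1%:M + u *: y) *m t23 (1%:M + u *: z) =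
  t23 (1%:M + u *: z) *m t13 (1%:M + u *: y) *m t12 (1%:M + u *: x).
Proof.
have -> : t12 (1%:M + u *: x) = 1%:M + u *: t12 x :> AAA.
  by rewrite linearD linearZ /= t12_1.
have -> : t13 (1%:M + u *: y) = 1%:M + u *: t13 y :> AAA.
  by rewrite linearD linearZ /= t13_1.
have -> : t23 (1%:M + u *: z) = 1%:M + u *: t23 z :> AAA.
  by rewrite linearD linearZ /= t23_1.
rewrite /CYB /lie.
have E (p q s : AAA) :
    p *m q - q *m p - (s *m p - p *m s) + (q *m s - s *m q) = 0 ->
    p *m q *m s = s *m q *m p ->
    (1%:M + p) *m (1%:M + q) *m (1%:M + s) = (1%:M + s) *m (1%:M + q) *m (1%:M + p).
  move=> h hc; rewrite !(mulmxDl, mulmxDr, mul1mx, mulmx1) hc.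
  have -> : p *m q = (s *m p - p *m s) - (q *m s - s *m q) + q *m p.
    apply/eqP; rewrite -subr_eq0 -h; apply/eqP.
    by apply/matrixP => i j; rewrite !mxE; ring.
  by apply/matrixP => i j; rewrite !mxE; ring.
move: (t12 x) (t13 y) (t23 z) => p q s h hc; apply: E; rewrite -!scalemxAl -!scalemxAr -?scalemxAl.
  by rewrite -!scalerBr -!scalerDr h !scaler0.
by rewrite hc.
Qed.

Lemma tens11_t23 a s : (a *t 1%:M *t 1%:M) *m t23 s = t23 s *m (a *t 1%:M *t 1%:M).
Proof.
elim/tens_ind: s => [b c|s s' hs hs']; last by rewrite linearD /= mulmxDl mulmxDr hs hs'.
by rewrite t23_tens !tens3M !mulmx1 !mul1mx.
Qed.

Lemma t12_swap23 t : t12 t *m t23 swap = t23 swap *m t13 t.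
Proof.
elim/tens_ind: t => [a b|s t hs ht]; last by rewrite !linearD /= ?mulmxDl ?mulmxDr hs ht.
have -> : t12 (a *t b) = (a *t 1%:M *t 1%:M) *m t23 (b *t 1%:M).
  by rewrite t12_tens t23_tens tens3M !mulmx1 !mul1mx.
have -> : t13 (a *t b) = (a *t 1%:M *t 1%:M) *m t23 (1%:M *t b).
  by rewrite t13_tens t23_tens tens3M !mulmx1 !mul1mx.
by rewrite -mulmxA -t23M tens_swap t23M !mulmxA tens11_t23.
Qed.

(** The contraction of the first factor with the linear form a |-> tr (X a). *)
Definition comb t X : A := ptr1 ((X *t 1%:M) *m t).

Lemma comb_tens X a b : comb (a *t b) X = \tr (X *m a) *: b.
Proof. by rewrite /comb -tensmxM ptr1_tens mul1mx. Qed.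

Lemma comb_is_linear t : linear (comb t).
Proof.
by move=> c X Y; rewrite /comb tensDl tensZl ?mulmxDl -scalemxAl linearP.
Qed.
HB.instance Definition _ t := GRing.isLinear.Build F A A _ (comb t) (comb_is_linear t).

Lemma combDl s t X : comb (s + t) X = comb s X + comb t X.
Proof. by rewrite /comb ?mulmxDr linearD. Qed.

Lemma combZl (k : F) t X : comb (k *: t) X = k *: comb t X.
Proof. by rewrite /comb -scalemxAr linearZ. Qed.

Lemma comb1_23_13 X s t : comb1 X (t23 s *m t13 t) = s *m (1%:M *t comb t X).
Proof.
elim/tens_ind: s => [a b|s s' hs hs']; last first.
  by rewrite linearD /= ?mulmxDl linearD /= hs hs'.
elim/tens_ind: t => [a' b'|t t' ht ht']; last first.
  by rewrite linearD /= combDl tensDr ?mulmxDr linearD /= ht ht'.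
rewrite t23_tens t13_tens tens3M comb1_tens comb_tens tensZr -scalemxAr -tensmxM.
by rewrite !mulmx1 mul1mx.
Qed.

Lemma comb1_13_23 X s t : comb1 X (t13 t *m t23 s) = (1%:M *t comb t X) *m s.
Proof.
elim/tens_ind: s => [a b|s s' hs hs']; last first.
  by rewrite linearD /= ?mulmxDr linearD /= hs hs'.
elim/tens_ind: t => [a' b'|t t' ht ht']; last first.
  by rewrite linearD /= combDl tensDr ?mulmxDl linearD /= ht ht'.
rewrite t23_tens t13_tens tens3M comb1_tens comb_tens tensZr -scalemxAl -tensmxM.
by rewrite !mulmx1 !mul1mx.
Qed.

Lemma comb1_t13 X t : comb1 X (t13 t) = 1%:M *t comb t X.
Proof. by rewrite -[t13 t]mul1mx -t23_1 comb1_23_13 mul1mx. Qed.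

Lemma comb_comb1 X Y s t :
  comb (comb1 X (t12 s *m t13 t)) Y = comb t (X *m comb (flip s) Y).
Proof.
elim/tens_ind: s => [a b|s s' hs hs']; last first.
  by rewrite flipD linearD /= ?mulmxDl linearD /= !combDl ?mulmxDr linearD /= hs hs'.
elim/tens_ind: t => [a' b'|t t' ht ht']; last first.
  by rewrite linearD /= ?mulmxDr linearD /= !combDl ht ht'.
rewrite t12_tens t13_tens tens3M comb1_tens flip_tens combZl !comb_tens mul1mx mulmx1.
by rewrite -scalemxAr -scalemxAl mxtraceZ !scalerA mulmxA mulrC.
Qed.

(** A tensor is nondegenerate in A (x) A when the induced map A -> A is
  injective; rl t is the matrix of that map, locked since conversion should not
  compute it. *)
Definition rl t : 'M[F]_(N * N) := locked (lin_mx (comb t)).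

Lemma mul_rl t X : mxvec X *m rl t = mxvec (comb t X).
Proof. by rewrite /rl -lock mul_vec_lin. Qed.

Lemma rl_unitP t : reflect (forall X, comb t X = 0 -> X = 0) (rl t \in unitmx).
Proof.
apply: (iffP idP) => [u X tX0|inj].
  apply: (can_inj mxvecK); rewrite linear0.
  by rewrite -[LHS]mulmx1 -(mulmxV u) mulmxA mul_rl tX0 linear0 mul0mx.
rewrite -row_free_unit -kermx_eq0; apply/eqP/row_matrixP => i; rewrite row0.
have := congr1 (row i) (mulmx_ker (rl t)); rewrite row_mul row0.
rewrite -[row i _]vec_mxK mul_rl => /(congr1 vec_mx); rewrite mxvecK linear0.
by move=> /inj ->; rewrite linear0.
Qed.

Lemma comb_surj t b : rl t \in unitmx -> exists X, comb t X = b.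
Proof.
move=> u; exists (vec_mx (mxvec b *m invmx (rl t))).
by apply: (can_inj mxvecK); rewrite -mul_rl vec_mxK mulmxKV.
Qed.

Lemma rl_is_linear : linear rl.
Proof.
move=> c s t; apply/row_matrixP => i.
rewrite !rowE -[delta_mx _ _]vec_mxK ?mulmxDr -scalemxAr !mul_rl.
by rewrite combDl combZl linearP.
Qed.
HB.instance Definition _ := GRing.isLinear.Build F AA _ _ rl rl_is_linear.

Lemma contract_comb (f : 'Hom(A, F^o)) X t :
  (forall a, f a = \tr (X *m a)) -> Defs.contract f t = comb t X.
Proof.
move=> fX; elim/tens_ind: t => [a b|s t hs ht]; first by rewrite contract_tens fX comb_tens.
rewrite combDl -hs -ht /Defs.contract -big_split; apply: eq_bigr => i _.
rewrite -big_split; apply: eq_bigr => j _; rewrite -big_split; apply: eq_bigr => k _.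
by rewrite -big_split; apply: eq_bigr => l _; rewrite tcoefD mulrDl scalerDl.
Qed.

Lemma trace_form_inj X : (forall a, \tr (X *m a) = 0) -> X = 0.
Proof.
move=> h; apply/matrixP => i j; have := h (delta_mx j i).
rewrite /mxtrace (bigD1 i) //= big1 ?addr0 => [|k ne].
  rewrite mxE (bigD1 j) //= big1 ?addr0 => [|k ne].
    by rewrite !mxE !eqxx mulr1.
  by rewrite mxE (negbTE ne) mulr0.
by rewrite mxE big1 // => m _; rewrite mxE (negbTE ne) andbF mulr0.
Qed.

Lemma nondegenerate_rl t : Defs.nondegenerate fullv t -> rl t \in unitmx.
Proof.
move=> [_ h]; apply/rl_unitP => X tX0.
pose g (a : A) : F^o := \tr (X *m a).
have gl : linear g by move=> c a b; rewrite /g ?mulmxDr -scalemxAr linearP.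
pose gL := GRing.isLinear.Build F A F^o _ g gl.
pose f : 'Hom(A, F^o) := linfun (HB.pack_for {linear A -> F^o} g gL).
have fE a : f a = \tr (X *m a) by rewrite /f lfunE.
apply: trace_form_inj => a; rewrite -fE; apply: h (memvf a).
by rewrite (contract_comb _ fE).
Qed.

End ThreeLegs.
(** * Limits and derivatives of matrix-valued functions *)

Section Tends.
Variables (K : numFieldType) (T : Type) (F : set_system T).
Hypothesis FF : Filter F.

(** The limit of f along a filter, sealed so that the lemmas below apply by
  the shape of f. *)
Record tends (V : normedModType K) (f : T -> V) (a : V) : Prop :=
  Tends { tends_cvg : f @ F --> a }.

Lemma tends_cst (V : normedModType K) (a : V) : tends (fun=> a) a.
Proof. by constructor; exact: cvg_cst. Qed.

Lemma tends_near (V : normedModType K) (f g : T -> V) a :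
  (\forall x \near F, f x = g x) -> tends f a -> tends g a.
Proof.
move=> fg [fa]; constructor; apply: cvg_trans fa; apply: near_eq_cvg.
by apply: filterS fg => x ->.
Qed.

Lemma tends_ext (V : normedModType K) (f g : T -> V) a b :
  (forall x, f x = g x) -> a = b -> tends f a -> tends g b.
Proof. by move=> fg <-; apply: tends_near; apply: nearW. Qed.

Lemma tendsD (V : normedModType K) (f g : T -> V) a b :
  tends f a -> tends g b -> tends (fun x => f x + g x) (a + b).
Proof. by move=> [fa] [gb]; constructor; exact: (cvgD fa gb). Qed.

Lemma tendsN (V : normedModType K) (f : T -> V) a :
  tends f a -> tends (fun x => - f x) (- a).
Proof. by move=> [fa]; constructor; exact: (cvgN fa). Qed.

Lemma tendsB (V : normedModType K) (f g : T -> V) a b :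
  tends f a -> tends g b -> tends (fun x => f x - g x) (a - b).
Proof. by move=> [fa] [gb]; constructor; exact: (cvgB fa gb). Qed.

Lemma tendsZ (V : normedModType K) (c : T -> K) (f : T -> V) k a :
  tends c k -> tends f a -> tends (fun x => c x *: f x) (k *: a).
Proof. by move=> [ck] [fa]; constructor; exact: (cvgZ ck fa). Qed.

Lemma tendsM (f g : T -> K) a b :
  tends f a -> tends g b -> tends (fun x => f x * g x) (a * b).
Proof. by move=> [fa] [gb]; constructor; exact: (cvgM fa gb). Qed.

Lemma tendsV (f : T -> K) a :
  a != 0 -> tends f a -> tends (fun x => (f x)^-1) a^-1.
Proof. by move=> a0 [fa]; constructor; exact: (cvgV a0 fa). Qed.

Lemma tends_sum (V : normedModType K) (I : Type) (r : seq I) (P : pred I)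
    (f : I -> T -> V) a :
  (forall i, P i -> tends (f i) (a i)) ->
  tends (fun x => \sum_(i <- r | P i) f i x) (\sum_(i <- r | P i) a i).
Proof.
move=> fa; elim: r => [|i r IH].
  by apply: (tends_ext _ _ (tends_cst (0 : V))) => [x|]; rewrite big_nil.
case Pi: (P i).
  apply: (tends_ext _ _ (tendsD (fa i Pi) IH)) => [x|];
  by rewrite big_cons Pi.
by apply: (tends_ext _ _ IH) => [x|]; rewrite big_cons Pi.
Qed.

Lemma tends_prod (I : Type) (r : seq I) (P : pred I) (f : I -> T -> K) a :
  (forall i, P i -> tends (f i) (a i)) ->
  tends (fun x => \prod_(i <- r | P i) f i x) (\prod_(i <- r | P i) a i).
Proof.
move=> fa; elim: r => [|i r IH].
  by apply: (tends_ext _ _ (tends_cst (1 : K))) => [x|]; rewrite big_nil.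
case Pi: (P i).
  apply: (tends_ext _ _ (tendsM (fa i Pi) IH)) => [x|];
  by rewrite big_cons Pi.
by apply: (tends_ext _ _ IH) => [x|]; rewrite big_cons Pi.
Qed.

Lemma tends_dist (V : normedModType K) (f : T -> V) a :
  tends f a <-> (forall eps, 0 < eps -> \forall t \near F, `|f t - a| < eps).
Proof.
split=> [[/cvgrPdist_lt fa] eps e0|fa].
  by apply: filterS (fa _ e0) => t; rewrite distrC.
by constructor; apply/cvgrPdist_lt => eps e0; apply: filterS (fa _ e0) => t; rewrite distrC.
Qed.

Lemma tends_norm0 (V : normedModType K) (f : T -> V) :
  tends f 0 <-> (forall eps, 0 < eps -> \forall t \near F, `|f t| < eps).
Proof.
by rewrite tends_dist; split=> h eps e0; apply: filterS (h _ e0) => t; rewrite subr0.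
Qed.

Lemma tends_neq0 (f : T -> K) a : a != 0 -> tends f a -> \forall t \near F, f t != 0.
Proof.
move=> a0 /tends_dist/(_ `|a|); rewrite normr_gt0 => /(_ a0).
by apply: filterS => t; apply: contraTneq => ->; rewrite sub0r normrN ltxx.
Qed.

Lemma tends_mx m n (f : T -> 'M[K]_(m, n)) a :
  tends f a <-> (forall i j, tends (fun x => f x i j) (a i j)).
Proof.
split=> [[fa] i j|fa].
  constructor; apply: (@cvg_comp _ _ _ f (fun M : 'M[K]_(m, n) => M i j) _ _ _ fa).
  exact: coord_continuous.
apply/tends_dist => eps e0.
have: \forall t \near F, forall i j, `|f t i j - a i j| < eps.
  apply: filter_forall => i; apply: filter_forall => j.
  by have /tends_dist := fa i j; apply.
apply: filterS => t h.
have : ball (a : 'M[K]_(m, n)) eps (f t).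
  by split=> // i j; rewrite -ball_normE /ball_ /= distrC.
by rewrite -ball_normE /ball_ /= distrC.
Qed.

Lemma tends_mulmx m n p (f : T -> 'M[K]_(m, n)) (g : T -> 'M[K]_(n, p)) a b :
  tends f a -> tends g b -> tends (fun x => f x *m g x) (a *m b).
Proof.
move=> /tends_mx fa /tends_mx gb; apply/tends_mx => i j.
apply: (tends_ext _ _ (tends_sum _ (fun k _ => tendsM (fa i k) (gb k j)))) => [x|];
by rewrite mxE.
Qed.

Lemma tends_lin m n p q (L : {linear 'M[K]_(m, n) -> 'M[K]_(p, q)})
    (f : T -> 'M[K]_(m, n)) a :
  tends f a -> tends (fun x => L (f x)) (L a).
Proof.
have LE u : L u = \sum_i \sum_j u i j *: L (delta_mx i j).
  rewrite {1}[u]matrix_sum_delta linear_sum; apply: eq_bigr => i _.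
  by rewrite linear_sum; apply: eq_bigr => j _; rewrite linearZ.
move=> /tends_mx fa; apply: (tends_ext _ _ (tends_sum (index_enum _) (fun i _ =>
  tends_sum (index_enum _) (fun j _ => tendsZ (fa i j) (tends_cst (L (delta_mx i j))))))).
  by move=> x; rewrite LE.
by rewrite LE.
Qed.

Lemma tends_tens m n p q (f : T -> 'M[K]_(m, n)) (g : T -> 'M[K]_(p, q)) a b :
  tends f a -> tends g b -> tends (fun x => f x *t g x) (a *t b).
Proof.
move=> /tends_mx fa /tends_mx gb; apply/tends_mx => i j.
apply: (tends_ext _ _ (tendsM (fa (mxtens_unindex i).1 (mxtens_unindex j).1)
   (gb (mxtens_unindex i).2 (mxtens_unindex j).2))) => [x|]; by rewrite mxE.
Qed.

Lemma tends_mxtrace n (f : T -> 'M[K]_n) a :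
  tends f a -> tends (fun x => \tr (f x)) (\tr a).
Proof. by move=> /tends_mx fa; apply: tends_sum => i _; exact: fa. Qed.

Lemma tends_scalar_mx n (f : T -> K) a :
  tends f a -> tends (fun x => (f x)%:M : 'M[K]_n) a%:M.
Proof.
move=> fa; apply: (tends_ext _ _ (tendsZ fa (tends_cst (1%:M : 'M[K]_n)))) => [x|];
by rewrite scalemx1.
Qed.

Lemma tends_det n (f : T -> 'M[K]_n) a :
  tends f a -> tends (fun x => \det (f x)) (\det a).
Proof.
move=> /tends_mx fa; apply: tends_sum => s _; apply: tendsM; first exact: tends_cst.
by apply: tends_prod => i _; exact: fa.
Qed.

Lemma tends_unit n (f : T -> 'M[K]_n) a :
  a \in unitmx -> tends f a -> \forall t \near F, f t \in unitmx.
Proof.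
move=> ua fa; have da : \det a != 0 by rewrite -unitfE.
by apply: filterS (tends_neq0 da (tends_det fa)) => t; rewrite unitmxE unitfE.
Qed.

Lemma tends_inv n (f : T -> 'M[K]_n) a :
  a \in unitmx -> tends f a -> tends (fun x => invmx (f x)) (invmx a).
Proof.
move=> ua fa.
have da : \det a != 0 by rewrite -unitfE.
apply: (@tends_near _ (fun x => (\det (f x))^-1 *: \adj (f x))).
  by apply: filterS (tends_unit ua fa) => t ut; rewrite /invmx ut.
rewrite /invmx ua; apply: tendsZ; first exact/tendsV/tends_det.
apply/tends_mx => i j.
suff h : tends (fun x => cofactor (f x) j i) (cofactor a j i).
  by apply: (tends_ext _ _ h) => [x|]; rewrite mxE.
apply: tendsM; first exact: tends_cst.
apply: tends_det; apply/tends_mx => k l.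
have /tends_mx := fa; move=> /(_ (lift j k) (lift i l)).
by move=> h; apply: (tends_ext _ _ h) => [x|]; rewrite !mxE.
Qed.

End Tends.

Lemma tends_unique (K : numFieldType) (T : Type) (F : set_system T) (FF : ProperFilter F)
    (V : normedModType K) (f : T -> V) a b : tends F f a -> tends F f b -> a = b.
Proof. by move=> [fa] [fb]; apply: (cvg_unique _ fa fb); exact: norm_hausdorff. Qed.

(** An injective limit matrix has the right inverse K0 = pinvmx T0; along F the
  matrix T t K0 is eventually invertible and U t = y t K0 (T t K0)^-1. *)
Lemma solve_limit (K : numFieldType) (X : Type) (F : set_system X) (FF : Filter F)
    n p (T : X -> 'M[K]_(n, p)) T0 (U : X -> 'rV_n) (y : X -> 'rV_p) y0 :
  (forall u : 'rV_n, u *m T0 = 0 -> u = 0) ->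
  tends F T T0 -> tends F y y0 -> (\forall t \near F, U t *m T t = y t) ->
  exists U0, tends F U U0.
Proof.
move=> inj TT yy Uy.
have rf : row_free T0.
  rewrite -kermx_eq0; apply/eqP/row_matrixP => i; rewrite row0.
  by apply: inj; rewrite -row_mul mulmx_ker row0.
have T01 : T0 *m pinvmx T0 = 1%:M by rewrite mulmxV_row_free || exact: mulmxVp.
have TP := tends_mulmx FF TT (tends_cst FF (pinvmx T0)).
have u1 : T0 *m pinvmx T0 \in unitmx by rewrite T01 unitmx1.
exists (y0 *m pinvmx T0 *m invmx (T0 *m pinvmx T0)).
apply: (@tends_near _ _ _ _ _ (fun t => y t *m pinvmx T0 *m invmx (T t *m pinvmx T0))).
  apply: filterS2 Uy (tends_unit FF u1 TP) => t <- ut.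
  by rewrite -[_ *m T t *m _]mulmxA mulmxK.
apply: tends_mulmx; first exact: tends_mulmx yy (tends_cst FF _).
exact: tends_inv.
Qed.

Section HasDer.
Variable K : numFieldType.
Implicit Types (z h : K).

(** Differentiability and the value of the derivative in one relation, so that
  the rules of calculus carry no side conditions. *)
Definition hasder (V : normedModType K) (f : K -> V) z (d : V) :=
  tends 0^' (fun h => h^-1 *: (f (z + h) - f z)) d.

Local Notation FD := (@dnbhs_filter _ (0 : K)).

Lemma dnbhs_neq0 : \forall h \near (0 : K)^', h != 0.
Proof. exact: nbhs_dnbhs_neq. Qed.

Lemma tends_id0 : tends (0 : K)^' (fun h : K => h) (0 : K).
Proof. by constructor; exact: nbhs_dnbhs. Qed.

Lemma hasder_unique (V : normedModType K) (f : K -> V) z d d' :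
  hasder f z d -> hasder f z d' -> d = d'.
Proof. exact: tends_unique. Qed.

Lemma near_dnbhs0 (P : K -> Prop) z : (\forall w \near z, P w) ->
  \forall h \near (0 : K)^', P (z + h).
Proof.
move=> Pz; have : \forall h \near (0 : K), P (z + h).
  by move: Pz; rewrite (near_shift 0); apply: filterS => h /=; rewrite subr0 addrC.
exact: nbhs_dnbhs.
Qed.

Lemma hasder_near (V : normedModType K) (f g : K -> V) z d :
  (\forall w \near z, f w = g w) -> hasder f z d -> hasder g z d.
Proof.
move=> fg; have fgz := nbhs_singleton fg; apply: tends_near.
by apply: filterS (near_dnbhs0 fg) => h ->; rewrite fgz.
Qed.

Lemma hasder_ext (V : normedModType K) (f g : K -> V) z d d' :
  (forall w, f w = g w) -> d = d' -> hasder f z d -> hasder g z d'.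
Proof.
move=> fg <-; have fg' : \forall w \near z, f w = g w by apply: filterE.
exact: hasder_near fg'.
Qed.

Lemma hasder_tends (V : normedModType K) (f : K -> V) z d :
  hasder f z d -> tends 0^' (fun h => f (z + h)) (f z).
Proof.
move=> fd; have := tendsD FD (tendsZ FD tends_id0 fd) (tends_cst FD (f z)).
rewrite scale0r add0r; apply: tends_near.
by apply: filterS dnbhs_neq0 => h h0; rewrite scalerA divff // scale1r subrK.
Qed.

Lemma hasder_cvg (V : normedModType K) (f : K -> V) z d :
  hasder f z d -> tends (nbhs z) f (f z).
Proof.
move=> /hasder_tends /(tends_dist FD) fd; apply/(tends_dist _) => eps e0.
have := fd _ e0; rewrite /dnbhs near_withinE => fe.
have : \forall h \near (0 : K), `|f (z + h) - f z| < eps.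
  apply: filterS fe => h; have [->|h0 /(_ isT)//] := eqVneq h 0.
  by rewrite addr0 subrr normr0.
move=> fe0; suff : \forall t \near z, `|f t - f z| < eps by [].
rewrite (near_shift 0); apply: filterS fe0 => h /=.
by rewrite subr0 [h + z]addrC.
Qed.

Lemma hasder_cst (V : normedModType K) (a : V) z : hasder (fun=> a) z 0.
Proof.
by apply: (tends_ext FD _ _ (tends_cst FD (0 : V))) => // h; rewrite subrr scaler0.
Qed.

Lemma hasder_id z : hasder (fun w : K => w) z 1.
Proof.
apply: (tends_near FD _ (tends_cst FD (1 : K))).
by apply: filterS dnbhs_neq0 => h h0; rewrite addrAC subrr add0r /GRing.scale /= mulVf.
Qed.

Lemma hasderD (V : normedModType K) (f g : K -> V) z d d' :
  hasder f z d -> hasder g z d' -> hasder (fun w => f w + g w) z (d + d').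
Proof.
move=> fd gd; apply: (tends_ext FD _ _ (tendsD FD fd gd)) => // h.
by rewrite -scalerDr; congr (_ *: _); rewrite addrACA opprD.
Qed.

Lemma hasderN (V : normedModType K) (f : K -> V) z d :
  hasder f z d -> hasder (fun w => - f w) z (- d).
Proof.
move=> fd; apply: (tends_ext FD _ _ (tendsN FD fd)) => // h.
by rewrite -scalerN opprB opprK addrC.
Qed.

Lemma hasderB (V : normedModType K) (f g : K -> V) z d d' :
  hasder f z d -> hasder g z d' -> hasder (fun w => f w - g w) z (d - d').
Proof. by move=> fd gd; exact: hasderD fd (hasderN gd). Qed.

Lemma hasder_lin m n p q (L : {linear 'M[K]_(m, n) -> 'M[K]_(p, q)}) f z d :
  hasder f z d -> hasder (fun w => L (f w)) z (L d).
Proof.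
move=> fd; apply: (tends_ext FD _ _ (tends_lin FD L fd)) => // h.
by rewrite linearZ linearB.
Qed.

Lemma hasderM m n p (f : K -> 'M[K]_(m, n)) (g : K -> 'M[K]_(n, p)) z d d' :
  hasder f z d -> hasder g z d' ->
  hasder (fun w => f w *m g w) z (d *m g z + f z *m d').
Proof.
move=> fd gd; apply: (tends_ext FD _ _ (tendsD FD
  (tends_mulmx FD fd (hasder_tends gd)) (tends_mulmx FD (tends_cst FD (f z)) gd))) => // h.
rewrite -scalemxAl -scalemxAr -scalerDr; congr (_ *: _).
by rewrite mulmxBl mulmxBr addrA subrK.
Qed.

Lemma hasder_opp (V : normedModType K) (f : K -> V) z d :
  hasder f (- z) d -> hasder (fun w => f (- w)) z (- d).
Proof.
move=> fd; have {fd} : tends (0 : K)^' (fun h => (- h)^-1 *: (f (- z + - h) - f (- z))) d.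
  apply/(tends_dist FD) => eps e0; have /(tends_dist FD)/(_ _ e0) := fd.
  rewrite /dnbhs !near_withinE => h1.
  have : \forall h \near - (0 : K), h != 0 -> `|h^-1 *: (f (- z + h) - f (- z)) - d| < eps.
    by rewrite oppr0.
  rewrite nearN; apply: filterS => h /= hh h0; apply: hh.
  by rewrite oppr_eq0.
move=> /(tendsN FD); apply: (tends_ext FD) => // h.
by rewrite invrN scaleNr opprK opprD.
Qed.

Lemma hasder_derivable (V : normedModType K) (f : K -> V) z :
  derivable f z 1 <-> exists d, hasder f z d.
Proof.
have E : (fun h : K => h^-1 *: ((f \o shift z) (h *: 1) - f z)) =
         (fun h => h^-1 *: (f (z + h) - f z)).
  apply/funext => h; congr (_ *: (f _ - _)); rewrite /= [RHS]addrC; congr (_ + _).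
  exact: mulr1.
rewrite /derivable E; split=> [/cvg_ex[d fd]|[d [fd]]]; first by exists d; constructor.
by apply/cvg_ex; exists d.
Qed.

Lemma hasderVs (f : K -> K) z (d : K) :
  f z != 0 -> hasder f z d -> hasder (fun w => (f w)^-1) z (- d / f z ^+ 2).
Proof.
move=> fz0 fd.
have fn : \forall h \near (0 : K)^', f (z + h) != 0.
  exact: (tends_neq0 FD fz0 (hasder_tends fd)).
have := tendsM FD (tendsN FD fd) (tendsM FD (tendsV FD fz0 (hasder_tends fd))
  (tends_cst FD (f z)^-1)).
rewrite -invfM -expr2; apply: (tends_near FD).
apply: filterS fn => h fh0; rewrite /GRing.scale /=.
by rewrite mulNr -mulrA -mulrN; congr (_ * _); field; rewrite fz0 fh0.
Qed.

End HasDer.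
(** * Uniqueness for linear differential equations in the complex plane *)

Section ComplexODE.
Variable R : realType.
Local Notation C := (Cplx R).
Local Notation rc x := ((x : R)%:C%C : C).
Implicit Types (x y z w : C) (s t : R).

Lemma rcD s t : rc (s + t) = rc s + rc t.
Proof. by apply/eqP; rewrite eq_complex /= addr0 !eqxx. Qed.

Lemma rcB s t : rc (s - t) = rc s - rc t.
Proof. by apply/eqP; rewrite eq_complex /= subr0 !eqxx. Qed.

Lemma rcM s t : rc (s * t) = rc s * rc t.
Proof. by apply/eqP; rewrite eq_complex /= !mulr0 !mul0r subr0 addr0 !eqxx. Qed.

Lemma rc_lt s t : (rc s < rc t) = (s < t).
Proof. exact: ltcR. Qed.

Lemma rc_le s t : (rc s <= rc t) = (s <= t).
Proof. exact: lecR. Qed.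

Lemma posC (eps : C) : 0 < eps -> exists2 r : R, 0 < r & eps = rc r.
Proof.
case: eps => a b; rewrite ltcE /= => /andP[/eqP -> a0].
by exists a.
Qed.

Lemma normC_rc (z : C) : exists2 r : R, 0 <= r & `|z| = rc r.
Proof.
exists (Num.sqrt (complex.Re z ^+ 2 + complex.Im z ^+ 2)); first exact: sqrtr_ge0.
by rewrite normc_def.
Qed.

Lemma norm_rc s : `|rc s| = rc `|s|.
Proof. by rewrite normc_def /= expr0n addr0 sqrtr_sqr. Qed.

Lemma near_line (P : set C) y w t :
  (\forall z \near y + rc t * w, P z) -> \forall s \near t, P (y + rc s * w).
Proof.
move=> /nbhs_ballP[e /= /posC[r r0 ->] bP].
have [n n0 nw] := normC_rc w.
apply/nbhs_ballP; exists (r / (n + 1)) => /=; first by rewrite divr_gt0 // ltr_wpDl.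
move=> s; rewrite -ball_normE /ball_ /= => ts; apply: bP.
rewrite -ball_normE /ball_ /= opprD addrACA subrr add0r -mulrBl normrM nw.
rewrite -rcB norm_rc -rcM rc_lt.
have n1 : 0 < n + 1 by rewrite ltr_wpDl.
rewrite ltr_pdivlMr // in ts; apply: le_lt_trans ts.
by rewrite ler_wpM2l // lerDl.
Qed.

(** Connectedness of the segment from y to y + w: the points near which Q holds
  and those near which it fails form two open sets. *)
Lemma segment_ind (Q : C -> Prop) y w :
  (forall t, 0 <= t <= 1 ->
     (\forall z \near y + rc t * w, Q z) \/ (\forall z \near y + rc t * w, ~ Q z)) ->
  Q y -> Q (y + w).
Proof.
move=> QN Qy.
pose A := [set` `[0, 1 : R]].
pose U := [set t : R | \forall s \near t, Q (y + rc s * w)].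
pose V := [set t : R | \forall s \near t, ~ Q (y + rc s * w)].
have opP (P : R -> Prop) : open [set t : R | \forall s \near t, P s].
  by rewrite openE => t /= Pt; exact: (near_join Pt).
have AE t : A t <-> 0 <= t <= 1 by rewrite /A /= in_itv /=.
have dich t : A t -> U t \/ V t.
  by move=> /AE /QN[] /near_line h; [left|right].
have disj t : U t -> ~ V t.
  by move=> /nbhs_singleton Ut /nbhs_singleton /(_ Ut).
have Q0 : A 0 /\ U 0.
  have A0 : A 0 by apply/AE; rewrite lexx ler01.
  split => //; case: (dich _ A0) => // /nbhs_singleton; rewrite mul0r addr0.
  by move=> /(_ Qy).
have BA : A `&` U = A.
  apply: (@segment_connected R 0 1).
  - by exists 0.
  - by exists U => //; exact: opP.
  - exists (~` V); first by apply: open_closedC; exact: opP.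
    apply/seteqP; split=> t [At]; first by move=> /disj.
    by move=> nV; case: (dich _ At).
have A1 : A 1 by apply/AE; rewrite lexx ler01.
have : (A `&` U) 1 by rewrite BA.
by move=> [_ /nbhs_singleton]; rewrite mul1r.
Qed.

Lemma hasder_is_derive (K : numFieldType) (V : normedModType K) (f : K -> V) (z : K) (d : V) :
  hasder f z d -> is_derive z 1 f d.
Proof.
move=> fd; have dz : derivable f z 1 by apply/hasder_derivable; exists d.
apply: DeriveDef => //.
suff [d' fd' ->] : exists2 d', hasder f z d' & 'D_1 f z = d' by apply: hasder_unique fd' fd.
exists ('D_1 f z) => //; constructor; rewrite /derive.
have E : (fun h : K => h^-1 *: ((f \o shift z) (h *: 1) - f z)) =
         (fun h => h^-1 *: (f (z + h) - f z)).
  apply/funext => h; congr (_ *: (f _ - _)); rewrite /= [RHS]addrC; congr (_ + _).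
  exact: mulr1.
by move: dz; rewrite /derivable /= E.
Qed.

Lemma hasder_line (f : C -> C) y w t d : hasder f (y + rc t * w) d ->
  hasder (fun s : R => complex.Re (f (y + rc s * w)) : R) t (complex.Re (d * w)).
Proof.
have [->|w0] := eqVneq w 0.
  rewrite !mulr0 => _; apply: hasder_ext (hasder_cst (complex.Re (f y) : R) t) => // s.
  by rewrite mulr0 addr0.
move=> fd; apply/tends_dist => eps e0.
have [n n0 nw] := normC_rc w.
have npos : 0 < n.
  by rewrite -rc_lt -nw normr_gt0.
have e1 : 0 < rc (eps / n) by rewrite rc_lt divr_gt0.
have /tends_dist/(_ _ e1) := fd; rewrite /dnbhs !near_withinE.
have {1}-> : (0 : C) = 0 + rc 0 * w by rewrite mul0r addr0.
move=> /near_line; apply: filterS => s h s0.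
have rs0 : rc s != 0 by apply: contra_neq s0 => -[].
have {h} := h _; rewrite add0r mulf_neq0 // => /(_ isT).
set q := _ - d; rewrite -rc_lt -norm_rc => qe.
have -> : s^-1 *: ((complex.Re (f (y + rc (t + s) * w)) : R)
   - complex.Re (f (y + rc t * w))) - complex.Re (d * w) = complex.Re (q * w).
  rewrite /q; set u := f (y + rc (t + s) * w); set v := f (y + rc t * w).
  have -> : u = f (y + rc t * w + rc s * w).
    by rewrite /u rcD mulrDl addrA.
  have -> : ((rc s * w)^-1 *: (f (y + rc t * w + rc s * w) - v) - d) * w =
     rc s^-1 * (f (y + rc t * w + rc s * w) - v) - d * w.
    rewrite /GRing.scale /= mulrBl; congr (_ - _).
    have -> : rc s^-1 = (rc s)^-1 by rewrite fmorphV.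
    by field; rewrite w0 rs0.
  move: (f _) (d * w) v => [a1 a2] [b1 b2] [c1 c2] /=.
  by rewrite /GRing.scale /= mul0r subr0.
have : `|q * w| < rc eps.
  rewrite normrM nw; apply: (lt_le_trans (y := rc (eps / n) * rc n)).
    by rewrite ltr_pM2r // rc_lt.
  by rewrite -rcM divfK // gt_eqF.
apply: le_lt_trans; rewrite norm_rc; exact: normc_ge_Re.
Qed.

(** The mean value theorem applies to real parts along a segment; applied to f
  and to - i f it bounds f, at the price of a factor 2. *)
Lemma Re_mean_value (f f' : C -> C) (k : R) y w :
  (forall t, 0 <= t <= 1 -> hasder f (y + rc t * w) (f' (y + rc t * w))) ->
  (forall t, 0 <= t <= 1 -> `|f' (y + rc t * w)| <= rc k) ->
  rc `|complex.Re (f (y + w) - f y)| <= rc k * `|w|.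
Proof.
move=> fd fk.
pose g (s : R) : R := complex.Re (f (y + rc s * w)).
pose dg (s : R) : R := complex.Re (f' (y + rc s * w) * w).
have gd s : 0 <= s <= 1 -> hasder g s (dg s) by move=> /fd; exact: hasder_line.
case: (@MVT_segment R g dg 0 1 ler01) => [c||c cI].
- rewrite in_itv /= => /andP[/ltW c0 /ltW c1].
  by apply: hasder_is_derive; apply: gd; rewrite c0 c1.
- apply: continuous_in_subspaceT => c; rewrite inE /= in_itv /= => cI.
  by have [] := hasder_cvg (gd _ cI).
move: cI; rewrite in_itv /= => cI; rewrite subr0 mulr1 /g mul1r mul0r addr0.
have -> : complex.Re (f (y + w)) - complex.Re (f y) = complex.Re (f (y + w) - f y).
  by case: (f (y + w)) (f y) => [a b] [a' b'].
move=> ->; apply: (le_trans (normc_ge_Re _)); rewrite normrM.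
by apply: ler_wpM2r => //; exact: fk.
Qed.

Lemma mean_value (f f' : C -> C) (k : R) y w :
  (forall t, 0 <= t <= 1 -> hasder f (y + rc t * w) (f' (y + rc t * w))) ->
  (forall t, 0 <= t <= 1 -> `|f' (y + rc t * w)| <= rc k) ->
  `|f (y + w) - f y| <= rc (2 * k) * `|w|.
Proof.
move=> fd fk.
pose i : C := 'i%C.
have ni : `|i| = 1 by rewrite normc_def /= expr0n expr1n add0r sqrtr1.
have h1 := Re_mean_value fd fk.
have h2 : rc `|complex.Re ((- i * f (y + w)) - (- i * f y))| <= rc k * `|w|.
  apply: (@Re_mean_value (fun z => - i * f z) (fun z => - i * f' z)).
    move=> t /fd ft; have c := @hasder_cst _ C (- i) (y + rc t * w).
    apply: (tends_ext _ _ _ (tendsM _ (tends_cst _ (- i : C)) ft)) => // h.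
    by rewrite /GRing.scale /= -mulrBr mulrCA.
  by move=> t /fk ft; rewrite normrM normrN ni mul1r.
have -> : rc (2 * k) * `|w| = rc k * `|w| + rc k * `|w|.
  by rewrite -mulrDl -rcD -mulr2n mulr_natl.
apply: le_trans (lerD h1 h2).
rewrite -mulrBr; move: (f _ - f y) => v.
have {1}-> : v = rc (complex.Re v) + i * rc (complex.Re (- i * v)).
  by case: v => a b; apply/eqP; rewrite eq_complex /=; apply/andP; split; apply/eqP; ring.
apply: (le_trans (ler_normD _ _)).
by rewrite normrM ni mul1r !norm_rc.
Qed.

End ComplexODE.

Section LinearODE.
Variable R : realType.
Local Notation C := (Cplx R).
Local Notation rc x := ((x : R)%:C%C : C).
Implicit Types (x y z w : C) (s t : R).

Lemma mx_bound m n (A : 'M[C]_(m, n)) :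
  exists2 k : R, 0 < k & forall i j, `|A i j| <= rc k.
Proof.
have S0 : 0 <= \sum_i \sum_j `|A i j| by apply: sumr_ge0 => i _; apply: sumr_ge0.
have [|k k0 kE] := @posC R (\sum_i \sum_j `|A i j| + 1).
  by rewrite ltr_wpDl.
exists k => // i j; rewrite -kE (bigD1 i) //= (bigD1 j) //= -!addrA lerDl.
rewrite !addr_ge0 //; first exact: sumr_ge0.
by apply: sumr_ge0 => i' _; apply: sumr_ge0.
Qed.

Lemma rcMn s n : rc (s *+ n) = rc s *+ n.
Proof. by elim: n => [|n IH]; rewrite ?mulr0n // !mulrS rcD IH. Qed.

Lemma tends_bound (F : set_system C) (FF : Filter F) m n (A : C -> 'M[C]_(m, n)) a :
  tends F A a -> exists2 k : R, 0 < k & \forall v \near F, forall i j, `|A v i j| <= rc k.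
Proof.
move=> Aa; have [k k0 ka] := mx_bound a; exists (k + 1); first by rewrite addr_gt0.
apply: filter_forall => i; apply: filter_forall => j.
have /tends_mx/(_ i j)/tends_dist/(_ 1 ltr01) := Aa.
apply: filterS => v h; rewrite rcD -[A v i j](subrK (a i j)).
by apply: (le_trans (ler_normD _ _)); rewrite addrC lerD // ltW.
Qed.

Lemma halving_zero (b : C) (B : R) : (forall k : nat, `|b| <= rc (B / 2 ^+ k)) -> b = 0.
Proof.
move=> h; have [r r0 br] := normC_rc b.
apply/eqP; rewrite -normr_eq0 br; apply/eqP; congr (rc _); apply/eqP.
rewrite eq_le r0 andbT leNgt; apply/negP => rpos.
have hk k : r * k%:R <= B.
  have := h k; rewrite br rc_le ler_pdivlMr ?exprn_gt0 //; apply: le_trans.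
  by rewrite ler_wpM2l // -natrX ler_nat ltnW // ltn_expl.
have := hk (Num.Def.archi_bound `|B / r|).
rewrite leNgt mulrC -ltr_pdivrMr // (le_lt_trans (ler_norm _)) //.
exact: archi_boundP.
Qed.

(** On a small ball around z the mean value inequality improves any bound of W by
  a factor 2; iterating, W vanishes there. *)
Lemma linear_ode_local m n (W : C -> 'M[C]_(m, n)) (M : C -> 'M[C]_m) z :
  (\forall v \near z, hasder W v (M v *m W v)) -> tends (nbhs z) M (M z) ->
  W z = 0 -> \forall v \near z, W v = 0.
Proof.
move=> dW cM Wz.
have [k k0 Mk] := tends_bound _ cM.
have cW : tends (nbhs z) W (W z) by exact: hasder_cvg (nbhs_singleton dW).
have [b b0 Wb] := tends_bound _ cW.
have : \forall v \near z, [/\ hasder W v (M v *m W v), forall i j, `|M v i j| <= rc k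
    & forall i j, `|W v i j| <= rc b] by apply: filterS3 dW Mk Wb.
move=> /nbhs_ballP[_ /= /posC[d d0 ->] dP].
(* m k bounds the row sums of M, and the mean value inequality costs a factor 2,
  so that the radius (4 l)^-1 gives the contraction factor 1 / 2 *)
pose l : R := m%:R * k + 1.
have l0 : 0 < l by rewrite ltr_wpDl // mulr_ge0 // ltW.
pose rho := Num.min d (4 * l)^-1.
have rho0 : 0 < rho by rewrite lt_min d0 invr_gt0 mulr_gt0.
have rhod v : ball z (rc rho) v -> ball z (rc d) v.
  by apply: le_ball; rewrite rc_le ge_min lexx.
have step (B : R) : 0 <= B -> (forall v, ball z (rc rho) v -> forall i j, `|W v i j| <= rc B) ->
    forall v, ball z (rc rho) v -> forall i j, `|W v i j| <= rc (B / 2).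
  move=> B0 hB v vz i j.
  have seg t : 0 <= t <= 1 -> ball z (rc rho) (z + rc t * (v - z)).
    move=> /andP[t0 t1]; rewrite -ball_normE /ball_ /= opprD addNKr normrN normrM norm_rc.
    move: vz; rewrite -ball_normE /ball_ /= distrC; apply: le_lt_trans.
    by rewrite ler_piMl // (ger0_norm t0) -[1]/(rc 1) rc_le.
  have := @mean_value R (fun v => W v i j) (fun v => (M v *m W v) i j) (m%:R * k * B) z (v - z).
  rewrite subrKC Wz mxE subr0 => h.
  apply: (le_trans (h _ _)) => {h}.
  - move=> t /seg/rhod/dP[h _ _].
    by have /tends_mx/(_ i j) := h; apply: tends_ext => // x; rewrite !mxE.
  - move=> t /seg st; have [_ Mt _] := dP _ (rhod _ st).
    rewrite mxE; apply: (le_trans (ler_norm_sum _ _ _)).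
    have -> : rc (m%:R * k * B) = \sum_(p < m) rc k * rc B.
      rewrite sumr_const card_ord -!rcM -mulrA mulr_natl; exact: rcMn.
    apply: ler_sum => p _; rewrite normrM; apply: ler_pM => //; exact: hB.
  - have vz' : `|v - z| <= rc (4 * l)^-1.
      move: vz; rewrite -ball_normE /ball_ /= distrC => /ltW /le_trans; apply.
      by rewrite rc_le ge_min lexx orbT.
    apply: (le_trans (y := rc (2 * (m%:R * k * B)) * rc (4 * l)^-1)).
      by apply: ler_wpM2l => //; rewrite -[0]/(rc 0) rc_le !mulr_ge0 // ltW.
    rewrite -rcM rc_le ler_pdivrMr ?mulr_gt0 //.
    have -> : B / 2 * (4 * l) = 2 * (B * l) by field.
    rewrite -[_ * B]mulrC ler_pM2l // ler_wpM2l // /l lerDl //.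
have all0 (q : nat) v : ball z (rc rho) v -> forall i j, `|W v i j| <= rc (b / 2 ^+ q).
  elim: q v => [|q IH] v vz i j; last first.
    rewrite exprSr invfM mulrA; apply: step IH _ vz _ _.
    by rewrite divr_ge0 ?exprn_ge0 // ltW.
  by rewrite expr0 divr1; have [_ _] := dP _ (rhod _ vz).
apply/nbhs_ballP; exists (rc rho) => [|v vz] /=; first by rewrite -[0]/(rc 0) rc_lt.
by apply/matrixP => i j; rewrite mxE; apply: halving_zero => q; exact: all0.
Qed.

Lemma mx_neq0_near m n (W : C -> 'M[C]_(m, n)) z :
  tends (nbhs z) W (W z) -> W z <> 0 -> \forall v \near z, W v <> 0.
Proof.
move=> cW Wz.
have [i [j Wij]] : exists i j, W z i j != 0.
  apply: contrapT => h; apply: Wz; apply/matrixP => i j; rewrite mxE.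
  by apply/eqP/negP => /negP hij; apply: h; exists i, j.
have /tends_mx/(_ i j) /(tends_neq0 _ Wij) := cW.
by apply: filterS => v h e; move: h; rewrite e mxE eqxx.
Qed.

(** A punctured disc is connected: x is first moved to its quarter turn m on the
  side of y, along a segment avoiding 0, and the segment from m to y avoids 0
  as well. *)
Lemma punctured_turn (x y : C) : x != 0 -> y != 0 ->
  exists m : C, `|m| = `|x| /\
    (forall t, 0 <= t <= 1 -> x + rc t * (m - x) != 0) /\
    (forall t, 0 <= t <= 1 -> m + rc t * (y - m) != 0).
Proof.
move=> x0 y0; pose zt := y / x; have yE : y = zt * x by rewrite /zt divfK.
have zt0 : zt != 0 by rewrite mulf_neq0 // invr_eq0.
have [s [sE bs]] : exists s : R, (s = 1 \/ s = -1) /\ 0 <= s * complex.Im zt.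
  have [b0|b0] := leP 0 (complex.Im zt); first by exists 1; split; [left|rewrite mul1r].
  by exists (-1); split; [right|rewrite mulN1r oppr_ge0 ltW].
pose u : C := Complex 0 s.
have nu : `|u| = 1.
  rewrite normc_def /= expr0n add0r.
  by case: sE => ->; rewrite ?sqrrN expr1n sqrtr1.
exists (u * x); split; first by rewrite normrM nu mul1r.
split=> t /andP[t0 t1].
  have -> : x + rc t * (u * x - x) = (1 + rc t * (u - 1)) * x by ring.
  rewrite mulf_neq0 //; apply/eqP => /eqP; rewrite eq_complex /= => /andP[/eqP e1 /eqP e2].
  by move: e1 e2; case: sE => ->; lra.
rewrite {1}yE; have -> : u * x + rc t * (zt * x - u * x) = (u + rc t * (zt - u)) * x by ring.
rewrite mulf_neq0 //; apply/eqP => /eqP; rewrite eq_complex /= => /andP[/eqP e1 /eqP e2].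
move: zt0 bs e1 e2; case: (zt) => a b /= zt0 bs e1 e2.
have tb : 0 <= t * (s * b) by rewrite mulr_ge0.
have t1' : t = 1 by case: sE tb e2 => -> tb e2; nra.
move: e1 e2 zt0; rewrite t1' eq_complex /= => e1 e2 /negP[].
have -> : a = 0 by lra.
have -> : b = 0 by lra.
by rewrite !eqxx.
Qed.

Lemma norm_segment (d p q : C) t :
  `|p| < d -> `|q| < d -> 0 <= t <= 1 -> `|p + rc t * (q - p)| < d.
Proof.
move=> pd qd /andP[t0 t1].
have d0 : 0 < d by apply: le_lt_trans pd.
have -> : p + rc t * (q - p) = rc (1 - t) * p + rc t * q.
  by rewrite rcB; ring.
apply: (le_lt_trans (ler_normD _ _)); rewrite !normrM !norm_rc.
have h1t : `|1 - t| = 1 - t by rewrite ger0_norm ?subr_ge0.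
rewrite (ger0_norm t0) h1t.
have [->|tn1] := eqVneq t 1.
  have -> : rc (1 - 1) = 0 by rewrite subrr.
  have -> : rc 1 = 1 by [].
  by rewrite mul0r add0r mul1r.
have -> : d = rc (1 - t) * d + rc t * d by rewrite rcB; ring.
apply: ltr_leD.
  by rewrite ltr_pM2l // -[0]/(rc 0) rc_lt subr_gt0 lt_neqAle tn1.
by apply: ler_wpM2l; [rewrite -[0]/(rc 0) rc_le|exact: ltW].
Qed.

Lemma near_neq z w : w != z -> \forall u \near w, u != z.
Proof.
move=> wz; apply/nbhs_ballP; exists `|w - z|; first by rewrite /= normr_gt0 subr_eq0.
move=> u; rewrite -ball_normE /ball_ /= => h; apply: contraTneq h => ->.
by rewrite ltxx.
Qed.

(** A locally constant property is constant around a puncture, by connectedness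
  of the punctured disc. *)
Lemma punctured_zero (D : set C) (Q : C -> Prop) z (d : C) : 0 < d ->
  (forall v, ball z d v -> v != z -> D v) ->
  (forall v, D v -> (\forall w \near v, Q w) \/ (\forall w \near v, ~ Q w)) ->
  (\forall w \near z^', Q w) \/ (\forall w \near z^', ~ Q w).
Proof.
move=> d0 dD dich.
have pb : \forall w \near z^', ball z d w /\ w != z.
  by rewrite /dnbhs near_withinE; have := nbhsx_ballx z d d0; apply: filterS.
have bE v : ball z d v = (`|v - z| < d).
  by rewrite -ball_normE /ball_ /= distrC.
have [[x [xb [xz Qx]]]|none] := pselect (exists x, ball z d x /\ x != z /\ Q x); last first.
  by right; apply: filterS pb => w [wb wz] Qw; apply: none; exists w.
left; apply: filterS pb => y [yb yz].
have xz0 : x - z != 0 by rewrite subr_eq0.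
have yz0 : y - z != 0 by rewrite subr_eq0.
have [m [mn [m1 m2]]] := punctured_turn xz0 yz0.
have xd : `|x - z| < d by rewrite -bE.
have yd : `|y - z| < d by rewrite -bE.
have md : `|m| < d by rewrite mn.
have Qm : Q (x + (m - (x - z))).
  apply: segment_ind Qx => t t01; apply: dich.
  have E : x + rc t * (m - (x - z)) - z = (x - z) + rc t * (m - (x - z)) by ring.
  apply: dD; first by rewrite bE E; apply: norm_segment.
  by rewrite -subr_eq0 E m1.
have -> : y = (x + (m - (x - z))) + ((y - z) - m) by ring.
apply: segment_ind Qm => t t01; apply: dich.
have E : x + (m - (x - z)) + rc t * (y - z - m) - z = m + rc t * (y - z - m) by ring.
apply: dD; first by rewrite bE E; apply: norm_segment.
by rewrite -subr_eq0 E m2.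
Qed.

(** The set where W vanishes is open and closed in D, and around a point of the
  disc missing from D it contains either all points or none. The vanishing of W
  on a punctured neighbourhood is therefore a locally constant property of all
  points of the disc, and it propagates along segments, even those that leave
  D. *)
Lemma linear_ode_global (e : R) (D : set C) m n (W : C -> 'M[C]_(m, n))
    (M : C -> 'M[C]_m) v1 v :
  (forall z, D z -> disc e z) ->
  (forall z, D z -> \forall w \near z, D w) ->
  (forall z, disc e z -> \forall w \near z^', D w) ->
  (forall z, D z -> hasder W z (M z *m W z)) ->
  (forall z, D z -> tends (nbhs z) M (M z)) ->
  D v1 -> W v1 = 0 -> D v -> W v = 0.
Proof.
move=> Dd Do Dg dW cM Dv1 W1 Dv.
have dich z : D z -> (\forall w \near z, W w = 0) \/ (\forall w \near z, W w <> 0).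
  move=> Dz; have [Wz|Wz] := pselect (W z = 0); [left|right].
    by apply: linear_ode_local Wz; [apply: filterS (Do _ Dz)|apply: cM].
  by apply: mx_neq0_near Wz; apply: hasder_cvg (dW _ Dz).
have pz z : disc e z -> (\forall w \near z^', W w = 0) \/ (\forall w \near z^', W w <> 0).
  move=> /Dg; rewrite /dnbhs !near_withinE => /nbhs_ballP[d /= d0 dD].
  by have := punctured_zero d0 dD dich; rewrite /dnbhs !near_withinE.
pose Q z := \forall w \near z^', W w = 0.
have NN z : Q z -> (\forall w \near z^', W w <> 0) -> False.
  move=> h1 h2; have /filter_ex[w []] : \forall w \near z^', W w = 0 /\ W w <> 0 by apply: filterS2 h1 h2.
  by move=> ->.
have Qn z (P : set C) : (\forall w \near z^', P w) -> \forall w \near z, w != z -> \forall u \near w, P u.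
  rewrite /dnbhs near_withinE => /near_join; apply: filterS => w h wz.
  by apply: filterS2 h (near_neq wz) => u; apply.
have nd z (P : set C) : (\forall w \near z, P w) -> \forall w \near z^', P w.
  exact: nbhs_dnbhs.
have Qdich z : disc e z -> (\forall w \near z, Q w) \/ (\forall w \near z, ~ Q w).
  move=> /[dup] /pz[] h dz; [left|right]; apply: filterS (Qn _ _ h) => w hw.
    by have [->//|/hw /nd] := eqVneq w z.
  have [->|/hw /nd h2] := eqVneq w z; first by move=> /NN; apply.
  by move=> /NN; apply.
have Qv1 : Q v1.
  by case: (dich _ Dv1) => [/nd//|/nbhs_singleton/(_ W1)].
have discC (p q : C) t : disc e p -> disc e q -> 0 <= t <= 1 -> disc e (p + rc t * (q - p)).
  rewrite /disc -ball_normE /ball_ /= !sub0r !normrN => pd qd t01.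
  exact: norm_segment.
have Qv : Q v.
  have -> : v = v1 + (v - v1) by rewrite subrKC.
  by apply: segment_ind Qv1 => t t01; apply: Qdich; apply: discC; auto.
by case: (dich _ Dv) => [/nbhs_singleton//|/nd/(NN _ Qv)].
Qed.

End LinearODE.
(** * The matrix exponential *)

Section MatrixExp.
Variable R : realType.
Local Notation C := (Cplx R).
Local Notation rc x := ((x : R)%:C%C : C).

Lemma hasderZ (K : numFieldType) (V : normedModType K) (c : K -> K) (f : K -> V) z k d :
  hasder c z k -> hasder f z d -> hasder (fun w => c w *: f w) z (k *: f z + c z *: d).
Proof.
move=> ck fd; have FF := @dnbhs_filter _ (0 : K).
have h1 := tendsD FF (tendsZ FF ck (hasder_tends fd)) (tendsZ FF (tends_cst FF (c z)) fd).
apply: (tends_ext FF _ _ h1) => // h.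
rewrite -[(h^-1 *: (c _ - _)) *: _]scalerA [c z *: _]scalerA mulrC -[_ *: (f _ - _)]scalerA.
rewrite -scalerDr; congr (_ *: _).
by rewrite scalerBl scalerBr addrA subrK.
Qed.

Lemma hasder_scale (V : normedModType C) (f : C -> V) (a z : C) d :
  hasder f (a * z) d -> hasder (fun w => f (a * w)) z (a *: d).
Proof.
have [->|a0] := eqVneq a 0.
  move=> _; apply: hasder_ext (hasder_cst (f 0) z) => [w|]; first by rewrite mul0r.
  by rewrite scale0r.
move=> fd; have FF := @dnbhs_filter _ (0 : C).
suff h : tends (0 : C)^' (fun h => (a * h)^-1 *: (f (a * z + a * h) - f (a * z))) d.
  apply: (tends_ext FF _ _ (tendsZ FF (tends_cst FF a) h)) => // t.
  rewrite scalerA -mulrDr; congr (_ *: _).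
  have [->|t0] := eqVneq t 0; first by rewrite mulr0 invr0 mulr0.
  by rewrite invfM mulrA divff // mul1r.
apply/(tends_dist FF) => eps e0; have /(tends_dist FF)/(_ _ e0) := fd.
rewrite /dnbhs !near_withinE => /nbhs_ballP[r /= r0 rP].
apply/nbhs_ballP; exists (r / `|a|) => /=; first by rewrite divr_gt0 // normr_gt0.
move=> t; rewrite -?ball_normE /ball_ /= sub0r normrN => ta t0.
apply: rP; last by rewrite mulf_neq0.
rewrite -?ball_normE /ball_ /= sub0r normrN normrM mulrC.
by rewrite -ltr_pdivlMr // normr_gt0.
Qed.

Definition cexp (z : C) : C :=
  rc (expR (complex.Re z)) * Complex (cos (complex.Im z)) (sin (complex.Im z)).

Lemma cexpD z w : cexp (z + w) = cexp z * cexp w.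
Proof.
case: z w => [a b] [c d]; rewrite /cexp /= expRD cosD sinD.
by apply/eqP; rewrite eq_complex /=; apply/andP; split; apply/eqP; ring.
Qed.

Lemma cexp0 : cexp 0 = 1.
Proof.
by rewrite /cexp /= expR0 cos0 sin0 mul1r.
Qed.

Lemma real_expand (f : R -> R) (d eps : R) : is_derive (0 : R) (1 : R) f d -> 0 < eps ->
  \forall s \near (0 : R), `|f s - f 0 - d * s| <= eps * `|s|.
Proof.
move=> [fd fE] e0; have [d' h] : exists d', hasder f 0 d' by apply/hasder_derivable.
have dE : d' = d.
  have [_ <-] := hasder_is_derive h; by rewrite fE.
have /(tends_dist (@dnbhs_filter _ (0 : R)))/(_ _ e0) := h.
rewrite /dnbhs !near_withinE; apply: filterS => s hs.
have [->|s0] := eqVneq s 0; first by rewrite subrr mulr0 subr0 !normr0 mulr0.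
have := ltW (hs s0); rewrite add0r dE => {}hs.
have -> : f s - f 0 - d * s = s * (s^-1 *: (f s - f 0) - d).
  by rewrite mulrBr /GRing.scale /= mulrA divff // mul1r [s * d]mulrC.
by rewrite normrM mulrC ler_wpM2r.
Qed.

(** By the first-order expansions of exp, cos and sin; the derivative at the
  other points follows from cexpD. *)
Lemma cexp_hasder0 : hasder cexp 0 1.
Proof.
have FF := @dnbhs_filter _ (0 : C).
apply/(tends_dist FF) => _ /posC[eps e0 ->].
(* the errors of the three expansions add up to 6 dl |h| *)
pose dl := Num.min (eps / 8) 1.
have dl0 : 0 < dl by rewrite lt_min ltr01 divr_gt0.
have dle : dl <= eps / 8 by rewrite ge_min lexx.
have dl1 : dl <= 1 by rewrite ge_min lexx orbT.
have h1 := real_expand (is_derive_expR 0) dl0.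
have h2 := real_expand (is_derive_cos 0) dl0.
have h3 := real_expand (is_derive_sin 0) dl0.
have h4 : \forall s \near (0 : R), `|s| <= dl / 2.
  apply/nbhs_ballP; exists (dl / 2) => /=; first by rewrite divr_gt0.
  by move=> s; rewrite -?ball_normE /ball_ /= sub0r normrN => /ltW.
have : \forall s \near (0 : R), [/\ `|expR s - 1 - s| <= dl * `|s|, `|cos s - 1| <= dl * `|s|,
    `|sin s - s| <= dl * `|s| & `|s| <= dl / 2].
  apply: filterS3 h1 h2 (filterI h3 h4) => s a b [c d].
  split=> //; [move: a|move: b|move: c].
  - by rewrite expR0 mul1r.
  - by rewrite cos0 sin0 oppr0 mul0r subr0.
  - by rewrite sin0 cos0 mul1r subr0.
move=> /nbhs_ballP[r /= r0 rP].
rewrite /dnbhs near_withinE; apply/nbhs_ballP; exists (rc r); first by rewrite /= rc_lt.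
move=> h; rewrite -?ball_normE /ball_ /= sub0r normrN => hr hn0.
have hh : 0 < `|h| by rewrite normr_gt0.
rewrite add0r cexp0.
suff H : `|cexp h - 1 - h| <= rc (6 * dl) * `|h|.
  have -> : h^-1 *: (cexp h - 1) - 1 = (cexp h - 1 - h) / h.
    by rewrite /GRing.scale /= mulrBl divff // [h^-1 * _]mulrC.
  rewrite normrM normfV ltr_pdivrMr //; apply: le_lt_trans H _.
  by rewrite ltr_pM2r // rc_lt; lra.
case: h hr hn0 hh => x y hr _ _.
have hx : `|x| < r.
  by rewrite -rc_lt; apply: le_lt_trans hr; exact: (normc_ge_Re (Complex x y)).
have nE : rc `|y| <= `|Complex x y : C|.
  have := normc_ge_Re (Complex x y * 'i%C); rewrite normrM.
  have -> : `|'i%C : C| = 1 by rewrite normc_def /= expr0n expr1n add0r sqrtr1.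
  by rewrite mulr1 /= mulr0 sub0r mulr1 normrN.
have hy : `|y| < r by rewrite -rc_lt; apply: le_lt_trans hr.
have bx : ball (0 : R) r x by rewrite -?ball_normE /ball_ /= sub0r normrN.
have by_ : ball (0 : R) r y by rewrite -?ball_normE /ball_ /= sub0r normrN.
have [ex _ _ sx] := rP _ bx; have [_ cy sy _] := rP _ by_.
have nx : rc `|x| <= `|Complex x y : C| by exact: (normc_ge_Re (Complex x y)).
have e1 : `|expR x - 1| <= dl.
  rewrite -[expR x - 1](subrK x); apply: (le_trans (ler_normD _ _)).
  apply: (le_trans (lerD ex sx)).
  have : dl * `|x| <= 1 * `|x| by apply: ler_wpM2r.
  by rewrite mul1r; lra.
have e2 : `|expR x| <= 2.
  rewrite -[expR x](subrK 1); apply: (le_trans (ler_normD _ _)); rewrite normr1; lra.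
have ny0 : 0 <= `|y| by [].
have nx0 : 0 <= `|x| by [].
have hre : `|expR x * cos y - 1 - x| <= dl * `|x| + 2 * (dl * `|y|).
  have -> : expR x * cos y - 1 - x = (expR x - 1 - x) + expR x * (cos y - 1) by ring.
  apply: (le_trans (ler_normD _ _)); apply: lerD => //; rewrite normrM.
  by apply: ler_pM.
have him : `|expR x * sin y - y| <= 3 * (dl * `|y|).
  have -> : expR x * sin y - y = expR x * (sin y - y) + (expR x - 1) * y by ring.
  apply: (le_trans (ler_normD _ _)); rewrite !normrM.
  have : `|expR x| * `|sin y - y| <= 2 * (dl * `|y|) by apply: ler_pM.
  have : `|expR x - 1| * `|y| <= dl * `|y| by apply: ler_wpM2r.
  by lra.
have -> : cexp (Complex x y) - 1 - Complex x y =
    rc (expR x * cos y - 1 - x) + 'i%C * rc (expR x * sin y - y).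
  by rewrite /cexp; apply/eqP; rewrite eq_complex /=; apply/andP; split; apply/eqP; ring.
apply: (le_trans (ler_normD _ _)); rewrite normrM.
have -> : `|'i%C : C| = 1 by rewrite normc_def /= expr0n expr1n add0r sqrtr1.
rewrite mul1r !norm_rc.
apply: (le_trans (y := rc (dl * `|x| + 5 * (dl * `|y|)))).
  by rewrite -rcD rc_le; lra.
rewrite rcD !rcM.
have -> : rc 6 * rc dl * `|Complex x y : C| = rc dl * `|Complex x y : C| + rc 5 * (rc dl * `|Complex x y : C|).
  have -> : rc 6 = 1 + rc 5 by rewrite (_ : 6 = 1 + 5) ?rcD //; lra.
  ring.
have d0 : 0 <= rc dl by rewrite -[0]/(rc 0) rc_le ltW.
by apply: lerD; [|apply: ler_wpM2l; first by rewrite -[0]/(rc 0) rc_le]; apply: ler_wpM2l.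
Qed.

Lemma cexp_hasder z : hasder cexp z (cexp z).
Proof.
have FF := @dnbhs_filter _ (0 : C).
have := tendsZ FF (tends_cst FF (cexp z)) cexp_hasder0.
apply: (tends_ext FF) => [h|]; last by rewrite /GRing.scale /= mulr1.
by rewrite add0r cexp0 cexpD /GRing.scale /= mulrCA mulrBr mulr1.
Qed.

End MatrixExp.

Section MatrixExpConstruction.
Variable R : realType.
Local Notation C := (Cplx R).
Variables (n : nat) (k : 'M[C]_n.+1).
Implicit Types (X : 'M[C]_n.+1) (a z w v : C) (p q : {poly C}).

Lemma hasder_pow m z : hasder (fun v : C => v ^+ m.+1 : C) z (m.+1%:R * z ^+ m).
Proof.
elim: m => [|m IH].
  by apply: hasder_ext (hasder_id z) => [w|]; rewrite ?expr1 ?mul1r ?expr0.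
apply: hasder_ext (hasderZ (hasder_id z) IH) => [w|]; first by rewrite [RHS]exprS.
by rewrite /GRing.scale /= exprS -[m.+2]addn1 natrD; ring.
Qed.

(** The truncated exponential series exp(v b) X, exact when a power of b kills
  X. *)
Definition nilp_sum (b : 'M[C]_n.+1) X m (v : C) : 'M[C]_n.+1 :=
  \sum_(j < m) (v ^+ j / j`!%:R) *: (b ^+ j *m X).

Lemma nilp_sum_hasder b X m v :
  hasder (nilp_sum b X m.+1) v (b *m nilp_sum b X m v).
Proof.
elim: m => [|m IH].
  apply: hasder_ext (hasder_cst X v) => [w|].
    rewrite /nilp_sum big_ord1 /= !expr0 fact0 divr1 scale1r; exact/esym/mul1mx.
  by rewrite /nilp_sum big_ord0 mulmx0.
have h := hasderZ (hasder_pow m v) (hasder_cst ((m.+1)`!%:R^-1 *: (b ^+ m.+1 *m X)) v).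
apply: hasder_ext (hasderD IH h) => [w|].
  by rewrite [RHS]/nilp_sum big_ord_recr /= scalerA.
rewrite scaler0 addr0 scalerA [in RHS]/nilp_sum big_ord_recr /= mulmxDr.
congr (_ + _); rewrite -scalemxAr mulmxA -[b *m b ^+ m]/(b * b ^+ m) -exprS; congr (_ *: _).
rewrite factS natrM invfM mulrACA divff ?pnatr_eq0 // mul1r.
by [].
Qed.

(** On the generalised eigenspace of a the solution is exp(a v) times a
  polynomial. *)
Lemma ode_nilp a X m : (k - a%:M) ^+ m *m X = 0 ->
  exists G, G 0 = X /\ forall v, hasder G v (k *m G v).
Proof.
case: m => [|m] bX.
  exists (fun=> 0); rewrite -[X]mul1mx -[1%:M]/((k - a%:M) ^+ 0) bX; split=> // v.
  by rewrite mulmx0; exact: hasder_cst.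
set b := k - a%:M in bX *.
have sumE v : nilp_sum b X m.+2 v = nilp_sum b X m.+1 v.
  by rewrite /nilp_sum big_ord_recr /= bX scaler0 addr0.
exists (fun v => cexp (a * v) *: nilp_sum b X m.+2 v); split.
  rewrite mulr0 cexp0 scale1r /nilp_sum big_ord_recl /= expr0 fact0 divr1 scale1r.
  rewrite expr0 big1 => [|j _]; first by rewrite addr0; exact: mul1mx.
  by rewrite /bump /= exprS mul0r mul0r scale0r.
move=> v; have ha := hasder_scale (cexp_hasder (a * v)).
have := hasderZ ha (nilp_sum_hasder b X m.+1 v).
apply: hasder_ext => // {ha}.
have kE (S : 'M[C]_n.+1) : k *m S = b *m S + a *: S.
  by rewrite /b mulmxBl mul_scalar_mx subrK.
rewrite -sumE -scalemxAr kE scalerDr addrC; congr (_ + _).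
rewrite scalerA; congr (_ *: _); exact: mulrC.
Qed.

(** A Bezout identity between the power of X - a and the product of the other
  factors splits off the eigenvalues one at a time. *)
Lemma ode_split (s : seq C) X :
  horner_mx k (\prod_(a <- s) ('X - a%:P)) *m X = 0 ->
  exists G, G 0 = X /\ forall v, hasder G v (k *m G v).
Proof.
have [l] := ubnP (size s); elim: l s X => // l IH [|a s] X sl.
  rewrite big_nil rmorph1 mul1mx => ->.
  exists (fun=> 0); split=> // v; rewrite mulmx0; exact: hasder_cst.
set s1 := a :: s => pX.
pose m := count_mem a s1; pose q := \prod_(c <- [seq c <- s1 | c != a]) ('X - c%:P).
have pE : \prod_(c <- s1) ('X - c%:P) = ('X - a%:P) ^+ m * q.
  rewrite (bigID (pred1 a)) /= /q big_filter; congr (_ * _).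
  rewrite (eq_bigr (fun=> 'X - a%:P)) => [|c /eqP -> //].
  by rewrite big_const_seq iter_mulr_1.
have cop : coprimep (('X - a%:P) ^+ m) q.
  apply: coprimep_expl; rewrite coprimep_sym coprimep_XsubC root_prod_XsubC.
  by rewrite mem_filter eqxx.
have /Bezout_eq1_coprimepP[[u1 u2] /= ubz] := cop.
have hM p p' : horner_mx k (p * p') = horner_mx k p *m horner_mx k p' by rewrite rmorphM.
pose X1 := horner_mx k (u1 * ('X - a%:P) ^+ m) *m X.
pose X2 := horner_mx k (u2 * q) *m X.
have XE : X = X1 + X2 by rewrite /X1 /X2 -mulmxDl -rmorphD ubz rmorph1 mul1mx.
have [||G1 [G10 G1d]] := IH [seq c <- s1 | c != a] X1.
- apply: leq_trans (sl : (size s1 <= l)%N); rewrite size_filter ltn_neqAle count_size andbT.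
  rewrite -all_count /=; by rewrite eqxx.
- rewrite -/q /X1 mulmxA -hM mulrCA -/q mulrC -[q * _]mulrC -pE.
  by rewrite [_ * u1]mulrC hM -mulmxA pX mulmx0.
have [|G2 [G20 G2d]] := @ode_nilp a X2 m.
  have <- : horner_mx k (('X - a%:P) ^+ m) = (k - a%:M) ^+ m.
    by rewrite rmorphXn rmorphB /= horner_mx_X horner_mx_C.
  by rewrite /X2 mulmxA -hM mulrCA -pE hM -mulmxA pX mulmx0.
exists (fun v => G1 v + G2 v); split; first by rewrite G10 G20.
by move=> v; rewrite mulmxDr; exact: hasderD.
Qed.

End MatrixExpConstruction.

Section EntireODE.
Variable R : realType.
Local Notation C := (Cplx R).
Local Notation rc x := ((x : R)%:C%C : C).

Lemma entire_unique m n (k : 'M[C]_m) (W : C -> 'M[C]_(m, n)) :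
  (forall v, hasder W v (k *m W v)) -> W 0 = 0 -> forall v, W v = 0.
Proof.
move=> dW W0 v.
have [r r0 vr] := normC_rc v.
have dE (z : C) : disc (r + 1) z = (`|z| < rc (r + 1)).
  by rewrite /disc -ball_normE /ball_ /= sub0r normrN.
apply: (@linear_ode_global _ (r + 1) (disc (r + 1)) _ _ W (fun=> k) 0) => //.
- move=> z dz; apply: (@open_nbhs_nbhs _ z (disc (r + 1))); split=> //.
  exact: ball_open.
- move=> z dz; apply: nbhs_dnbhs; apply: (@open_nbhs_nbhs _ z (disc (r + 1))); split=> //.
  exact: ball_open.
- by move=> z _; exact: tends_cst.
- by rewrite dE normr0 -[0]/(rc 0) rc_lt ltr_wpDl.
- by rewrite dE vr rc_lt ltrDl.
Qed.

(** The exponential of v k. It exists by the Cayley-Hamilton theorem and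
  ode_split; the group law and the commutation rule follow from uniqueness. *)
Lemma mexp_exists m (k : 'M[C]_m) : exists F : C -> 'M[C]_m,
  [/\ F 0 = 1%:M, forall v, hasder F v (k *m F v),
      forall v w, F (v + w) = F v *m F w
    & forall b, b *m k = k *m b -> forall v, b *m F v = F v *m b].
Proof.
have [F [F0 Fd]] : exists F : C -> 'M[C]_m, F 0 = 1%:M /\ forall v, hasder F v (k *m F v).
  case: m k => [|n] k.
    exists (fun=> 0); split=> [|v]; first by apply/matrixP => -[].
    by rewrite mulmx0; exact: hasder_cst.
  have [s sE] := closed_field_poly_normal (char_poly k).
  apply: (@ode_split R n k s).
  have := Cayley_Hamilton k; rewrite {}sE (monicP (char_poly_monic k)) scale1r => ->.
  by rewrite mul0mx.
exists F; split=> //.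
- move=> v w; apply/eqP; rewrite -subr_eq0; apply/eqP.
  apply: (@entire_unique _ _ k (fun v => F (v + w) - F v *m F w)) => [z|]; last first.
    by rewrite add0r F0 mul1mx subrr.
  have h1 : hasder (fun v => F (v + w)) z (k *m F (z + w)).
    apply: (tends_ext (@dnbhs_filter _ (0 : C)) _ _ (Fd (z + w))) => // h.
    by rewrite addrAC.
  have h2 := hasderM (Fd z) (hasder_cst (F w) z).
  apply: hasder_ext (hasderB h1 h2) => //.
  by rewrite mulmx0 addr0 mulmxBr mulmxA.
- move=> b bk v; apply/eqP; rewrite -subr_eq0; apply/eqP.
  apply: (@entire_unique _ _ k (fun v => b *m F v - F v *m b)) => [z|]; last first.
    by rewrite F0 mul1mx mulmx1 subrr.
  apply: hasder_ext (hasderB (hasderM (hasder_cst b z) (Fd z)) (hasderM (Fd z) (hasder_cst b z))) => //.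
  by rewrite mul0mx add0r mulmx0 addr0 mulmxBr !mulmxA bk.
Qed.

End EntireODE.
(** * The pole at the origin *)

Section PoleAlgebra.
Variables (F : fieldType) (N : nat).
Local Notation A := 'M[F]_N.
Local Notation AA := 'M[F]_(N * N).
Local Notation AAA := 'M[F]_(N * N * N).
Implicit Types (s t x y z U : AA) (X Y : A).

Lemma comb1_23_12 X s t : comb1 X (t23 s *m t12 t) = s *m (comb t X *t 1%:M).
Proof.
elim/tens_ind: s => [a b|s s' hs hs']; last first.
  by rewrite linearD /= !mulmxDl linearD /= hs hs'.
elim/tens_ind: t => [a' b'|t t' ht ht']; last first.
  by rewrite linearD /= combDl tensDl !mulmxDr linearD /= ht ht'.
rewrite t23_tens t12_tens tens3M comb1_tens comb_tens tensZl -scalemxAr -tensmxM.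
by rewrite !mulmx1 mul1mx.
Qed.

Lemma comb1_12_13_23 X s t z :
  comb1 X (t12 s *m t13 t *m t23 z) = comb1 X (t12 s *m t13 t) *m z.
Proof.
elim/tens_ind: z => [p q|z z' hz hz']; last first.
  by rewrite linearD /= mulmxDr linearD /= hz hz' mulmxDr.
elim/tens_ind: s => [a b|s s' hs hs']; last first.
  by rewrite linearD /= !mulmxDl !linearD /= hs hs' mulmxDl.
elim/tens_ind: t => [a' b'|t t' ht ht']; last first.
  by rewrite linearD /= !mulmxDr !mulmxDl !linearD /= ht ht' mulmxDl.
rewrite t12_tens t13_tens t23_tens !tens3M !comb1_tens -scalemxAl -tensmxM.
by rewrite !mulmx1.
Qed.

Lemma comb1D X (S T : AAA) : comb1 X (S + T) = comb1 X S + comb1 X T.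
Proof. exact: linearD. Qed.
Lemma comb1B X (S T : AAA) : comb1 X (S - T) = comb1 X S - comb1 X T.
Proof. exact: linearB. Qed.
Lemma comb10 X : comb1 X (0 : AAA) = 0.
Proof. exact: linear0. Qed.

Lemma swap23_t12 t : t23 swap *m t12 t = t13 t *m t23 swap.
Proof.
have PP : t23 swap *m t23 swap = 1%:M :> AAA by rewrite -t23M swapK t23_1.
by rewrite -[LHS]mulmx1 -PP mulmxA -[_ *m t12 t *m _]mulmxA t12_swap23 !mulmxA PP mul1mx.
Qed.

(** A second contraction turns this into the composite of the two contractions
  attached to s and t, which are injective (comb_comb1). *)
Lemma comb1_12_13_inj X s t : rl (flip s) \in unitmx -> rl t \in unitmx ->
  comb1 X (t12 s *m t13 t) = 0 -> X = 0.
Proof.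
move=> us ut h; have [Y sY] := comb_surj 1%:M us.
have := comb_comb1 X Y s t; rewrite h /comb mulmx0 linear0 => /esym.
by move/rl_unitP: ut => ut /ut; rewrite -/(comb _ _) sY mulmx1.
Qed.

(** Splitting off the scalar part of a tensor. *)
Definition tau U : F := \tr U / (N * N)%:R.
Definition tless U : AA := U - (tau U)%:M.

Lemma tau_is_linear : linear (tau : AA -> F^o).
Proof. by move=> c U V; rewrite /tau linearP /= mulrDl -mulrA. Qed.
HB.instance Definition _ := GRing.isLinear.Build F AA F^o _ tau tau_is_linear.

Lemma tauD U V : tau (U + V) = tau U + tau V. Proof. exact: linearD. Qed.
Lemma tauZ c U : tau (c *: U) = c * tau U. Proof. exact: linearZ. Qed.

Lemma tless_is_linear : linear tless.
Proof.
by move=> c U V; rewrite /tless tauD tauZ; apply/matrixP => i j; rewrite !mxE; ring.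
Qed.
HB.instance Definition _ := GRing.isLinear.Build F AA AA _ tless tless_is_linear.

Lemma tau_flip U : tau (flip U) = tau U.
Proof. by rewrite /tau trace_flip. Qed.

Lemma flip_scalar a : flip (a%:M : AA) = a%:M.
Proof. by rewrite -scalemx1 flipZ flip1. Qed.

Lemma tless_opp_flip U : tless (- flip U) = - flip (tless U).
Proof.
have tN : tau (- flip U) = - tau U by rewrite [LHS]linearN /= tau_flip.
by rewrite /tless tN flipD flipN flip_scalar raddfN opprD.
Qed.

Hypothesis N0 : (N * N)%:R != 0 :> F.

Lemma tau_scalar a : tau a%:M = a.
Proof. by rewrite /tau mxtrace_scalar -[a *+ _]mulr_natr mulfK. Qed.

Lemma tau_tless U : tau (tless U) = 0.
Proof. by rewrite /tless linearB /= tau_scalar subrr. Qed.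

(** Let lam(h) be the scalar part of r(h) P and U the traceless part of r(h) P plus
  h lam(h). The AYBE at (v, h), multiplied on the right by P23, reads
  pole_op (r v) (r (v + h)) q U = r12(v) r13(v + h) P23, with q the difference
  quotient of r between v and v + h; by unitarity pole_flip maps the U of h to
  that of - h. *)
Definition pole_op x y (q : AA) U : AAA :=
  t23 (tless U) *m t13 x - t13 y *m t23 (tless U) - tau U *: t13 q.

Definition pole_flip U : AA := (tau U)%:M - flip (tless U).

Lemma pole_op_is_linear x y q : linear (pole_op x y q).
Proof.
move=> c U V; rewrite /pole_op tauD tauZ linearP /= linearP /=.
rewrite mulmxDl mulmxDr -scalemxAl -scalemxAr.
by apply/matrixP => i j; rewrite !mxE; ring.
Qed.
HB.instance Definition _ x y q :=
  GRing.isLinear.Build F AA AAA _ (pole_op x y q) (pole_op_is_linear x y q).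

Lemma pole_flip_is_linear : linear pole_flip.
Proof.
move=> c U V; rewrite /pole_flip tauD tauZ linearP /= flipD flipZ.
by apply/matrixP => i j; rewrite !mxE; ring.
Qed.
HB.instance Definition _ := GRing.isLinear.Build F AA AA _ pole_flip pole_flip_is_linear.

Lemma tau_pole_flip U : tau (pole_flip U) = tau U.
Proof. by rewrite /pole_flip linearB /= tau_scalar tau_flip tau_tless subr0. Qed.

Lemma tless_pole_flip U : tless (pole_flip U) = - flip (tless U).
Proof. by rewrite {1}/tless tau_pole_flip /pole_flip addrAC subrr add0r. Qed.

(** The system has no homogeneous solution in the limit: contracting with the
  preimage of 1 kills the scalar part, and what remains commutes with 1 (x) A,
  as does its flip. *)
Lemma pole_op_inj (o : 'I_N) x (q : AA) X U : rl x \in unitmx ->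
  comb x X = 1%:M -> comb q X != 0 ->
  pole_op x x q U = 0 -> pole_op x x q (pole_flip U) = 0 -> U = 0.
Proof.
move=> ux xX qX h1 h2.
have tU : tau U = 0.
  have := congr1 (comb1 X) h1; rewrite /pole_op linear0 linearB /= linearB /=.
  rewrite comb1_23_13 comb1_13_23 xX tens11 mulmx1 mul1mx subrr sub0r.
  rewrite linearZ /= comb1_t13 => /eqP; rewrite oppr_eq0 scaler_eq0.
  case/orP => [/eqP //|/eqP q0]; case/eqP: qX.
  by apply: (tens1_inj (leq_ltn_trans (leq0n o) (ltn_ord o))); rewrite q0 tensmx0.
have comm V : tau V = 0 -> pole_op x x q V = 0 ->
    forall b, tless V *m (1%:M *t b) = (1%:M *t b) *m tless V.
  move=> tV h b; have [Y xY] := comb_surj b ux.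
  have := congr1 (comb1 Y) h; rewrite /pole_op tV scale0r subr0 linear0 linearB /=.
  by rewrite comb1_23_13 comb1_13_23 xY => /eqP; rewrite subr_eq0 => /eqP.
have [a aE] := tens1_comm o (comm _ tU h1).
have tU2 : tau (pole_flip U) = 0 by rewrite tau_pole_flip.
have [a' a'E] := tens1_comm o (comm _ tU2 h2).
have ab : a *t 1%:M = 1%:M *t (- a') :> AA.
  rewrite -aE; apply: (can_inj (@flipK F N)); rewrite -[flip (tless U)]opprK.
  by rewrite -tless_pole_flip a'E flip_tens tensNl.
have aS := tens1_scalar o ab.
have tE : tless U = ((- a') o o)%:M.
  rewrite aE aS; move: ((- a') o o) => k.
  by rewrite -[k%:M in LHS]scalemx1 tensZl tens11 scalemx1.
have := tau_tless U; rewrite tE tau_scalar => a0.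
by move: tE; rewrite a0 /tless tU raddf0 subr0.
Qed.

End PoleAlgebra.

Section LimitTools.
Variable K : numFieldType.

Lemma tends_mxvec (T : Type) (F : set_system T) (FF : Filter F) m n (f : T -> 'M[K]_(m, n)) a :
  tends F f a -> tends F (fun t => mxvec (f t)) (mxvec a).
Proof. exact: tends_lin. Qed.

Lemma tends_lin_mx (T : Type) (F : set_system T) (FF : Filter F) m n p q
    (f : T -> {linear 'M[K]_(m, n) -> 'M[K]_(p, q)}) (f0 : {linear 'M[K]_(m, n) -> 'M[K]_(p, q)}) :
  (forall U, tends F (fun t => f t U) (f0 U)) ->
  tends F (fun t => lin_mx (f t)) (lin_mx f0).
Proof.
move=> h; apply/tends_mx => i j.
have /tends_mx/(_ 0 j) := tends_mxvec FF (h (vec_mx (delta_mx 0 i))).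
by apply: tends_ext => [t|]; rewrite mxE.
Qed.

Lemma tends_row_mx (T : Type) (F : set_system T) (FF : Filter F) m n p
    (f : T -> 'M[K]_(m, n)) (g : T -> 'M[K]_(m, p)) a b :
  tends F f a -> tends F g b -> tends F (fun t => row_mx (f t) (g t)) (row_mx a b).
Proof.
move=> /tends_mx fa /tends_mx gb; apply/tends_mx => i j.
case: (splitP j) => k jk.
  have -> : j = lshift p k by apply: val_inj.
  by apply: (tends_ext _ _ _ (fa i k)) => [t|]; rewrite row_mxEl.
have -> : j = rshift n k by apply: val_inj.
by apply: (tends_ext _ _ _ (gb i k)) => [t|]; rewrite row_mxEr.
Qed.

(** Two linear systems are one system with a block matrix. *)
Lemma solve_limit2 (T : Type) (F : set_system T) (FF : Filter F) m n p q p' q'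
    (f : T -> {linear 'M[K]_(m, n) -> 'M[K]_(p, q)})
    (f0 : {linear 'M[K]_(m, n) -> 'M[K]_(p, q)})
    (g : T -> {linear 'M[K]_(m, n) -> 'M[K]_(p', q')})
    (g0 : {linear 'M[K]_(m, n) -> 'M[K]_(p', q')}) U y y0 z z0 :
  (forall u, f0 u = 0 -> g0 u = 0 -> u = 0) ->
  (forall u, tends F (fun t => f t u) (f0 u)) ->
  (forall u, tends F (fun t => g t u) (g0 u)) ->
  tends F y y0 -> tends F z z0 ->
  (\forall t \near F, f t (U t) = y t /\ g t (U t) = z t) ->
  exists U0, tends F U U0.
Proof.
move=> inj ff gg yy zz fU.
pose TT t := row_mx (lin_mx (f t)) (lin_mx (g t)).
have [||||u0 uu] := @solve_limit K T F FF _ _ TT (row_mx (lin_mx f0) (lin_mx g0))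
  (fun t => mxvec (U t)) (fun t => row_mx (mxvec (y t)) (mxvec (z t)))
  (row_mx (mxvec y0) (mxvec z0)).
- move=> u; rewrite mul_mx_row -[u]vec_mxK !mul_vec_lin => /eqP.
  rewrite row_mx_eq0 !mxvec_eq0 => /andP[/eqP h1 /eqP h2].
  by rewrite (inj _ h1 h2) linear0.
- by apply: tends_row_mx; apply: tends_lin_mx.
- by apply: tends_row_mx; apply: tends_mxvec.
- by apply: filterS fU => t [<- <-]; rewrite /TT mul_mx_row !mul_vec_lin.
exists (vec_mx u0); apply: (tends_ext FF _ _ (tends_lin FF vec_mx uu)) => // t.
by rewrite /= mxvecK.
Qed.

Lemma near0_and (P Q : K -> Prop) :
  (\forall h \near (0 : K)^', P h) -> (\forall h \near (0 : K)^', Q h) ->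
  \forall h \near (0 : K)^', P h /\ Q h.
Proof. by move=> p q; apply: filterS2 p q. Qed.

Lemma near_and (z : K) (P Q : K -> Prop) :
  (\forall w \near z, P w) -> (\forall w \near z, Q w) -> \forall w \near z, P w /\ Q w.
Proof. by move=> p q; apply: filterS2 p q. Qed.

Lemma near0_opp (P : K -> Prop) :
  (\forall h \near (0 : K)^', P h) -> \forall h \near (0 : K)^', P (- h).
Proof.
rewrite /dnbhs !near_withinE => /nbhs_ballP[d d0 dP].
apply/nbhs_ballP; exists d => // h hd h0; apply: dP; last by rewrite oppr_eq0.
by move: hd; rewrite -?ball_normE /ball_ /= !sub0r opprK normrN.
Qed.

Lemma tends_opp0 (V : normedModType K) (f : K -> V) a :
  tends (0 : K)^' f a -> tends (0 : K)^' (fun h => f (- h)) a.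
Proof.
have FF := @dnbhs_filter _ (0 : K).
move=> /(tends_dist FF) h; apply/(tends_dist FF) => eps e0.
exact: near0_opp (h _ e0).
Qed.

Lemma hasder_inv n (f : K -> 'M[K]_n) z d : f z \in unitmx -> hasder f z d ->
  hasder (fun w => invmx (f w)) z (- (invmx (f z) *m d *m invmx (f z))).
Proof.
have FF := @dnbhs_filter _ (0 : K).
move=> uz fd; have fz := hasder_tends fd.
have h := tendsN FF (tends_mulmx FF (tends_mulmx FF (tends_inv FF uz fz) fd)
  (tends_cst FF (invmx (f z)))).
apply: (tends_near FF _ h); apply: filterS (tends_unit FF uz fz) => t ut.
rewrite -scalemxAr -scalemxAl -scalerN; congr (_ *: _).
by rewrite mulmxBr mulVmx // mulmxBl mul1mx -mulmxA mulmxV // mulmx1 opprB.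
Qed.

End LimitTools.

Section Pole.
Variables (R : realType) (N : nat).
Local Notation C := (Cplx R).
Local Notation A := 'M[C]_N.
Local Notation AA := 'M[C]_(N * N).
Local Notation AAA := 'M[C]_(N * N * N).

(** A symmetric open domain, dense in the disc, on which r satisfies all the
  hypotheses pointwise. *)
Record AYBE_domain (e : R) (D : set C) (r : C -> AA) : Prop := {
  dom_disc : forall v, D v -> disc e v;
  dom_neq0 : forall v, D v -> v != 0;
  dom_opp : forall v, D v -> D (- v);
  dom_open : forall v, D v -> \forall w \near v, D w;
  dom_dense : forall z, disc e z -> \forall v \near z^', D v;
  dom_der : forall v, D v -> exists d, hasder r v d;
  dom_AYB : forall v v', D v -> D v' -> D (v + v') ->
    AYB (r v) (r (v + v')) (r v');
  dom_flip : forall v, D v -> flip (r (- v)) = - r v;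
  dom_rl : forall z, disc e z -> \forall v \near z^', rl (r v) \in unitmx }.

Variables (e : R) (D : set C) (r : C -> AA).
Hypotheses (hN : (0 < N)%N) (he : 0 < e) (H : AYBE_domain e D r).

Let FF : ProperFilter (0 : C)^' := Proper_dnbhs_numFieldType (0 : C).
Let o : 'I_N := Ordinal hN.

Lemma NN_neq0 : (N * N)%:R != 0 :> C.
Proof. by rewrite pnatr_eq0 muln_eq0 orbb -lt0n hN. Qed.

Definition dr v : AA := xget 0 [set d | hasder r v d].

Lemma r_hasder v : D v -> hasder r v (dr v).
Proof. by move=> /(dom_der H)[d hd]; apply: (xgetPex 0); exists d. Qed.

Lemma r_AYB' v v' : D v -> D v' -> D (v + v') -> AYB' (r v) (r (v + v')) (r v').
Proof.
move=> Dv Dv' Dw.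
have Dw' : D (- v' + - v) by rewrite -opprD [v' + v]addrC; exact: (dom_opp H Dw).
have := AYB_flip (dom_AYB H (dom_opp H Dv') (dom_opp H Dv) Dw').
have fl u : D u -> - flip (r (- u)) = r u by move=> Du; rewrite (dom_flip H) // opprK.
by rewrite -opprD [v' + v]addrC !fl.
Qed.

Lemma disc0 : disc e (0 : C).
Proof. by apply: ballxx; rewrite -[0]/((0 : R)%:C%C) ltcR. Qed.

Lemma near_dom : \forall h \near (0 : C)^', D h.
Proof. exact: dom_dense H _ disc0. Qed.

Lemma near_dom_shift v : D v -> \forall h \near (0 : C)^', D h /\ D (v + h).
Proof.
move=> /(dom_open H)/near_dnbhs0 h; exact: near0_and near_dom h.
Qed.

Definition dual1 v : A := vec_mx (mxvec 1%:M *m invmx (rl (r v))).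

Lemma comb_dual1 v : rl (r v) \in unitmx -> comb (r v) (dual1 v) = 1%:M.
Proof. by move=> u; apply: (can_inj mxvecK); rewrite -mul_rl vec_mxK mulmxKV. Qed.

(** The preimage of 1 cannot be stationary: if it were constant near v, the
  contraction of the equation at v, v + h would vanish. *)
Lemma dual_moves : exists v X, [/\ D v, rl (r v) \in unitmx, rl (flip (r v)) \in unitmx,
  comb (r v) X = 1%:M & comb (dr v) X != 0].
Proof.
have Rn := near0_and near_dom (dom_rl H disc0).
have Rn' := near0_opp Rn.
have := near0_and Rn Rn'; rewrite /dnbhs near_withinE => /nbhs_ballP[d /= d0 dP].
have {}dP v : ball 0 d v -> v != 0 ->
    [/\ D v, rl (r v) \in unitmx & rl (flip (r v)) \in unitmx].
  move=> vd v0; have [[Dv uv] [Dv' uv']] := dP v vd v0.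
  split; [exact: Dv|exact: uv|].
  have -> : flip (r v) = - r (- v) by rewrite -(dom_flip H Dv') opprK.
  rewrite linearN /= -scaleN1r unitmxZ; first exact: uv'.
  by rewrite unitrN1.
apply: contrapT => none.
have none' v : ball 0 d v -> v != 0 -> comb (dr v) (dual1 v) = 0.
  move=> vd v0; have [Dv uv uv'] := dP v vd v0; apply: contrapT => /eqP ne.
  apply: none; exists v, (dual1 v).
  split; [exact: Dv|exact: uv|exact: uv'|exact: comb_dual1 uv|exact: ne].
have /filter_ex[v [v0 vd]] : \forall v \near (0 : C)^', v != 0 /\ ball 0 d v.
  by rewrite /dnbhs near_withinE; apply: filterS (nbhsx_ballx (0 : C) d d0).
have [Dv uv uv'] := dP v vd v0.
have nv : \forall w \near v, ball 0 d w /\ w != 0.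
  apply: near_and; last exact: near_neq.
  by apply: (@open_nbhs_nbhs _ v (ball 0 d)); split=> //; exact: ball_open.
have der w : ball 0 d w -> w != 0 -> hasder dual1 w 0.
  move=> wd w0; have [Dw uw uw'] := dP w wd w0.
  have h1 := hasder_inv uw (hasder_lin (@rl _ N) (r_hasder Dw)).
  have h2 := hasder_lin vec_mx (hasderM (hasder_cst (mxvec (1%:M : A)) w) h1).
  apply: hasder_ext h2 => //=.
  rewrite mul0mx add0r mulmxN !mulmxA -[mxvec _ *m _](@vec_mxK _ N N) -/(dual1 w).
  by rewrite mul_rl none' // linear0 mul0mx oppr0 linear0.
have const : \forall w \near v, dual1 w - dual1 v = 0.
  apply: (@linear_ode_local _ _ _ (fun w => dual1 w - dual1 v) (fun=> 0)).
  - apply: filterS nv => w [wd w0]; rewrite mul0mx -[0](subr0 0).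
    by apply: hasderB (hasder_cst _ _); exact: der.
  - exact: tends_cst.
  - by rewrite subrr.
have := near0_and (near_dom_shift Dv) (near_dnbhs0 (near_and nv const)).
move=> /filter_ex[h [[Dh Dvh] [[hd h0] hc]]].
have [_ uvh _] := dP _ hd h0.
have := congr1 (comb1 (dual1 v)) (dom_AYB H Dv Dh Dvh).
rewrite comb10 comb1D comb1B comb1_23_12 comb1_13_23 (comb_dual1 uv).
have <- : dual1 (v + h) = dual1 v by apply/eqP; rewrite -subr_eq0 hc.
rewrite (comb_dual1 uvh) tens11 mulmx1 mul1mx subrK => /(comb1_12_13_inj uv' uvh) X0.
have := comb_dual1 uvh; rewrite X0 linear0 => /matrixP/(_ o o); rewrite !mxE eqxx.
by move/eqP; rewrite eq_sym oner_eq0.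
Qed.

Definition lam h : C := tau (r h *m swap).
Definition sreg h : AA := tless (r h *m swap) *m swap.

Lemma r_split h : r h = lam h *: swap + sreg h.
Proof.
rewrite /lam /sreg /tless mulmxBl -mulmxA swapK mulmx1 mul_scalar_mx addrC subrK.
by [].
Qed.

Lemma rswap_opp h : D h -> r (- h) *m swap = - flip (r h *m swap).
Proof.
move=> Dh; rewrite flipM flip_swap -[r (- h)]flipK (dom_flip H Dh) linearN /= mulNmx.
by [].
Qed.

Lemma lam_opp h : D h -> lam (- h) = - lam h.
Proof. by move=> Dh; rewrite /lam rswap_opp // linearN /= tau_flip. Qed.

Lemma sreg_opp h : D h -> sreg (- h) = - flip (sreg h).
Proof.
move=> Dh; apply: (addrI (lam (- h) *: swap)); rewrite -r_split lam_opp //.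
have -> : sreg h = r h - lam h *: swap by rewrite r_split addrC addKr.
rewrite flipD flipN flipZ flip_swap opprB scaleNr addKr -[LHS]flipK (dom_flip H Dh).
by rewrite linearN.
Qed.

(** The systems at h and - h determine U, so U converges, and r(h) is c P / h + s
  up to terms that vanish in the limit. If c were 0, the contraction of the
  limit system with the X of dual_moves would force X = 0. *)
Lemma simple_pole : exists c s, [/\ c != 0, tends (0 : C)^' (fun h => h * lam h) c,
  tends (0 : C)^' sreg s & flip s = - s].
Proof.
have [v [X [Dv uv uv' vX dX]]] := dual_moves.
have rv := hasder_tends (r_hasder Dv).
pose quo h : AA := h^-1 *: (r (v + h) - r v).
have qv : tends (0 : C)^' quo (dr v) := r_hasder Dv.
pose U h : AA := tless (r h *m swap) + (h * lam h)%:M.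
have tU h : tau (U h) = h * lam h.
  by rewrite /U tauD tau_scalar ?NN_neq0 // tau_tless ?NN_neq0 // add0r.
have zU h : tless (U h) = tless (r h *m swap).
  by rewrite {1}/tless tU /U addrK.
pose G h : AAA := t12 (r v) *m t13 (r (v + h)) *m t23 swap.
pose G0 : AAA := t12 (r v) *m t13 (r v) *m t23 swap.
have GG : tends (0 : C)^' G G0.
  apply: tends_mulmx; last exact: tends_cst.
  by apply: tends_mulmx; [exact: tends_cst|exact: (tends_lin FF (@t13 _ N))].
have eqn h : h != 0 -> D h -> D (v + h) -> pole_op (r v) (r (v + h)) (quo h) (U h) = G h.
  move=> h0 Dh Dvh; rewrite /pole_op tU zU.
  have -> : tless (r h *m swap) = r h *m swap - (lam h)%:M by [].
  have t23c (k : C) : t23 k%:M = k%:M :> AAA by rewrite -scalemx1 linearZ /= t23_1 scalemx1.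
  have -> : t23 (r h *m swap - (lam h)%:M) = t23 (r h) *m t23 swap - (lam h)%:M :> AAA.
    by rewrite linearB /= t23M t23c.
  rewrite mulmxBl mulmxBr mul_scalar_mx mul_mx_scalar -mulmxA -t12_swap23.
  have -> : t13 (quo h) = h^-1 *: (t13 (r (v + h)) - t13 (r v)) :> AAA.
    by rewrite /quo linearZ linearB.
  rewrite scalerA mulrAC divff // mul1r scalerBr !mulmxA.
  have aeq : t12 (r v) *m t13 (r (v + h)) =
     t23 (r h) *m t12 (r v) - t13 (r (v + h)) *m t23 (r h).
    have := dom_AYB H Dv Dh Dvh; rewrite /AYB => /eqP.
    by rewrite -addrA addr_eq0 opprD opprK => /eqP.
  rewrite /G aeq mulmxBl -?mulmxA.
  have E (a b p q : AAA) : a - p - (b - q) - (q - p) = a - b.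
    by apply/matrixP => i j; rewrite !mxE; ring.
  exact: E.
have inj u : pole_op (r v) (r v) (dr v) u = 0 ->
    (pole_op (r v) (r v) (dr v) \o @pole_flip C N) u = 0 -> u = 0.
  exact: (pole_op_inj NN_neq0 o uv vX dX).
have opT u : tends (0 : C)^' (fun h => pole_op (r v) (r (v + h)) (quo h) u)
    (pole_op (r v) (r v) (dr v) u).
  apply: tendsB; last first.
    by apply: tendsZ; [exact: tends_cst|exact: (tends_lin FF (@t13 _ N))].
  apply: tendsB; first exact: tends_cst.
  by apply: tends_mulmx; [exact: (tends_lin FF (@t13 _ N))|exact: tends_cst].
pose f h : {linear AA -> AAA} := pole_op (r v) (r (v + h)) (quo h).
pose f0 : {linear AA -> AAA} := pole_op (r v) (r v) (dr v).
pose pf : {linear AA -> AA} := @pole_flip C N.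
pose g h : {linear AA -> AAA} := (f (- h) \o pf).
pose g0 : {linear AA -> AAA} := (f0 \o pf).
have gg u : tends (0 : C)^' (fun h => g h u) (g0 u) := tends_opp0 (opT (pole_flip u)).
have GG' : tends (0 : C)^' (fun h => G (- h)) G0 := tends_opp0 GG.
have sys : \forall h \near (0 : C)^', f h (U h) = G h /\ g h (U h) = G (- h).
  have nD := near0_and (near_dom_shift Dv) (@dnbhs_neq0 C).
  apply: filterS2 nD (near0_opp nD) => h [[Dh Dvh] h0] [[Dh' Dvh'] h0'].
  split; first exact: eqn.
  rewrite -(eqn _ h0' Dh' Dvh'); congr (pole_op _ _ _ _).
  rewrite /pf /= /pole_flip tU zU /U.
  rewrite (lam_opp Dh) mulrNN (rswap_opp Dh) [RHS]addrC; congr (_ + _).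
  by rewrite tless_opp_flip.
have [U0 UU] := @solve_limit2 C C (0 : C)^' FF _ _ _ _ _ _ f f0 g g0 U G G0
  (fun h => G (- h)) G0 inj opT gg GG GG' sys.
have tl : tends (0 : C)^' (fun h => h * lam h) (tau U0).
  apply: (tends_ext FF _ _ (tendsM FF (tends_mxtrace FF UU) (tends_cst FF ((N * N)%:R^-1 : C)))) => //.
have zl : tends (0 : C)^' (fun h => tless (U h)) (tless U0) := tends_lin FF (@tless C N) UU.
have sl : tends (0 : C)^' sreg (tless U0 *m swap).
  have h1 := tends_mulmx FF zl (tends_cst FF (swap : AA)).
  have E h : tless (U h) *m swap = sreg h by rewrite zU.
  exact: (tends_ext FF E erefl h1).
exists (tau U0), (tless U0 *m swap); split=> //.
- apply/eqP => c0.
  have lim : pole_op (r v) (r v) (dr v) U0 = G0.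
    apply: (@tends_unique _ _ (0 : C)^' FF _ (fun h => pole_op (r v) (r (v + h)) (quo h) (U h))).
      apply: tendsB; last first.
        apply: (tends_ext FF _ _ (tendsZ FF tl (tends_lin FF (@t13 _ N) qv))) => // h.
        by rewrite tU.
      apply: tendsB; apply: tends_mulmx; try exact: tends_cst.
      + exact: (tends_lin FF (@t23 _ N) zl).
      + exact: (tends_lin FF (@t13 _ N) rv).
      + exact: (tends_lin FF (@t23 _ N) zl).
    apply: (tends_near FF _ GG); have nD := near0_and (near_dom_shift Dv) (@dnbhs_neq0 C).
    by apply: filterS nD => h [[Dh Dvh] h0]; rewrite eqn.
  have := congr1 (comb1 X) lim; rewrite /pole_op c0 scale0r subr0 comb1B.
  rewrite comb1_23_13 comb1_13_23 vX tens11 mulmx1 mul1mx subrr /G0 comb1_12_13_23.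
  move=> /esym/(congr1 (mulmx^~ swap)); rewrite -mulmxA swapK mulmx1 mul0mx.
  move=> /(comb1_12_13_inj uv' uv) X0.
  move: vX; rewrite X0 linear0 => /matrixP/(_ o o); rewrite !mxE eqxx.
  by move/eqP; rewrite eq_sym oner_eq0.
- apply: (can_inj (@flipK C N)); rewrite flipK linearN /=.
  apply: (@tends_unique _ _ (0 : C)^' FF _ (fun h => sreg (- h))); first exact: tends_opp0.
  apply: (tends_near FF _ (tendsN FF (tends_lin FF (@flip C N) sl))).
  by apply: filterS near_dom => h Dh; rewrite sreg_opp.
Qed.

(** In the limit of the equation with v' tending to 0, the two polar terms combine
  into c times a difference quotient of r13. *)
Lemma AYBE_at_pole (c : C) (s : AA) v : tends (0 : C)^' (fun h => h * lam h) c ->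
  tends (0 : C)^' sreg s -> D v ->
  t12 (r v) *m t13 (r v) =
    t23 s *m t12 (r v) - t13 (r v) *m t23 s - c *: (t13 (dr v) *m t23 swap).
Proof.
move=> cl sl Dv; have rv := hasder_tends (r_hasder Dv).
have t13l : tends (0 : C)^' (fun h => t13 (r (v + h)) : AAA) (t13 (r v)) :=
  tends_lin FF (@t13 _ N) rv.
have t23l : tends (0 : C)^' (fun h => t23 (sreg h) : AAA) (t23 s) := tends_lin FF (@t23 _ N) sl.
have ql : tends (0 : C)^' (fun h => t13 (h^-1 *: (r (v + h) - r v)) : AAA) (t13 (dr v)) :=
  tends_lin FF (@t13 _ N) (r_hasder Dv).
apply: (@tends_unique _ _ (0 : C)^' FF _ (fun h => t12 (r v) *m t13 (r (v + h)))).
  by apply: tends_mulmx => //; exact: tends_cst.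
have h1 := tends_mulmx FF t23l (tends_cst FF (t12 (r v))).
have h2 := tends_mulmx FF t13l t23l.
have h3 := tendsZ FF cl (tends_mulmx FF ql (tends_cst FF (t23 swap : AAA))).
apply: (tends_near FF _ (tendsB FF (tendsB FF h1 h2) h3)).
apply: filterS2 (near_dom_shift Dv) (@dnbhs_neq0 C) => h [Dh Dvh] h0.
have -> : t12 (r v) *m t13 (r (v + h)) =
     t23 (r h) *m t12 (r v) - t13 (r (v + h)) *m t23 (r h).
  have := dom_AYB H Dv Dh Dvh; rewrite /AYB => /eqP.
  by rewrite -addrA addr_eq0 opprD opprK => /eqP.
have -> : t13 (h^-1 *: (r (v + h) - r v)) = h^-1 *: (t13 (r (v + h)) - t13 (r v)) :> AAA.
  by rewrite linearZ linearB.
have -> : t23 (r h) = lam h *: t23 swap + t23 (sreg h) :> AAA.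
  by rewrite [r h in LHS]r_split linearD linearZ.
rewrite mulmxDl mulmxDr -!scalemxAl -scalemxAr scalerA mulrAC divff // mul1r mulmxBl.
rewrite swap23_t12 -?mulmxA.
have E (a b p q : AAA) (k : C) : a - b - k *: (p - q) = k *: q + a - (k *: p + b).
  by apply/matrixP => i j; rewrite !mxE; ring.
exact: E.
Qed.

End Pole.
(** * Consequences of the equation at the pole *)

Section ScalarTools.
Variable R : realType.
Local Notation C := (Cplx R).
Local Notation rc x := ((x : R)%:C%C : C).

Lemma hasder_trace n (f : C -> 'M[C]_n) z d :
  hasder f z d -> hasder (fun w => \tr (f w) : C) z (\tr d).
Proof.
have FF := @dnbhs_filter _ (0 : C).
move=> fd; apply: (tends_ext FF _ _ (tends_mxtrace FF fd)) => // h.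
by rewrite mxtraceZ raddfB.
Qed.

Lemma hasder_scalar_mx n (f : C -> C) z d :
  hasder f z d -> hasder (fun w => (f w)%:M : 'M[C]_n) z d%:M.
Proof.
have FF := @dnbhs_filter _ (0 : C).
move=> fd; apply: (tends_ext FF _ _ (tends_scalar_mx FF n fd)) => // h.
by rewrite -raddfB -scale_scalar_mx.
Qed.

(** A punctured disc is connected, so f is constant there, and the constant is the
  limit. *)
Lemma zero_der_near0 m n (f : C -> 'M[C]_(m, n)) a :
  (\forall v \near (0 : C)^', hasder f v 0) -> tends (0 : C)^' f a ->
  \forall v \near (0 : C)^', f v = a.
Proof.
have FF := Proper_dnbhs_numFieldType (0 : C).
rewrite {1}/dnbhs near_withinE => /nbhs_ballP[_ /= /posC[d d0 ->] dP] fa.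
pose D' := [set v : C | disc d v /\ v != 0].
have nD : \forall v \near (0 : C)^', D' v.
  have d0' : 0 < rc d by rewrite -[0]/(rc 0) rc_lt.
  by rewrite /dnbhs near_withinE; apply: filterS (nbhsx_ballx (0 : C) (rc d) d0').
have opD z : disc d z -> \forall w \near z, disc d w.
  by move=> dz; apply: (@open_nbhs_nbhs _ z (disc d)); split=> //; exact: ball_open.
have eqf v v1 : D' v -> D' v1 -> f v - f v1 = 0.
  move=> Dv Dv1.
  have dD z : D' z -> disc d z by case.
  have oD z : D' z -> \forall w \near z, D' w.
    by move=> [dz z0]; apply: near_and; [exact: opD|exact: near_neq].
  have gD z : disc d z -> \forall w \near z^', D' w.
    move=> dz; have [->|z0] := eqVneq z 0; first exact: nD.
    by apply: nbhs_dnbhs; apply: oD.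
  have hD z : D' z -> hasder (fun w => f w - f v1) z ((0 : 'M[C]_m) *m (f z - f v1)).
    move=> [dz z0]; rewrite mul0mx -[0](subr0 0).
    by apply: hasderB (hasder_cst _ _); exact: dP.
  have cD z : D' z -> tends (nbhs z) (fun=> 0 : 'M[C]_m) 0 by move=> _; exact: tends_cst.
  exact: (@linear_ode_global _ d D' _ _ (fun w => f w - f v1) (fun=> 0) v1 v dD oD gD hD cD
    Dv1 (subrr _) Dv).
apply: filterS (nD) => v Dv; apply: (@tends_unique _ _ (0 : C)^' FF _ f); last exact: fa.
apply: (tends_near _ _ (tends_cst _ (f v))).
by apply: filterS nD => w Dw; apply/eqP; rewrite -subr_eq0 eqf.
Qed.

(** Of the two square roots of p, the one with nonnegative real part. *)
Lemma sqrt_near1 (p : C) : exists q : C, q ^+ 2 = p /\ `|q - 1| <= `|p - 1|.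
Proof.
pose q := sqrtC p; have qq : q ^+ 2 = p by rewrite sqrtCK.
have H (w : C) : w ^+ 2 = p -> 1 <= `|w + 1| -> `|w - 1| <= `|p - 1|.
  move=> <- w1; rewrite subr_sqr_1 normrM -{1}[`|w - 1|]mulr1.
  by apply: ler_wpM2l.
have re (z : C) : 0 <= complex.Re z -> 1 <= `|z + 1|.
  move=> z0; apply: le_trans (normc_ge_Re (z + 1)); rewrite -[1]/(rc 1) rc_le.
  by case: z z0 => a b /= a0; rewrite ger0_norm ?addr_ge0 // lerDr.
have [q0|q0] := leP 0 (complex.Re q).
  by exists q; split=> //; apply: H => //; exact: re.
exists (- q); split; first by rewrite sqrrN.
apply: H; first by rewrite sqrrN.
by apply: re; case: (q) q0 => a b /= a0; rewrite oppr_ge0 ltW.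
Qed.

End ScalarTools.

Section Consequences.
Variables (R : realType) (N : nat).
Local Notation C := (Cplx R).
Local Notation A := 'M[C]_N.
Local Notation AA := 'M[C]_(N * N).
Variables (e : R) (D : set C) (r : C -> AA).
Hypotheses (hN : (0 < N)%N) (he : 0 < e) (H : AYBE_domain e D r).
Variables (c : C) (s : AA).
Hypotheses (c0 : c != 0) (cl : tends (0 : C)^' (fun h => h * lam r h) c)
  (sl : tends (0 : C)^' (sreg r) s) (fs : flip s = - s).
Let FF : ProperFilter (0 : C)^' := Proper_dnbhs_numFieldType (0 : C).
Let o : 'I_N := Ordinal hN.
Local Notation dr := (dr r).
Implicit Types v : C.

Lemma N_neq0 : N%:R != 0 :> C. Proof. by rewrite pnatr_eq0 -lt0n hN. Qed.

(** With these names the Riccati equation below reads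
  r' = kap ([1 (x) kk, r] - r * r). *)
Definition kk : A := mu (flip s).
Definition kap : C := (N%:R * c)^-1.
Definition alpha v : A := ptr2 (r v).

(** The products of the last two factors of AYBE_at_pole, in the order b c here and
  in the order c b in the next lemma. *)
Lemma sqr_ptr2 v : D v -> r v *m r v = - c *: (ptr2 (dr v) *t 1%:M).
Proof.
move=> Dv; have := congr1 (@mu23 _ N) (AYBE_at_pole he H cl sl Dv).
rewrite mu23_12_13 !linearB linearZ /= mu23_23_12 subrr sub0r mu23_13_swap.
by rewrite scaleNr.
Qed.

Lemma riccati v : D v ->
  (c * N%:R) *: dr v = (1%:M *t kk) *m r v - r v *m (1%:M *t kk) - pmul (r v) (r v).
Proof.
move=> Dv; have := congr1 (@mu32 _ N) (AYBE_at_pole he H cl sl Dv).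
rewrite mu32_12_13 !linearB linearZ /= mu32_23_12 !mu32_13_23 mu_flip_swap => ->.
rewrite -[N%:R%:M]scalemx1 tensZr tens11 -scalemxAr mulmx1 scalerA.
by rewrite opprB addrC subrK.
Qed.

Lemma dr_opp v : D v -> dr (- v) = flip (dr v).
Proof.
move=> Dv; apply: oppr_inj.
have h1 := hasder_opp (r_hasder H (dom_opp H Dv)).
have h2 : hasder (fun w => r (- w)) v (- flip (dr v)).
  apply: hasder_near (hasderN (hasder_lin (@flip C N) (r_hasder H Dv))).
  apply: filterS (dom_open H Dv) => w Dw.
  by rewrite /= -[r (- w)]flipK (dom_flip H Dw) linearN.
exact: hasder_unique h1 h2.
Qed.

Lemma r_flipE v : D v -> r v = - flip (r (- v)).
Proof. by move=> Dv; rewrite (dom_flip H Dv) opprK. Qed.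

Definition ff v : C := tau (r v *m r v).

(** By sqr_ptr2 the square lies in A (x) 1 and, by unitarity, in 1 (x) A. *)
Lemma sqr_ff v : D v -> r v *m r v = (ff v)%:M.
Proof.
move=> Dv; rewrite /ff; have h1 := sqr_ptr2 Dv; have h2 := sqr_ptr2 (dom_opp H Dv).
have h3 : r v *m r v = 1%:M *t (- c *: ptr2 (dr (- v))).
  rewrite {1 2}(r_flipE Dv) mulNmx mulmxN opprK -flipM h2 flipZ flip_tens tensZr.
    reflexivity.
rewrite -tensZl in h1; have aS := tens1_scalar o (etrans (esym h1) h3).
rewrite h1 aS; move: (_ o o) => k.
have -> : k%:M *t 1%:M = k%:M :> AA by rewrite -[k%:M in LHS]scalemx1 tensZl tens11 scalemx1.
by rewrite tau_scalar // (NN_neq0 _ hN).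
Qed.

Lemma ptr2_dr v : D v -> ptr2 (dr v) = (- ff v / c)%:M.
Proof.
move=> Dv; have := sqr_ptr2 Dv; rewrite (sqr_ff Dv).
move: (ptr2 (dr v)) (ff v) => p f h; apply/matrixP => i j.
have := congr1 (fun t => tcoef t i j o o) h.
rewrite tcoefZ tcoef_tens -[f%:M]scalemx1 tcoefZ -tens11 tcoef_tens !mxE !eqxx !mulr1.
move=> h'; apply: (mulfI c0); rewrite -[c * p i j]opprK -mulNr -h'.
by rewrite -mulr_natr; field.
Qed.

(** The Riccati equation at - v, once flipped, differs from the one at v only in
  the factor on which kk acts. *)
Lemma kk_sym v : D v -> lie (kk *t 1%:M + 1%:M *t kk) (r v) = 0.
Proof.
move=> Dv; have h1 := riccati Dv; have := riccati (dom_opp H Dv).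
move=> /(congr1 (@flip C N)); rewrite dr_opp // flipZ flipK h1 !flipD !flipN !flipM flip_tens.
rewrite flip_pmul; have fr : flip (r (- v)) = - r v by exact: dom_flip H _ Dv.
have pN x : pmul (- x) (- x) = pmul x x :> AA.
  by rewrite /pmul linearN /= mulNmx mulmxN opprK.
rewrite fr pN mulNmx mulmxN opprK => /addIr h.
have E (p q p' q' : AA) : q - q' = - p + p' -> p + q - (p' + q') = 0.
  move=> hh; have -> : q = - p + p' + q' by rewrite -hh subrK.
  by apply/matrixP => i j; rewrite !mxE; ring.
rewrite /lie mulmxDl mulmxDr; exact: E h.
Qed.

Lemma alpha_lie v v' : D v -> D v' -> D (v + v') ->
  lie (alpha (v + v') *t 1%:M + 1%:M *t alpha v') (r v) = 0.
Proof.
by move=> Dv Dv' Dw; exact: (AYB_ptr2 (dom_AYB H Dv Dv' Dw) (r_AYB' H Dv Dv' Dw)).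
Qed.

Lemma trace_s : \tr s = 0.
Proof.
have : \tr s = - \tr s by rewrite -{1}trace_flip fs linearN.
by move/eqP; rewrite -subr_eq0 opprK -mulr2n mulrn_eq0 /= => /eqP.
Qed.

Definition JJ h : AA := (h / c) *: r h.

Lemma JJ_tends : tends (0 : C)^' JJ swap.
Proof.
have h1 := tendsM FF cl (tends_cst FF c^-1).
have h2 := tendsM FF (tends_id0 C) (tends_cst FF c^-1).
have := tendsD FF (tendsZ FF h1 (tends_cst FF (swap : AA))) (tendsZ FF h2 sl).
rewrite divff // scale1r mul0r scale0r addr0; apply: tends_ext => // h.
by rewrite /JJ [r h in RHS]r_split scalerDr scalerA mulrAC.
Qed.

(** Near 0 the operator (v / c) r(v) squares to a scalar and is close to the
  permutation P, hence is conjugate to a multiple of P; this computes its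
  trace. *)
Lemma near_trace : exists psi : C -> C, [/\ tends (0 : C)^' psi 1,
  \forall h \near (0 : C)^', \tr (r h) = N%:R * (c * psi h / h)
  & \forall h \near (0 : C)^', (c * psi h / h) ^+ 2 = ff h].
Proof.
pose phi h : C := (h / c) ^+ 2 * ff h.
have JJphi h : D h -> JJ h *m JJ h = (phi h)%:M.
  move=> Dh; rewrite /JJ -scalemxAl -scalemxAr sqr_ff // scalerA -scalemx1 scalerA.
  by rewrite scalemx1.
have phiE h : D h -> phi h = tau (JJ h *m JJ h).
  by move=> Dh; rewrite JJphi // tau_scalar // (NN_neq0 _ hN).
have phil : tends (0 : C)^' phi 1.
  have h1 := tendsM FF (tends_mxtrace FF (tends_mulmx FF JJ_tends JJ_tends)) (tends_cst FF (((N * N)%:R : C)^-1)).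
  apply: (tends_ext FF (fun=> erefl) _ (tends_near FF _ h1)).
    by rewrite swapK -/(tau 1%:M) tau_scalar // (NN_neq0 _ hN).
  by apply: filterS (near_dom he H) => h Dh; rewrite phiE.
have [psi psiP] : exists psi : C -> C, forall h, psi h ^+ 2 = phi h /\ `|psi h - 1| <= `|phi h - 1|.
  by have [psi psiP] := choice (fun h => sqrt_near1 (phi h)); exists psi.
have psil : tends (0 : C)^' psi 1.
  apply/tends_dist => eps e0; have /tends_dist/(_ _ e0) := phil.
  by apply: filterS => h; apply: le_lt_trans; exact: (psiP h).2.
exists psi; split=> //; last first.
  apply: filterS2 (near_dom he H) (@dnbhs_neq0 C) => h Dh h0.
  rewrite !exprMn (psiP h).1 /phi exprMn !exprVn.
  by field; rewrite h0 c0.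
(* JJ^2 = psi^2 gives JJ KK = psi KK P, so the invertible KK conjugates JJ into
  psi P *)
pose KK h : AA := JJ h + psi h *: swap.
have KKl := tendsD FF JJ_tends (tendsZ FF psil (tends_cst FF (swap : AA))).
have uK : (swap + 1 *: swap : AA) \in unitmx.
  rewrite scale1r -mulr2n -scaler_nat unitmxE detZ unitrM unitrX ?unitfE ?pnatr_eq0 //=.
  rewrite -unitfE -unitmxE; have /mulmx1_unit[] := @swapK C N; by [].
apply: filterS3 (near_dom he H) (@dnbhs_neq0 C) (tends_unit FF uK KKl) => h Dh h0 uh.
have JK : JJ h *m KK h = psi h *: (KK h *m swap).
  rewrite /KK mulmxDr mulmxDl scalerDr JJphi // -scalemxAr -scalemxAl swapK scalerA.
  by rewrite -expr2 (psiP h).1 scalemx1 addrC.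
have -> : r h = (c / h) *: JJ h.
  rewrite /JJ scalerA (_ : c / h * (h / c) = 1) ?scale1r //.
  by field; rewrite h0 c0.
have -> : JJ h = psi h *: (KK h *m swap *m invmx (KK h)).
  by rewrite scalemxAl -JK mulmxK.
by rewrite !mxtraceZ mxtrace_mulC mulmxA mulVmx // mul1mx trace_swap; field.
Qed.

Lemma tr_hasder v : D v -> hasder (fun w => \tr (r w) : C) v (- (N%:R * ff v / c)).
Proof.
move=> Dv; have := hasder_trace (r_hasder H Dv).
rewrite -trace_ptr2 ptr2_dr // mxtrace_scalar; apply: hasder_ext => //.
by rewrite -mulr_natr; ring.
Qed.

(** By the scalar Riccati equation for the trace, N c / tr r(v) - v has zero
  derivative near 0, and it tends to 0. *)
Lemma near_tr : \forall v \near (0 : C)^', \tr (r v) = N%:R * (c / v) /\ ff v = (c / v) ^+ 2.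
Proof.
have [psi [psil h1 h2]] := near_trace.
have psi0 : \forall h \near (0 : C)^', psi h != 0 by apply: tends_neq0 psil; exact: oner_neq0.
pose u h : C := N%:R * c / \tr (r h) - h.
have un : \forall h \near (0 : C)^', u h = h / psi h - h.
  apply: filterS3 h1 psi0 (@dnbhs_neq0 C) => h e1 p0 h0; rewrite /u e1.
  by congr (_ - _); field; rewrite N_neq0 c0 p0 h0.
have ul : tends (0 : C)^' u 0.
  have p1 := tendsV FF (oner_neq0 C) psil.
  have := tendsB FF (tendsM FF (tends_id0 C) p1) (tends_id0 C).
  rewrite mul0r subr0; apply: tends_near.
  by apply: filterS un => h ->.
have und : \forall h \near (0 : C)^', hasder u h 0.
  apply: filterS3 (near_dom he H) (near0_and h1 psi0) (near0_and h2 (@dnbhs_neq0 C)).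
  move=> h Dh [e1 p0] [e2 h0].
  have tr0 : \tr (r h) != 0.
    by rewrite e1 !mulf_neq0 ?invr_eq0 // N_neq0.
  have := hasderZ (hasder_cst (N%:R * c : C) h) (hasderVs tr0 (tr_hasder Dh)).
  move=> /hasderB/(_ (hasder_id h)); apply: hasder_ext => //.
  rewrite /GRing.scale /= mul0r add0r -e2 e1; field.
  by rewrite N_neq0 c0 p0 h0.
have u0 : \forall h \near (0 : C)^', (u h)%:M = 0 :> 'M[C]_1.
  apply: zero_der_near0.
    by apply: filterS und => h /(hasder_scalar_mx 1); rewrite raddf0.
  by have := tends_scalar_mx FF 1 ul; rewrite raddf0.
apply: filterS3 (near0_and u0 un) (near0_and h1 psi0) (near0_and h2 (@dnbhs_neq0 C)).
move=> h [/matrixP/(_ 0 0)] /[!mxE] /=; rewrite mulr1n => uh0 uE [e1 p0] [e2 h0].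
have p1 : psi h = 1.
  have hp : h / psi h = h by apply/eqP; rewrite -subr_eq0 -uE uh0.
  by apply: (mulfI h0); rewrite mulr1 -{1}hp divfK.
by rewrite e1 -e2 p1 mulr1.
Qed.

Definition beta : A := ptr2 s.

Lemma beta_tr : \tr beta = 0.
Proof. by rewrite /beta trace_ptr2 trace_s. Qed.

Lemma alpha_hasder v : D v -> hasder alpha v ((- ff v / c)%:M).
Proof. by move=> Dv; rewrite -ptr2_dr //; exact: (hasder_lin (@ptr2 _ N) (r_hasder H Dv)). Qed.

Lemma cv_hasder v : v != 0 -> hasder (fun w : C => (c / w)%:M : A) v (- (c / v ^+ 2))%:M.
Proof.
move=> v0; apply: hasder_scalar_mx.
have := hasderZ (hasder_cst (c : C) v) (hasderVs v0 (hasder_id v)).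
by apply: hasder_ext => //; rewrite /GRing.scale /= mul0r add0r; ring.
Qed.

(** Both sides have the same derivative near 0, and their difference tends to 0. *)
Lemma near_alpha : \forall v \near (0 : C)^', alpha v = beta + (c / v)%:M.
Proof.
have h : \forall v \near (0 : C)^', alpha v - (c / v)%:M = beta.
  apply: zero_der_near0.
    apply: filterS3 (near_dom he H) near_tr (@dnbhs_neq0 C) => v Dv [_ fE] v0.
    apply: hasder_ext (hasderB (alpha_hasder Dv) (cv_hasder v0)) => //.
    have -> : - ff v / c = - (c / v ^+ 2) by rewrite fE; field; rewrite c0 v0.
    by rewrite subrr.
  have h1 := tendsN FF (tendsM FF (tends_mxtrace FF sl) (tends_cst FF (N%:R^-1 : C))).
  have hp : tends (0 : C)^' (fun h => ptr2 (sreg r h) : A) beta := tends_lin FF (@ptr2 _ N) sl.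
  have h2 := tendsD FF hp (tends_scalar_mx FF N h1).
  move: h2; rewrite trace_s mul0r oppr0 raddf0 addr0.
  apply: (tends_near FF); apply: filterS near_tr => v [tE _].
  have nN := N_neq0.
  have lE : lam r v - c / v = - (\tr (sreg r v) / N%:R).
    move: tE; rewrite {1}(r_split r v) mxtraceD mxtraceZ trace_swap => tE.
    apply: (mulfI nN); rewrite mulrBr -tE; field; exact: nN.
  have aE : alpha v = lam r v *: 1%:M + ptr2 (sreg r v).
    by rewrite /alpha [in LHS](r_split r v) [LHS]linearD linearZ /= ptr2_swap.
  rewrite -lE aE.
  move: (ptr2 (sreg r v)) (lam r v) => p l.
  by apply/matrixP => i j; rewrite !mxE; ring.
by apply: filterS h => v <-; rewrite subrK.
Qed.

Lemma tens_scalarl (k : C) : k%:M *t 1%:M = k%:M :> AA.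
Proof. by rewrite -[k%:M in LHS]scalemx1 tensZl tens11 scalemx1. Qed.

Lemma tens_scalarr (k : C) : 1%:M *t k%:M = k%:M :> AA.
Proof. by rewrite -[k%:M in LHS]scalemx1 tensZr tens11 scalemx1. Qed.

Lemma lie_scalar n (k : C) (x y : 'M[C]_n) : lie (x + k%:M) y = lie x y.
Proof.
rewrite /lie mulmxDl mulmxDr mul_scalar_mx mul_mx_scalar.
by rewrite opprD addrACA subrr addr0.
Qed.

(** In alpha_lie the scalar parts of alpha commute with r(v). *)
Lemma beta_comm v : D v ->
  (forall w, D w -> alpha w = beta + (c / w)%:M) ->
  lie (beta *t 1%:M + 1%:M *t beta) (r v) = 0.
Proof.
move=> Dv aE; have /filter_ex[h [Dh Dvh]] := near_dom_shift he H Dv.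
have := alpha_lie Dv Dh Dvh; rewrite (aE _ Dvh) (aE _ Dh).
rewrite tensDl tensDr tens_scalarl tens_scalarr addrA lie_scalar addrAC lie_scalar.
by [].
Qed.

(** The partial trace of kk_sym over the second factor: the terms with kk in that
  factor cancel by cyclicity. *)
Lemma kk_beta : kk *m beta = beta *m kk.
Proof.
have /filter_ex[v [Dv aE]] := near0_and (near_dom he H) near_alpha.
have E1 t (a : A) : ptr2 ((a *t 1%:M) *m t) = a *m ptr2 t.
  elim/tens_ind: t => [x y|t t' ht ht']; last by rewrite mulmxDr !linearD /= ?mulmxDr ht ht'.
  by rewrite -tensmxM !ptr2_tens mul1mx scalemxAr.
have E2 t (a : A) : ptr2 (t *m (a *t 1%:M)) = ptr2 t *m a.
  elim/tens_ind: t => [x y|t t' ht ht']; last by rewrite mulmxDl !linearD /= ?mulmxDl ht ht'.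
  by rewrite -tensmxM !ptr2_tens mulmx1 scalemxAl.
have E3 t (a : A) : ptr2 ((1%:M *t a) *m t) = ptr2 (t *m (1%:M *t a)).
  elim/tens_ind: t => [x y|t t' ht ht']; last by rewrite mulmxDr mulmxDl !linearD /= ht ht'.
  by rewrite -!tensmxM !ptr2_tens mul1mx mulmx1 mxtrace_mulC.
have p2D t t' : ptr2 (t + t') = ptr2 t + ptr2 t' :> A by exact: linearD.
have /eqP := kk_sym Dv; rewrite /lie subr_eq0 mulmxDl mulmxDr => /eqP.
move=> /(congr1 (@ptr2 C N)); rewrite !p2D E1 E2 E3 => /addIr.
rewrite -/(alpha v) aE mulmxDl mulmxDr mul_scalar_mx mul_mx_scalar.
by move=> /addIr.
Qed.

End Consequences.
(** * The gauge transformation that makes the solution rational *)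

Section PolyTools.
Variable R : realType.
Local Notation C := (Cplx R).
Implicit Types (p q : {poly C}) (z : C).

Lemma near_notin (s : seq C) z : \forall v \near z^', v \notin s.
Proof.
elim: s => [|a s IH]; first by apply: filterE.
have ha : \forall v \near z^', v != a.
  have [->|az] := eqVneq a z; first exact: nbhs_dnbhs_neq.
  by apply: nbhs_dnbhs; apply: near_neq; rewrite eq_sym.
by apply: filterS2 ha IH => v va vs; rewrite inE negb_or va.
Qed.

Lemma horner_near_neq0 p z : p != 0 -> \forall v \near z^', p.[v] != 0.
Proof.
move=> p0; have [s sE] := closed_field_poly_normal p.
apply: filterS (near_notin s z) => v vs.
rewrite sE hornerZ mulf_neq0 ?lead_coef_eq0 //.
by rewrite -[_ == 0]/(root _ _) root_prod_XsubC.
Qed.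

Lemma horner_near_eq0 p z : (\forall v \near z^', p.[v] = 0) -> p = 0.
Proof.
move=> h; apply/eqP; apply: contraT => /(horner_near_neq0 z) h'.
have FF := Proper_dnbhs_numFieldType z.
by have /filter_ex[v [-> /eqP]] : \forall v \near z^', p.[v] = 0 /\ p.[v] != 0 by apply: filterS2 h h'.
Qed.

Definition hmx n m (P : 'M[{poly C}]_(n, m)) (v : C) : 'M[C]_(n, m) := map_mx (horner_eval v) P.

Lemma hmxE n m (P : 'M[{poly C}]_(n, m)) v i j : hmx P v i j = (P i j).[v].
Proof. by rewrite mxE. Qed.

Lemma hmxM n m l (P : 'M[{poly C}]_(n, m)) (Q : 'M[{poly C}]_(m, l)) v :
  hmx (P *m Q) v = hmx P v *m hmx Q v.
Proof. exact: map_mxM. Qed.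

Lemma hmx_det n (P : 'M[{poly C}]_n) v : (\det P).[v] = \det (hmx P v).
Proof. by rewrite /hmx det_map_mx. Qed.

Lemma hmx_adj n (P : 'M[{poly C}]_n) v : hmx (\adj P) v = \adj (hmx P v).
Proof. exact: map_mx_adj. Qed.

Lemma hmxD n m (P Q : 'M[{poly C}]_(n, m)) v : hmx (P + Q) v = hmx P v + hmx Q v.
Proof. exact: map_mxD. Qed.

Lemma hmxB n m (P Q : 'M[{poly C}]_(n, m)) v : hmx (P - Q) v = hmx P v - hmx Q v.
Proof. exact: map_mxB. Qed.

Lemma hmxZ n m p (P : 'M[{poly C}]_(n, m)) v : hmx (p *: P) v = p.[v] *: hmx P v.
Proof. by apply/matrixP => i j; rewrite !mxE /horner_eval hornerM. Qed.

Lemma hmxC n m (A : 'M[C]_(n, m)) v : hmx (map_mx polyC A) v = A.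
Proof. by apply/matrixP => i j; rewrite !mxE /horner_eval hornerC. Qed.

Lemma hmx_trace n (P : 'M[{poly C}]_n) v : (\tr P).[v] = \tr (hmx P v).
Proof. by rewrite /mxtrace horner_sum; apply: eq_bigr => i _; rewrite mxE. Qed.

Lemma hmx_near_eq n m (P Q : 'M[{poly C}]_(n, m)) z :
  (\forall v \near z^', hmx P v = hmx Q v) -> P = Q.
Proof.
move=> h; apply/matrixP => i j; apply/eqP; rewrite -subr_eq0; apply/eqP.
apply: (@horner_near_eq0 _ z); apply: filterS h => v /matrixP/(_ i j).
by rewrite !hmxE hornerD hornerN => ->; rewrite subrr.
Qed.

End PolyTools.

(** The structure of r on D: up to the one-parameter group F it is rational,
  with explicit square and partial trace. *)
Record AYBE_normal_form (R : realType) (N : nat) (D : set (Cplx R))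
    (r : Cplx R -> 'M[Cplx R]_(N * N)) (c : Cplx R) (b : 'M[Cplx R]_N)
    (F : Cplx R -> 'M[Cplx R]_N) : Prop := {
  nf_c0 : c != 0;
  nf_F0 : F 0 = 1%:M;
  nf_FD : forall v w, F (v + w) = F v *m F w;
  nf_Fder : forall v, exists d, hasder F v d;
  nf_FF : forall w v, D v -> (F w *t F w) *m r v = r v *m (F w *t F w);
  nf_Fb : forall v, b *m F v = F v *m b;
  nf_btr : \tr b = 0;
  nf_sqr : forall v, D v -> r v *m r v = ((c / v) ^+ 2)%:M;
  nf_alpha : forall v, D v -> ptr2 (r v) = N%:R *: b + (c / v)%:M;
  nf_bcomm : forall v, D v -> lie (b *t 1%:M + 1%:M *t b) (r v) = 0;
  nf_rat : exists (d : {poly Cplx R}) (P : 'M[{poly Cplx R}]_(N * N)), d != 0 /\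
    forall v, D v -> d.[v] *: ((1%:M *t F v) *m r v *m (1%:M *t F (- v))) = hmx P v;
  nf_pole : tends (0 : Cplx R)^' (fun v => v *: r v) (c *: (swap : 'M[Cplx R]_(N * N))) }.

Section Gauge.
Variables (R : realType) (N : nat).
Local Notation C := (Cplx R).
Local Notation A := 'M[C]_N.
Local Notation AA := 'M[C]_(N * N).

Definition tl1 (a : A) : AA := a *t 1%:M.
Definition tr1 (a : A) : AA := 1%:M *t a.
Lemma tl1_is_linear : linear tl1.
Proof. by move=> k a a'; rewrite /tl1 tensDl tensZl. Qed.
HB.instance Definition _ := GRing.isLinear.Build C A AA _ tl1 tl1_is_linear.
Lemma tr1_is_linear : linear tr1.
Proof. by move=> k a a'; rewrite /tr1 tensDr tensZr. Qed.
HB.instance Definition _ := GRing.isLinear.Build C A AA _ tr1 tr1_is_linear.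

Lemma tr1M a b : tr1 (a *m b) = tr1 a *m tr1 b.
Proof. by rewrite /tr1 -tensmxM mulmx1. Qed.

Lemma tl1M a b : tl1 (a *m b) = tl1 a *m tl1 b.
Proof. by rewrite /tl1 -tensmxM mulmx1. Qed.

Lemma tens_tl1 a b : a *t b = tl1 a *m tr1 b.
Proof. by rewrite /tl1 /tr1 -tensmxM mulmx1 mul1mx. Qed.

Lemma tl1_tr1C a b : tl1 a *m tr1 b = tr1 b *m tl1 a.
Proof. by rewrite -tens_tl1 /tl1 /tr1 -tensmxM mulmx1 mul1mx. Qed.

Variables (e : R) (D : set C) (r : C -> AA).
Hypotheses (hN : (0 < N)%N) (he : 0 < e) (H : AYBE_domain e D r).
Variables (c : C) (s : AA).
Hypotheses (c0 : c != 0) (cl : tends (0 : C)^' (fun h => h * lam r h) c)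
  (sl : tends (0 : C)^' (sreg r) s) (fs : flip s = - s).
Let FF : ProperFilter (0 : C)^' := Proper_dnbhs_numFieldType (0 : C).
Local Notation kk := (kk s).
Local Notation kap := (kap N c).
Local Notation alpha := (alpha r).
Local Notation beta := (beta s).

Variable F : C -> A.
Hypotheses (F0 : F 0 = 1%:M) (dF : forall v, hasder F v ((- kap *: kk) *m F v))
  (FD : forall v w, F (v + w) = F v *m F w)
  (FC : forall b, b *m (- kap *: kk) = (- kap *: kk) *m b -> forall v, b *m F v = F v *m b).

Lemma FKV v : F (- v) *m F v = 1%:M.
Proof. by rewrite -FD addNr F0. Qed.

Lemma F_kk v : kk *m F v = F v *m kk.
Proof. by apply: FC; rewrite -scalemxAr -scalemxAl. Qed.

Definition gau v (x : AA) : AA := tr1 (F v) *m x *m tr1 (F (- v)).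
Definition rho v : AA := gau v (r v).

Lemma gauD v x y : gau v (x + y) = gau v x + gau v y.
Proof. by rewrite /gau mulmxDr mulmxDl. Qed.

Lemma pmul_gau v (x y : AA) : pmul (gau v x) (gau v y) = gau v (pmul x y).
Proof.
elim/tens_ind: x => [a b|x x' hx hx']; last by rewrite gauD !pmulDl hx hx' gauD.
elim/tens_ind: y => [a' b'|y y' hy hy']; last by rewrite gauD !pmulDr hy hy' gauD.
rewrite /gau /tr1 -!tensmxM !pmul_tens -!tensmxM !mul1mx !mulmx1.
by rewrite !mulmxA -(mulmxA (F v *m b')) FKV mulmx1.
Qed.

Lemma gauge_alg n (k : C) (f K x p g : 'M[C]_n) :
  ((- k *: (f *m K)) *m x + f *m (k *: (K *m x - x *m K - p))) *m g
    + f *m x *m (k *: (K *m g)) = - k *: (f *m p *m g).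
Proof.
rewrite -!scalemxAr -!scalemxAl mulmxDl -!scalemxAl !mulmxBr !mulmxBl !mulmxA.
move: (f *m K *m x *m g) (f *m x *m K *m g) (f *m p *m g) => u v w.
by apply/matrixP => i j; rewrite !mxE; ring.
Qed.

(** The conjugation is chosen so that the commutator of the Riccati equation
  disappears. *)
Lemma rho_hasder v : D v -> hasder rho v (- kap *: pmul (rho v) (rho v)).
Proof.
move=> Dv.
have dF' : hasder (fun w => F (- w)) v (- ((- kap *: kk) *m F (- v))).
  exact: hasder_opp (dF (- v)).
have h1 : hasder (fun w => tr1 (F w)) v (tr1 ((- kap *: kk) *m F v)) := hasder_lin tr1 (dF v).
have h2 : hasder (fun w => tr1 (F (- w))) v (tr1 (- ((- kap *: kk) *m F (- v)))) :=
  hasder_lin tr1 dF'.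
have := hasderM (hasderM h1 (r_hasder H Dv)) h2.
apply: hasder_ext => //.
have -> : dr r v = kap *: (tr1 kk *m r v - r v *m tr1 kk - pmul (r v) (r v)).
  rewrite /tr1 -(riccati he H cl sl Dv) scalerA /kap mulrC [c * _]mulrC mulfV ?scale1r //.
  by rewrite mulf_neq0 // pnatr_eq0 -lt0n.
rewrite /rho pmul_gau.
have e1 : tr1 ((- kap *: kk) *m F v) = - kap *: (tr1 (F v) *m tr1 kk).
  by rewrite -scalemxAl F_kk -tr1M; exact: linearZ.
have e2 : tr1 (- ((- kap *: kk) *m F (- v))) = kap *: (tr1 kk *m tr1 (F (- v))).
  by rewrite -scalemxAl scaleNr opprK -tr1M; exact: linearZ.
rewrite e1 e2; exact: gauge_alg.
Qed.

Definition YY v : AA := pt (rho v).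

Lemma YY_hasder v : D v -> hasder YY v (- kap *: (YY v *m YY v)).
Proof.
move=> Dv; have := hasder_lin (@pt C N) (rho_hasder Dv).
apply: hasder_ext => //; rewrite /YY.
by rewrite -[pt _ *m pt _](@ptK C N) -/(pmul _ _); exact: linearZ.
Qed.

Lemma riccati_alg n (k t : C) (y y1 : 'M[C]_n) :
  - k *: (y *m y) - 0 + (k *: (y *m y1) + t *: ((- k *: (y *m y)) *m y1 + y *m 0)) =
  (- k *: y) *m (y - y1 + t *: (y *m y1)).
Proof.
rewrite mulmx0 addr0 subr0 mulmxDr mulmxBr -!scalemxAl -!scalemxAr -!mulmxA.
move: (y *m y) (y *m (y *m y1)) (y *m y1) => u v w.
by apply/matrixP => i j; rewrite !mxE; ring.
Qed.

(** The difference W of the two sides satisfies W' = - kap Y W and vanishes at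
  v1. *)
Lemma resolvent v v1 : D v -> D v1 ->
  YY v *m (1%:M + (kap * (v - v1)) *: YY v1) = YY v1.
Proof.
move=> Dv Dv1.
pose W w : AA := YY w - YY v1 + (kap * (w - v1)) *: (YY w *m YY v1).
have lin z : hasder (fun w : C => kap * (w - v1) : C) z kap.
  have := hasderZ (hasder_cst (kap : C) z) (hasderB (hasder_id z) (hasder_cst (v1 : C) z)).
  by apply: hasder_ext => //; rewrite /GRing.scale /= mul0r add0r subr0 mulr1.
have dW z : D z -> hasder W z ((- kap *: YY z) *m W z).
  move=> Dz; have hY := YY_hasder Dz.
  have := hasderD (hasderB hY (hasder_cst (YY v1) z))
    (hasderZ (lin z) (hasderM hY (hasder_cst (YY v1) z))).
  have E w : YY w - YY v1 + (kap * (w - v1)) *: (YY w *m YY v1) = W w by [].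
  apply: (hasder_ext E); exact: riccati_alg.
have cM z : D z -> tends (nbhs z) (fun w => - kap *: YY w) (- kap *: YY z).
  move=> Dz; apply: tendsZ; first exact: tends_cst.
  exact: hasder_cvg (YY_hasder Dz).
have W1 : W v1 = 0 by rewrite /W !subrr mulr0 scale0r addr0.
have := @linear_ode_global _ e D _ _ W (fun w => - kap *: YY w) v1 v (dom_disc H)
  (dom_open H) (dom_dense H) dW cM Dv1 W1 Dv.
rewrite /W mulmxDr mulmx1 -scalemxAr => /eqP.
by rewrite addrAC subr_eq0 => /eqP.
Qed.

Section BasePoint.
Variables (p : C) (Dp : D p).
Let Bp : 'M[{poly C}]_(N * N) :=
  1%:M + (kap *: ('X - p%:P)) *: map_mx polyC (YY p).
(** Cramer's rule for the resolvent based at p. The denominator equals 1 at p, so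
  that an identity of rational functions is read off at any point by basing the
  resolvent there. *)
Definition res_den : {poly C} := \det Bp.
Definition res_num : 'M[{poly C}]_(N * N) := map_mx polyC (YY p) *m \adj Bp.

Lemma hmx_Bp v : hmx Bp v = 1%:M + (kap * (v - p)) *: YY p.
Proof.
rewrite /Bp hmxD hmxZ hmxC hornerZ hornerXsubC; congr (_ + _).
by rewrite /hmx map_mx1.
Qed.

Lemma res_eq v : D v -> res_den.[v] *: YY v = hmx res_num v.
Proof.
move=> Dv; rewrite /res_num hmxM hmxC hmx_adj /res_den hmx_det hmx_Bp.
have := resolvent Dv Dp; move: (1%:M + _) => B h.
by rewrite -[in RHS]h -mulmxA mul_mx_adj mul_mx_scalar.
Qed.

Lemma res_den_base : res_den.[p] = 1.
Proof. by rewrite /res_den hmx_det hmx_Bp subrr mulr0 scale0r addr0 det1. Qed.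

Lemma res_num_base : hmx res_num p = YY p.
Proof.
by have := res_eq Dp; rewrite res_den_base scale1r.
Qed.
End BasePoint.

Lemma trace_YY v : \tr (YY v) = \tr (r v).
Proof.
rewrite /YY trace_pt /rho /gau mxtrace_mulC mulmxA -tr1M FKV.
by rewrite /tr1 tens11 mul1mx.
Qed.

(** The formula known near 0 extends to D, since both sides are rational. *)
Lemma tr_D v : D v -> \tr (r v) = N%:R * (c / v).
Proof.
move=> Dv; pose p : {poly C} := 'X * \tr (res_num v) - (N%:R * c) *: res_den v.
have p0 : p = 0.
  apply: (@horner_near_eq0 _ _ 0).
  apply: filterS3 (near_dom he H) (near_tr hN he H c0 cl sl) (@dnbhs_neq0 C) => w Dw [tw _] w0.
  rewrite /p hornerD hornerN hornerZ hornerM hornerX hmx_trace -(res_eq Dv Dw).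
  by rewrite mxtraceZ trace_YY tw; field.
have := congr1 (fun q => q.[v]) p0.
rewrite /p hornerD hornerN hornerZ hornerM hornerX hmx_trace res_num_base //.
rewrite res_den_base // trace_YY horner0 mulr1 => /eqP; rewrite subr_eq0 => /eqP h.
have v0 := dom_neq0 H Dv.
by apply: (mulfI v0); rewrite h; field.
Qed.

Lemma ff_D v : D v -> ff r v = (c / v) ^+ 2.
Proof.
move=> Dv; have v0 := dom_neq0 H Dv.
have h1 := tr_hasder hN he H c0 cl sl Dv.
have h2 : hasder (fun w => \tr (r w) : C) v (- (N%:R * (c / v ^+ 2))).
  have := hasderZ (hasder_cst (N%:R * c : C) v) (hasderVs v0 (hasder_id v)).
  move=> h; apply: (hasder_near (f := fun w => (N%:R * c) *: w^-1)).
    by apply: filterS (dom_open H Dv) => w Dw; rewrite tr_D // /GRing.scale /= mulrA.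
  apply: hasder_ext h => //; rewrite /GRing.scale /= mul0r add0r; ring.
have nN : N%:R != 0 :> C by rewrite pnatr_eq0 -lt0n.
have /oppr_inj h := hasder_unique h1 h2.
have : ff r v = c * (N%:R^-1 * (N%:R * ff r v / c)) by field; rewrite nN c0.
by rewrite h => ->; field; rewrite v0 nN.
Qed.

Lemma alpha_D v : D v -> alpha v = beta + (c / v)%:M.
Proof.
move=> Dv.
pose W w : A := alpha w - (c / w)%:M - beta.
have [v1 [Dv1 W1]] : exists v1, D v1 /\ W v1 = 0.
  have /filter_ex[v1 [Dv1 h1]] := near0_and (near_dom he H) (near_alpha hN he H c0 cl sl fs).
  by exists v1; split=> //; rewrite /W h1 addrK subrr.
have dW z : D z -> hasder W z ((0 : A) *m W z).
  move=> Dz; have z0 := dom_neq0 H Dz.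
  have := hasderB (hasderB (alpha_hasder hN he H c0 cl sl Dz) (cv_hasder N c z0)) (hasder_cst beta z).
  apply: hasder_ext => //; rewrite mul0mx subr0 ff_D //.
  have -> : - (c / z) ^+ 2 / c = - (c / z ^+ 2) by field; rewrite z0 c0.
  by rewrite subrr.
have cM z : D z -> tends (nbhs z) (fun=> 0 : A) 0 by move=> _; exact: tends_cst.
have := @linear_ode_global _ e D _ _ W (fun=> 0) v1 v (dom_disc H)
  (dom_open H) (dom_dense H) dW cM Dv1 W1 Dv.
by rewrite /W => /eqP; rewrite subr_eq0 subr_eq => /eqP.
Qed.

Lemma FF_comm w v : D v -> (F w *t F w) *m r v = r v *m (F w *t F w).
Proof.
move=> Dv.
pose k : A := - kap *: kk.
pose k2 : AA := tl1 k + tr1 k.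
have k2r : k2 *m r v = r v *m k2.
  have := kk_sym he H cl sl Dv; rewrite /lie => /eqP; rewrite subr_eq0 => /eqP h.
  have -> : k2 = - kap *: (kk *t 1%:M + 1%:M *t kk).
    by rewrite /k2 /k /tl1 /tr1 tensZl tensZr scalerDr.
  by rewrite -scalemxAl h scalemxAr.
have dFF z : hasder (fun w => F w *t F w) z (k2 *m (F z *t F z)).
  have h1 : hasder (fun w => tl1 (F w)) z (tl1 (k *m F z)) := hasder_lin tl1 (dF z).
  have h2 : hasder (fun w => tr1 (F w)) z (tr1 (k *m F z)) := hasder_lin tr1 (dF z).
  have := hasderM h1 h2; apply: hasder_ext => [u|]; first by rewrite -tens_tl1.
  by rewrite /k2 mulmxDl !tens_tl1 tl1M tr1M !mulmxA (tl1_tr1C (F z) k).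
apply/eqP; rewrite -subr_eq0; apply/eqP.
apply: (@entire_unique _ _ _ k2 (fun w => (F w *t F w) *m r v - r v *m (F w *t F w))) => [z|].
  have := hasderB (hasderM (dFF z) (hasder_cst (r v) z)) (hasderM (hasder_cst (r v) z) (dFF z)).
  apply: hasder_ext => //.
  by rewrite mulmx0 addr0 mul0mx add0r mulmxBr !mulmxA k2r.
by rewrite F0 tens11 mul1mx mulmx1 subrr.
Qed.

Lemma F_beta v : beta *m F v = F v *m beta.
Proof.
apply: FC; rewrite -scalemxAr -scalemxAl; congr (_ *: _).
exact/esym/(kk_beta hN he H c0 cl sl fs).
Qed.

Lemma normal_form_of_pole :
  AYBE_normal_form D r c (N%:R^-1 *: beta) F.
Proof.
have nN : N%:R != 0 :> C by rewrite pnatr_eq0 -lt0n.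
split.
- exact: c0.
- exact: F0.
- exact: FD.
- by move=> v; eexists; exact: dF.
- exact: FF_comm.
- by move=> v; rewrite -scalemxAl -scalemxAr F_beta.
- by rewrite mxtraceZ (beta_tr fs) mulr0.
- by move=> v Dv; rewrite (sqr_ff hN he H cl sl Dv) ff_D.
- by move=> v Dv; rewrite scalerA mulfV // scale1r; exact: alpha_D.
- move=> v Dv; have := beta_comm he H Dv alpha_D.
  rewrite tensZl tensZr -scalerDr /lie -scalemxAl -scalemxAr -scalerBr => ->.
  by rewrite scaler0.
- have /filter_ex[p Dp] := near_dom he H.
  exists (res_den p), (\matrix_(u, w) res_num p
    (mxtens_index ((mxtens_unindex u).1, (mxtens_unindex w).2))
    (mxtens_index ((mxtens_unindex w).1, (mxtens_unindex u).2))).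
  split; first by apply/eqP => h; have := res_den_base p; rewrite h horner0 => /eqP; rewrite eq_sym oner_eq0.
  move=> v Dv; rewrite -[LHS](@ptK C N).
  have -> : pt ((res_den p).[v] *: (1%:M *t F v *m r v *m (1%:M *t F (- v)))) = hmx (res_num p) v.
    by rewrite -(res_eq Dp Dv); exact: linearZ.
  by apply/matrixP => u w; rewrite !mxE /tcoef !mxE.
- have := JJ_tends c0 cl sl => /(tendsZ FF (tends_cst FF c)).
  apply: tends_ext => // h; rewrite /JJ scalerA mulrC divfK //.
Qed.

End Gauge.

Lemma normal_form_exists (R : realType) (N : nat) (e : R) (D : set (Cplx R))
    (r : Cplx R -> 'M[Cplx R]_(N * N)) : (0 < N)%N -> 0 < e -> AYBE_domain e D r ->
  exists c b F, AYBE_normal_form D r c b F.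
Proof.
move=> hN he H; have [c [s [c0 cl sl fs]]] := simple_pole hN he H.
have [F [F0 dF FD FC]] := mexp_exists (- kap N c *: kk s).
exists c, (N%:R^-1 *: beta s), F.
exact: (normal_form_of_pole hN he H c0 cl sl fs F0 dF FD FC).
Qed.
(** * Holomorphic points and extension by continuity *)

Section HoloTools.
Variable R : realType.
Local Notation C := (Cplx R).
Implicit Types (z v w h : C).

Lemma near_affine (a v : C) (P : C -> Prop) : a != 0 ->
  (\forall w \near v^', P w) -> \forall h \near (0 : C)^', P (v + a * h).
Proof.
move=> a0 hP; have {hP} : nbhs v (fun w => w != v -> P w) := hP.
move=> /nbhs_ballP[r /= r0 rP].
suff : nbhs (0 : C) (fun h => h != 0 -> P (v + a * h)) by [].
apply/nbhs_ballP; exists (r / `|a|) => /=; first by rewrite divr_gt0 // normr_gt0.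
move=> t; rewrite -?ball_normE /ball_ /= sub0r normrN => ta t0.
apply: rP; last first.
  by rewrite -subr_eq0 addrAC subrr add0r mulf_neq0.
rewrite -?ball_normE /ball_ /= opprD addrA subrr sub0r normrN normrM mulrC.
by rewrite -ltr_pdivlMr // normr_gt0.
Qed.

Lemma near_affine_full (a v : C) (P : C -> Prop) : a != 0 ->
  (\forall w \near v, P w) -> \forall h \near (0 : C)^', P (v + a * h).
Proof. by move=> a0 h; apply: near_affine => //; exact: nbhs_dnbhs. Qed.

Lemma tends_affine (V : normedModType C) (f : C -> V) (a v : C) : a != 0 ->
  tends (nbhs v) f (f v) -> tends (0 : C)^' (fun h => f (v + a * h)) (f v).
Proof.
have FF := @dnbhs_filter _ (0 : C).
move=> a0 /(tends_dist (@nbhs_filter _ v)) fv; apply/(tends_dist FF) => eps e0.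
exact: near_affine_full a0 (fv _ e0).
Qed.

Lemma dnbhs_join z (P : C -> Prop) :
  (\forall w \near z^', P w) -> \forall w \near z^', \forall u \near w, P u.
Proof.
move=> hP; have {hP} : nbhs z (fun w => w != z -> P w) := hP.
move=> /near_join hP; suff : nbhs z (fun w => w != z -> \forall u \near w, P u) by [].
apply: filterS hP => w h wz.
by apply: filterS2 h (near_neq wz) => u; apply.
Qed.

Lemma near_opp z (P : C -> Prop) : (\forall w \near - z, P w) -> \forall w \near z, P (- w).
Proof.
move=> /nbhs_ballP[d /= d0 dP]; apply/nbhs_ballP; exists d => // w.
rewrite -?ball_normE /ball_ /= => h; apply: dP.
rewrite -?ball_normE /ball_ /=.
have -> : - z - - w = - (z - w) by rewrite opprB opprK addrC.
by rewrite normrN.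
Qed.

Lemma dnbhs_opp z (P : C -> Prop) : (\forall w \near (- z)^', P w) -> \forall w \near z^', P (- w).
Proof.
move=> hP; have {hP} : nbhs (- z) (fun w => w != - z -> P w) := hP.
move=> /near_opp hP; suff : nbhs z (fun w => w != z -> P (- w)) by [].
apply: filterS hP => w h wz; apply: h.
by rewrite eqr_opp.
Qed.

Lemma holo_cvg (V : normedModType C) (f : C -> V) z :
  holomorphic_at f z -> tends (nbhs z) f (f z).
Proof. by move=> /nbhs_singleton/hasder_derivable[d hd]; exact: hasder_cvg hd. Qed.

Lemma discN (e : R) v : disc e v -> disc e (- v).
Proof. by rewrite /disc -ball_normE /ball_ /= !sub0r !normrN. Qed.

Lemma disc_near (e : R) v : disc e v -> \forall w \near v, disc e w.
Proof. by move=> dz; apply: (@open_nbhs_nbhs _ v (disc e)); split=> //; exact: ball_open. Qed.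

Lemma mero_near_holo (V : normedModType C) (f : C -> V) z :
  meromorphic_at f z -> \forall w \near z^', holomorphic_at f w.
Proof.
move=> [k [g [hg fg]]].
have dg : \forall w \near z^', derivable g w 1 := nbhs_dnbhs hg.
have n0 : \forall w \near z^', w != z := nbhs_dnbhs_neq z.
have h : \forall w \near z^', \forall u \near w, f u = ((u - z) ^+ k)^-1 *: g u.
  apply: dnbhs_join; apply: filterS2 fg n0 => w <- wz.
  by rewrite scalerA mulVf ?scale1r // expf_neq0 // subr_eq0.
apply: dnbhs_join; apply: filterS3 h dg n0 => w h /hasder_derivable[d hd] wz.
apply/hasder_derivable.
have cd : exists d', hasder (fun u : C => ((u - z) ^+ k)^-1 : C) w d'.
  have pd : exists d', hasder (fun u : C => (u - z) ^+ k : C) w d'.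
    elim: k {fg h} => [|k [d' IH]].
      by exists 0; apply: hasder_ext (hasder_cst (1 : C) w) => // u; rewrite expr0.
    have := hasderZ (hasderB (hasder_id w) (hasder_cst (z : C) w)) IH.
    by move=> h1; eexists; apply: hasder_ext h1 => [u|//]; rewrite exprS.
  have [d' hd'] := pd; exists (- d' / ((w - z) ^+ k) ^+ 2).
  by apply: hasderVs => //; rewrite expf_neq0 // subr_eq0.
have [d' hd'] := cd; eexists; apply: hasder_near (hasderZ hd' hd).
by apply: filterS h => u ->.
Qed.

End HoloTools.

Section Domain.
Variables (R : realType) (N : nat).
Local Notation C := (Cplx R).
Local Notation AA := 'M[C]_(N * N).
Local Notation AAA := 'M[C]_(N * N * N).

Definition sym_dom (e : R) (r : C -> AA) : set C :=
  [set v | [/\ v != 0, holo_pts (disc e) r v & holo_pts (disc e) r (- v)]].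

Lemma sym_dom_domain (e : R) (r : C -> AA) : (0 < N)%N -> 0 < e ->
  nondegenerate_unitary_AYBE_solution (disc e) r -> AYBE_domain e (sym_dom e r) r.
Proof.
move=> hN he [mer ayb fl nd].
split.
- by move=> v [_ []].
- by move=> v [].
- move=> v [v0 h1 h2].
  by split; [rewrite oppr_eq0; exact: v0|exact: h2|rewrite opprK; exact: h1].
- move=> v [v0 [dv hv] [dv' hv']].
  apply: filterS3 (near_neq v0) (near_and (disc_near dv) (near_join hv))
    (near_opp (near_and (disc_near dv') (near_join hv'))) => w w0 [dw hw] [dw' hw'].
  split; [exact: w0|exact: (conj dw hw)|exact: (conj dw' hw')].
- move=> z dz.
  have n0 : \forall w \near z^', w != 0.
    have [->|z0] := eqVneq z 0; first exact: nbhs_dnbhs_neq.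
    by apply: nbhs_dnbhs; exact: near_neq.
  have nh u : disc e u -> \forall w \near u^', holo_pts (disc e) r w.
    move=> du; have h1 : \forall w \near u^', disc e w := nbhs_dnbhs (disc_near du).
    by apply: filterS2 h1 (mero_near_holo (mer _ du)).
  apply: filterS3 n0 (nh _ dz) (dnbhs_opp (nh _ (discN dz))) => w w0 h1 h2.
  split; [exact: w0|exact: h1|exact: h2].
- by move=> v [_ [_ hv] _]; exact/hasder_derivable/(nbhs_singleton hv).
- by move=> v v' [_ hv _] [_ hv' _] [_ hw _]; exact: ayb.
- by move=> v [_ hv hv']; exact: fl.
- move=> z dz; apply: filterS (nd _ dz) => v; exact: nondegenerate_rl.
Qed.

Section Limits.
Variables (x y z : C -> AA) (x0 y0 z0 : AA).
Let FF : ProperFilter (0 : C)^' := Proper_dnbhs_numFieldType (0 : C).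
Hypotheses (hx : tends (0 : C)^' x x0) (hy : tends (0 : C)^' y y0) (hz : tends (0 : C)^' z z0).
Let hx12 : tends (0 : C)^' (fun h => t12 (x h) : AAA) (t12 x0) := tends_lin FF (@t12 _ N) hx.
Let hy13 : tends (0 : C)^' (fun h => t13 (y h) : AAA) (t13 y0) := tends_lin FF (@t13 _ N) hy.
Let hz23 : tends (0 : C)^' (fun h => t23 (z h) : AAA) (t23 z0) := tends_lin FF (@t23 _ N) hz.

Lemma lim_CYB : (\forall h \near (0 : C)^', CYB (x h) (y h) (z h)) -> CYB x0 y0 z0.
Proof.
move=> nh.
have tl n (p q : C -> 'M[C]_n) p0 q0 : tends (0 : C)^' p p0 -> tends (0 : C)^' q q0 ->
    tends (0 : C)^' (fun h => lie (p h) (q h)) (lie p0 q0).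
  by move=> hp hq; apply: (tendsB FF); apply: (tends_mulmx FF).
have := tendsD FF (tendsB FF (tl _ _ _ _ _ hx12 hy13) (tl _ _ _ _ _ hz23 hx12)) (tl _ _ _ _ _ hy13 hz23).
move=> h; apply: (tends_unique FF h); apply: (tends_near FF _ (tends_cst FF (0 : AAA))).
by apply: filterS nh => u ->.
Qed.

Lemma lim_QYB : (\forall h \near (0 : C)^',
    t12 (x h) *m t13 (y h) *m t23 (z h) = t23 (z h) *m t13 (y h) *m t12 (x h)) ->
  t12 x0 *m t13 y0 *m t23 z0 = t23 z0 *m t13 y0 *m t12 x0.
Proof.
move=> nh.
have h1 := tends_mulmx FF (tends_mulmx FF hx12 hy13) hz23.
have h2 := tends_mulmx FF (tends_mulmx FF hz23 hy13) hx12.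
apply: (tends_unique FF h1); apply: (tends_near FF _ h2).
by apply: filterS nh => u ->.
Qed.
End Limits.

Section Dense.
Variables (e : R) (r : C -> AA).
Hypotheses (H : AYBE_domain e (sym_dom e r) r).
Local Notation D := (sym_dom e r).

(** Points of the disc are limits of points of D, also along v, v', v + v'
  simultaneously. *)
Lemma dense1 v : disc e v -> \forall h \near (0 : C)^', D (v + 1 * h).
Proof. by move=> dv; apply: near_affine (oner_neq0 _) (dom_dense H dv). Qed.

Lemma two_neq0 : (2 : C) != 0. Proof. by rewrite pnatr_eq0. Qed.

Lemma dense3 v v' : disc e v -> disc e v' -> disc e (v + v') ->
  \forall h \near (0 : C)^', [/\ D (v + 1 * h), D (v' + 1 * h), D (v + v' + 2 * h)
    & (v + 1 * h) + (v' + 1 * h) = v + v' + 2 * h].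
Proof.
move=> dv dv' dw.
apply: filterS3 (dense1 dv) (dense1 dv') (near_affine two_neq0 (dom_dense H dw)).
by move=> h h1 h2 h3; split=> //; ring.
Qed.

Lemma lim_D (V : normedModType C) (f : C -> V) (a : V) v : disc e v ->
  tends (nbhs v) f (f v) -> (forall w, D w -> f w = a) -> f v = a.
Proof.
have FF := Proper_dnbhs_numFieldType (0 : C).
move=> dv fv fa; apply: (tends_unique FF (tends_affine (oner_neq0 C) fv)).
apply: (tends_near FF _ (tends_cst FF a)).
by apply: filterS (dense1 dv) => h /fa.
Qed.
End Dense.

End Domain.

(** * Traceless tensors *)

Section Traceless.
Variables (F : fieldType) (N : nat).
Local Notation A := 'M[F]_N.
Local Notation AA := 'M[F]_(N * N).
Local Notation AAA := 'M[F]_(N * N * N).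
Implicit Types (t x y z : AA) (a b : A).

Section Projection.
Hypothesis N0 : N%:R != 0 :> F.

Definition sl_part a : A := a - (\tr a / N%:R)%:M.

Lemma sl_partP a : sl_part a \in sl.
Proof. by rewrite mem_sl /sl_part linearB /= mxtrace_scalar -[_ *+ N]mulr_natr divfK // subrr. Qed.

(** The projection of A (x) A onto the tensors with vanishing partial traces,
  which is sl_part (x) sl_part. *)
Definition sl_proj t : AA :=
  t - ptr2 t *t (N%:R^-1)%:M - (N%:R^-1)%:M *t ptr1 t + (\tr t / (N%:R * N%:R))%:M.

Lemma sl_proj_tens a b : sl_proj (a *t b) = sl_part a *t sl_part b.
Proof.
rewrite /sl_proj /sl_part ptr2_tens ptr1_tens trace_tens tensDl !tensDr !tensNl !tensNr.
have S (k : F) (x : A) : x *t k%:M = k *: (x *t 1%:M) :> AA by rewrite -tensZr scalemx1.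
have S' (k : F) (x : A) : k%:M *t x = k *: (1%:M *t x) :> AA by rewrite -tensZl scalemx1.
rewrite !(S N%:R^-1) !(S' N%:R^-1) !(S (\tr b / _)) !(S' (\tr a / _)) !tensZl !tensZr !scalerA.
rewrite -[(_ / (N%:R * N%:R))%:M]scalemx1 -tens11 opprK.
have -> : \tr a * \tr b / (N%:R * N%:R) = \tr a / N%:R * (\tr b / N%:R) by field.
have -> : N%:R^-1 * \tr b = \tr b / N%:R by rewrite mulrC.
have -> : N%:R^-1 * \tr a = \tr a / N%:R by rewrite mulrC.
by rewrite [\tr b / _ * _]mulrC !addrA.
Qed.

Lemma in_tensD (V : {vspace A}) s t : in_tens V s -> in_tens V t -> in_tens V (s + t).
Proof.
move=> [p [hp ->]] [q [hq ->]]; exists (p ++ q); split; last by rewrite big_cat.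
by move=> x; rewrite mem_cat => /orP[/hp|/hq].
Qed.

Lemma sl_proj_in t : in_tens sl (sl_proj t).
Proof.
elim/tens_ind: t => [a b|s t hs ht].
  rewrite sl_proj_tens; exists [:: (sl_part a, sl_part b)]; split; last by rewrite big_seq1.
  by move=> p; rewrite inE => /eqP ->; split; exact: sl_partP.
have -> : sl_proj (s + t) = sl_proj s + sl_proj t.
  rewrite /sl_proj !linearD /= tensDl tensDr mulrDl raddfD /=.
  move: (ptr2 s *t _) (ptr2 t *t _) (_ *t ptr1 s) (_ *t ptr1 t) => p q p' q'.
  by apply/matrixP => i j; rewrite !mxE; ring.
exact: in_tensD.
Qed.

Lemma in_tens_sl t : ptr1 t = 0 -> ptr2 t = 0 -> in_tens sl t.
Proof.
move=> t1 t2; have := sl_proj_in t; rewrite /sl_proj t1 t2 -trace_ptr1 t1 mxtrace0.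
by rewrite tens0mx tensmx0 !subr0 mul0r -scalemx1 scale0r addr0.
Qed.

Lemma linform_trace (f : 'Hom(A, F^o)) : exists X, forall a, f a = \tr (X *m a).
Proof.
exists (\matrix_(i, j) f (delta_mx j i)) => a.
have -> : f a = \sum_i \sum_j a i j * f (delta_mx i j).
  rewrite {1}[a]matrix_sum_delta linear_sum; apply: eq_bigr => i _.
  by rewrite linear_sum; apply: eq_bigr => j _; rewrite linearZ.
rewrite exchange_big; apply: eq_bigr => i _; rewrite mxE; apply: eq_bigr => j _.
by rewrite mxE mulrC.
Qed.

(** For t in sl (x) sl the contraction with X depends on sl_part X only, and there
  the term k 1 (x) 1 contributes nothing. *)
Lemma nondegenerate_sl t (k : F) : ptr1 t = 0 -> ptr2 t = 0 ->
  rl (t + k%:M) \in unitmx -> Defs.nondegenerate sl t.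
Proof.
move=> t1 t2 /rl_unitP inj; split; first exact: in_tens_sl.
move=> f; have [X fX] := linform_trace f; rewrite (contract_comb _ fX) => tX a.
rewrite mem_sl fX => /eqP a0.
have k1 : comb (k%:M : AA) (sl_part X) = 0.
  rewrite -scalemx1 combZl -tens11 comb_tens mulmx1.
  have /eqP -> : \tr (sl_part X) == 0 by rewrite -mem_sl sl_partP.
  by rewrite scale0r scaler0.
have c1 : comb t 1%:M = 0 by rewrite /comb tens11 mul1mx.
have : sl_part X = 0.
  apply: inj; rewrite combDl k1 addr0 /sl_part linearB /= tX sub0r.
  by rewrite -scalemx1 linearZ /= c1 scaler0 oppr0.
rewrite /sl_part => /eqP; rewrite subr_eq0 => /eqP ->.
by rewrite mul_scalar_mx mxtraceZ a0 mulr0.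
Qed.

End Projection.

Lemma rl_swap (c : F) : c != 0 -> rl (c *: swap : AA) \in unitmx.
Proof.
move=> c0; apply/rl_unitP => X; rewrite combZl => /eqP; rewrite scaler_eq0 (negbTE c0) /=.
move=> /eqP <-; apply/matrixP => i j; rewrite /comb !mxE.
rewrite (bigD1 i) //= big1 ?addr0 => [|k ne].
  by rewrite tcoef_mul_swap tcoef_tens mxE eqxx mulr1.
by rewrite tcoef_mul_swap tcoef_tens !mxE eq_sym (negbTE ne) mulr0.
Qed.

Lemma CYB_conj x y z x' y' z' (g h : AAA) : h *m g = 1%:M ->
  t12 x' = g *m t12 x *m h -> t13 y' = g *m t13 y *m h -> t23 z' = g *m t23 z *m h ->
  g *m h = 1%:M -> CYB x' y' z' -> CYB x y z.
Proof.
move=> hg ex ey ez gh; rewrite /CYB ex ey ez.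
have L (p q : AAA) : lie (g *m p *m h) (g *m q *m h) = g *m lie p q *m h.
  have E (p' q' : AAA) : g *m p' *m h *m (g *m q' *m h) = g *m (p' *m q') *m h.
    by rewrite !mulmxA -(mulmxA (g *m p')) hg mulmx1.
  by rewrite /lie !E mulmxBr mulmxBl.
rewrite !L -mulmxBl -mulmxBr -mulmxDl -mulmxDr => /(congr1 (fun M => h *m M *m g)).
by rewrite mulmx0 mul0mx !mulmxA hg mul1mx -mulmxA hg mulmx1.
Qed.

Lemma lieDl n (p q s : 'M[F]_n) : lie (p + q) s = lie p s + lie q s.
Proof. by rewrite /lie mulmxDl mulmxDr opprD addrACA. Qed.
Lemma lieC n (p q : 'M[F]_n) : lie p q = - lie q p.
Proof. by rewrite /lie opprB. Qed.
Lemma lieDr n (p q s : 'M[F]_n) : lie s (p + q) = lie s p + lie s q.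
Proof. by rewrite lieC lieDl opprD -!(lieC s). Qed.
Lemma lieNl n (p q : 'M[F]_n) : lie (- p) q = - lie p q.
Proof. by rewrite /lie mulNmx mulmxN opprB opprK addrC. Qed.
Lemma lieNr n (p q : 'M[F]_n) : lie p (- q) = - lie p q.
Proof. by rewrite lieC lieNl -lieC. Qed.
Lemma lie_scalarl n (k : F) (q : 'M[F]_n) : lie k%:M q = 0.
Proof. by rewrite /lie mul_scalar_mx mul_mx_scalar subrr. Qed.
Lemma lie_scalarr n (k : F) (q : 'M[F]_n) : lie q k%:M = 0.
Proof. by rewrite lieC lie_scalarl oppr0. Qed.

Lemma lie_self n (p : 'M[F]_n) : lie p p = 0.
Proof. by rewrite /lie subrr. Qed.

Lemma CYB_shift_alg n (X Y Z B1 B2 B3 : 'M[F]_n) (k l m : F) :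
  lie (B1 + B2) X = 0 -> lie B3 X = 0 -> lie (B1 + B3) Y = 0 -> lie B2 Y = 0 ->
  lie (B2 + B3) Z = 0 -> lie B1 Z = 0 -> lie B1 B2 = 0 -> lie B1 B3 = 0 -> lie B2 B3 = 0 ->
  let X' := X - (B1 - B2) - k%:M in let Y' := Y - (B1 - B3) - l%:M in
  let Z' := Z - (B2 - B3) - m%:M in
  lie X' Y' - lie Z' X' + lie Y' Z' = lie X Y - lie Z X + lie Y Z.
Proof.
rewrite !lieDl => bx1 bx3 by1 by2 bz2 bz1 b12 b13 b23 /=.
rewrite !(lieDl, lieDr, lieNl, lieNr, lie_scalarl, lie_scalarr).
rewrite (lieC X B1) (lieC X B3) (lieC Y B2) (lieC Y B3) (lieC Z B1) (lieC Z B2).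
rewrite ?(lieC B2 B1) ?(lieC B3 B1) ?(lieC B3 B2).
rewrite bx3 by2 bz1 b12 b13 b23 !lie_self.
move: bx1 by1 bz2 => /eqP; rewrite addr_eq0 => /eqP -> /eqP; rewrite addr_eq0 => /eqP ->.
move=> /eqP; rewrite addr_eq0 => /eqP ->.
move: (lie B2 X) (lie B3 Y) (lie B3 Z) (lie X Y) (lie Z X) (lie Y Z) => ? ? ? ? ? ?.
by apply/matrixP => i j; rewrite !mxE; ring.
Qed.

Lemma comm13_2 t b : lie (1%:M *t b *t 1%:M) (t13 t) = 0.
Proof.
elim/tens_ind: t => [a c|s t hs ht]; last by rewrite linearD lieDr hs ht addr0.
by rewrite t13_tens /lie !tens3M !mulmx1 !mul1mx subrr.
Qed.

Lemma comm12_3 t b : lie (1%:M *t 1%:M *t b) (t12 t) = 0.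
Proof.
elim/tens_ind: t => [a c|s t hs ht]; last by rewrite linearD lieDr hs ht addr0.
by rewrite t12_tens /lie !tens3M !mulmx1 !mul1mx subrr.
Qed.

Lemma comm23_1 t b : lie (b *t 1%:M *t 1%:M) (t23 t) = 0.
Proof. by rewrite /lie tens11_t23 subrr. Qed.

(** A symmetry b allows the shift of a solution by b (x) 1 - 1 (x) b, since the
  commutators that appear involve b (x) 1 + 1 (x) b only. *)
Lemma CYB_shift x y z b (k l m : F) :
  let S := b *t 1%:M + 1%:M *t b : AA in
  let B := b *t 1%:M - 1%:M *t b : AA in
  lie S x = 0 -> lie S y = 0 -> lie S z = 0 -> CYB x y z ->
  CYB (x - B - k%:M) (y - B - l%:M) (z - B - m%:M).
Proof.
move=> S B sx sy sz; rewrite /CYB.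
set B1 : AAA := b *t 1%:M *t 1%:M; set B2 : AAA := 1%:M *t b *t 1%:M.
set B3 : AAA := 1%:M *t 1%:M *t b.
have L (u : F) : u%:M = u *: 1%:M :> AA by rewrite scalemx1.
have -> : t12 (x - B - k%:M) = t12 x - (B1 - B2) - k%:M.
  by rewrite !linearB /= !t12_tens L linearZ /= t12_1 scalemx1.
have -> : t13 (y - B - l%:M) = t13 y - (B1 - B3) - l%:M.
  by rewrite !linearB /= !t13_tens L linearZ /= t13_1 scalemx1.
have -> : t23 (z - B - m%:M) = t23 z - (B2 - B3) - m%:M.
  by rewrite !linearB /= !t23_tens L linearZ /= t23_1 scalemx1.
have bb (p q p' q' p'' q'' : A) : p *m q = q *m p -> p' *m q' = q' *m p' ->
    p'' *m q'' = q'' *m p'' -> lie (p *t p' *t p'' : AAA) (q *t q' *t q'') = 0.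
  by move=> h h' h''; rewrite /lie !tens3M h h' h'' subrr.
rewrite CYB_shift_alg //; try (by apply: bb; rewrite ?mulmx1 ?mul1mx).
- have -> : B1 + B2 = t12 S by rewrite linearD /= !t12_tens.
  have -> : lie (t12 S) (t12 x) = t12 (lie S x) by rewrite /lie linearB /= !t12M.
  by rewrite sx linear0.
- exact: comm12_3.
- have -> : B1 + B3 = t13 S by rewrite linearD /= !t13_tens.
  have -> : lie (t13 S) (t13 y) = t13 (lie S y) by rewrite /lie linearB /= !t13M.
  by rewrite sy linear0.
- exact: comm13_2.
- have -> : B2 + B3 = t23 S by rewrite linearD /= !t23_tens.
  have -> : lie (t23 S) (t23 z) = t23 (lie S z) by rewrite /lie linearB /= !t23M.
  by rewrite sz linear0.
- exact: comm23_1.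
Qed.

End Traceless.

(** * Meromorphic functions and quotients by polynomials *)

Section MeroTools.
Variable R : realType.
Local Notation C := (Cplx R).
Implicit Types (z v w h : C).

Lemma holo_at_der (V : normedModType C) (f : C -> V) z :
  (\forall w \near z, exists d, hasder f w d) -> holomorphic_at f z.
Proof. by apply: filterS => w /hasder_derivable. Qed.

Lemma holo_der_near (V : normedModType C) (f : C -> V) z :
  holomorphic_at f z -> \forall w \near z, exists d, hasder f w d.
Proof. by apply: filterS => w /hasder_derivable. Qed.

Lemma poly_hasder (p : {poly C}) z : exists d, hasder (fun v => p.[v] : C) z d.
Proof.
elim/poly_ind: p => [|p a [d hd]].
  by exists 0; apply: hasder_ext (hasder_cst (0 : C) z) => // w; rewrite horner0.
have := hasderD (hasderZ hd (hasder_id z)) (hasder_cst (a : C) z).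
by move=> h; eexists; apply: hasder_ext h => // w; rewrite hornerMXaddC.
Qed.

Lemma hasder_mx n m (f : C -> 'M[C]_(n, m)) z :
  (forall i j, exists d, hasder (fun v => f v i j) z d) -> exists d, hasder f z d.
Proof.
have FF := @dnbhs_filter _ (0 : C).
move=> h.
pose d i j := xget 0 [set d | hasder (fun v => f v i j) z d].
have hd i j : hasder (fun v => f v i j) z (d i j).
  by have [d' hd'] := h i j; exact: (@xgetI _ 0 [set d | hasder (fun v => f v i j) z d] d' hd').
exists (\matrix_(i, j) d i j); apply/(tends_mx FF) => i j.
by apply: (tends_ext FF _ _ (hd i j)) => [t|]; rewrite !mxE.
Qed.

Lemma hmx_hasder n m (P : 'M[{poly C}]_(n, m)) z : exists d, hasder (hmx P) z d.
Proof.
apply: hasder_mx => i j; have [d hd] := poly_hasder (P i j) z.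
by exists d; apply: hasder_ext hd => // w; rewrite hmxE.
Qed.

Lemma mero_quot (V : normedModType C) (g : C -> V) (q : {poly C}) z : q != 0 ->
  (forall w, exists d, hasder g w d) -> meromorphic_at (fun v => (q.[v])^-1 *: g v) z.
Proof.
move=> q0 hg; have [k [q1]] := multiplicity_XsubC q z; rewrite q0 /= => q1z qE.
exists k, (fun v => (q1.[v])^-1 *: g v); split; last first.
  have h : \forall v \near z^', v != z := nbhs_dnbhs_neq z.
  apply: filterS h => v vz; rewrite scalerA; congr (_ *: _).
  by rewrite qE hornerM horner_exp hornerXsubC invfM mulrCA divff ?mulr1 // expf_neq0 // subr_eq0.
apply: holo_at_der.
have [d1 hd1] := poly_hasder q1 z.
have q1n : \forall w \near z, q1.[w] != 0 := tends_neq0 (@nbhs_filter _ z) q1z (hasder_cvg hd1).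
apply: filterS q1n => w q1w; have [d2 hd2] := poly_hasder q1 w; have [d3 hd3] := hg w.
by eexists; exact: hasderZ (hasderVs q1w hd2) hd3.
Qed.

Lemma mero_sub (V : normedModType C) (f g : C -> V) z :
  meromorphic_at f z -> meromorphic_at g z -> meromorphic_at (fun v => f v - g v) z.
Proof.
move=> [k [f1 [hf ff1]]] [l [g1 [hg gg1]]].
exists (k + l)%N, (fun v => (v - z) ^+ l *: f1 v - (v - z) ^+ k *: g1 v); split; last first.
  apply: filterS2 ff1 gg1 => v <- <-; rewrite !scalerA scalerBr -!exprD.
  by rewrite [(l + k)%N]addnC.
have X m w : exists d, hasder (fun v => (v - z) ^+ m : C) w d.
  have [d hd] := poly_hasder (('X - z%:P) ^+ m) w; exists d.
  by apply: hasder_ext hd => // v; rewrite horner_exp hornerXsubC.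
apply: holo_at_der; apply: filterS2 (holo_der_near hf) (holo_der_near hg) => w [d1 hd1] [d2 hd2].
have [d3 hd3] := X l w; have [d4 hd4] := X k w.
by eexists; exact: hasderB (hasderZ hd3 hd1) (hasderZ hd4 hd2).
Qed.

Lemma mero_near_eq (V : normedModType C) (f g : C -> V) z :
  (\forall w \near z^', f w = g w) -> meromorphic_at f z -> meromorphic_at g z.
Proof.
move=> fg [k [h [hh fh]]]; exists k, h; split=> //.
by apply: filterS2 fg fh => w <-.
Qed.

Lemma lim_eq (V : normedModType C) (f g : C -> V) v :
  tends (nbhs v) f (f v) -> tends (nbhs v) g (g v) ->
  (\forall w \near v^', f w = g w) -> f v = g v.
Proof.
have FF := Proper_dnbhs_numFieldType (0 : C).
move=> hf hg fg; have e1 := tends_affine (oner_neq0 C) hf.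
apply: (tends_unique FF e1); apply: (tends_near FF _ (tends_affine (oner_neq0 C) hg)).
by apply: filterS (near_affine (oner_neq0 C) fg) => h ->.
Qed.

End MeroTools.

(** * The CYBE and QYBE solutions attached to a normal form *)

Section FromNormalForm.
Variables (R : realType) (N : nat).
Local Notation C := (Cplx R).
Local Notation A := 'M[C]_N.
Local Notation AA := 'M[C]_(N * N).
Local Notation AAA := 'M[C]_(N * N * N).
Variables (e : R) (r : C -> AA).
Local Notation D := (sym_dom e r).
Hypotheses (hN : (1 < N)%N) (he : 0 < e)
  (hr : nondegenerate_unitary_AYBE_solution (disc e) r) (H : AYBE_domain e D r).
Variables (c : C) (b : A) (F : C -> A).
Hypothesis NF : AYBE_normal_form D r c b F.
Let FF : ProperFilter (0 : C)^' := Proper_dnbhs_numFieldType (0 : C).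

Lemma NC_neq0 : N%:R != 0 :> C.
Proof. by rewrite pnatr_eq0 -lt0n; exact: ltnW. Qed.

Lemma N_gt0 : (0 < N)%N. Proof. exact: ltnW. Qed.

(** At a point of holomorphy 0, v r(v) would tend to 0 instead of c P. *)
Lemma holo_neq0 v : holo_pts (disc e) r v -> v != 0.
Proof.
move=> [_ hv]; apply/eqP => v0; move: hv; rewrite v0 => /holo_cvg r0.
have r0' : tends (0 : C)^' r (r 0).
  by have := tends_affine (oner_neq0 C) r0; apply: tends_ext => // h; rewrite mul1r add0r.
have := tends_unique FF (nf_pole NF) (tendsZ FF (tends_id0 C) r0').
rewrite scale0r => /(congr1 (fun M => M *m swap)); rewrite -scalemxAl swapK mul0mx.
move=> /matrixP/(_ (mxtens_index (Ordinal N_gt0, Ordinal N_gt0)) (mxtens_index (Ordinal N_gt0, Ordinal N_gt0))).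
by rewrite !mxE eqxx mulr1 => /eqP; rewrite (negbTE (nf_c0 NF)).
Qed.

Lemma holo_sym v : holo_pts (disc e) r v -> holo_pts (disc e) r (- v) -> D v.
Proof. by move=> h h'; split; [exact: holo_neq0|exact: h|exact: h']. Qed.

Lemma r_CYB v v' : D v -> D v' -> D (v + v') -> CYB (r v) (r (v + v')) (r v').
Proof.
by move=> h h' h''; apply: AYB_CYB; [exact: (dom_AYB H)|exact: (r_AYB' H)].
Qed.

Lemma r_QYB v v' : D v -> D v' -> D (v + v') ->
  t12 (r v) *m t13 (r (v + v')) *m t23 (r v') = t23 (r v') *m t13 (r (v + v')) *m t12 (r v).
Proof.
move=> h h' h''.
exact: AYB_QYB (dom_AYB H h h' h'') (r_AYB' H h h' h'') (nf_sqr NF h').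
Qed.

(** D is dense, also along triples v, v', v + v' (dense3), so the identities hold
  wherever f is continuous. *)
Section Extension.
Variables (f : C -> AA) (v v' : C).
Hypotheses (hv : holo_pts (disc e) f v) (hv' : holo_pts (disc e) f v')
  (hw : holo_pts (disc e) f (v + v')).
Let fv : tends (0 : C)^' (fun h => f (v + 1 * h)) (f v) :=
  tends_affine (oner_neq0 C) (holo_cvg hv.2).
Let fv' : tends (0 : C)^' (fun h => f (v' + 1 * h)) (f v') :=
  tends_affine (oner_neq0 C) (holo_cvg hv'.2).
Let fw : tends (0 : C)^' (fun h => f (v + v' + 2 * h)) (f (v + v')) :=
  tends_affine (two_neq0 R) (holo_cvg hw.2).

Lemma ext_CYB : (forall v v', D v -> D v' -> D (v + v') -> CYB (f v) (f (v + v')) (f v')) ->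
  CYB (f v) (f (v + v')) (f v').
Proof.
move=> hf; apply: (lim_CYB fv fw fv').
by apply: filterS (dense3 H hv.1 hv'.1 hw.1) => h [h1 h2 h3 E]; rewrite -E; apply: hf; rewrite ?E.
Qed.

Lemma ext_QYB : (forall v v', D v -> D v' -> D (v + v') ->
    t12 (f v) *m t13 (f (v + v')) *m t23 (f v') = t23 (f v') *m t13 (f (v + v')) *m t12 (f v)) ->
  t12 (f v) *m t13 (f (v + v')) *m t23 (f v') = t23 (f v') *m t13 (f (v + v')) *m t12 (f v).
Proof.
move=> hf; apply: (lim_QYB fv fw fv').
by apply: filterS (dense3 H hv.1 hv'.1 hw.1) => h [h1 h2 h3 E]; rewrite -E; apply: hf; rewrite ?E.
Qed.
End Extension.

Lemma QYB_scale (x y z : AA) (k l m : C) :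
  t12 x *m t13 y *m t23 z = t23 z *m t13 y *m t12 x ->
  t12 (k *: x) *m t13 (l *: y) *m t23 (m *: z) = t23 (m *: z) *m t13 (l *: y) *m t12 (k *: x).
Proof.
have -> : t12 (k *: x) = k *: t12 x :> AAA by rewrite linearZ.
have -> : t13 (l *: y) = l *: t13 y :> AAA by rewrite linearZ.
have -> : t23 (m *: z) = m *: t23 z :> AAA by rewrite linearZ.
move=> h; rewrite -!(scalemxAl, scalemxAr) h !scalerA; congr (_ *: _); ring.
Qed.

Lemma quantumR_QYBE u : unitary_QYBE_solution
  (quantumR_dom (holo_pts (disc e) r) c u) (quantumR r c u).
Proof.
split=> [v v' [hv _] [hv' _] [hw _]|v [hv d1] [hv' d2]].
  rewrite /quantumR tens11; apply: QYB_scale; apply: QYB_affine.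
    exact: ext_CYB hv hv' hw r_CYB.
  exact: ext_QYB hv hv' hw r_QYB.
have Dv := holo_sym hv hv'; have v0 := dom_neq0 H Dv.
rewrite /quantumR tens11 flipZ flipD flipZ flip1 (dom_flip H Dv) -scalemxAl -scalemxAr scalerA.
rewrite mulmxDl !mulmxDr mul1mx mul1mx mulmx1 scalerN mulmxN -scalemxAl -scalemxAr.
rewrite (nf_sqr NF Dv) !scale_scalar_mx.
have -> : 1%:M - u *: r v + (u *: r v - (u * (u * (c / v) ^+ 2))%:M) =
    (1 - u * (u * (c / v) ^+ 2))%:M.
  by apply/matrixP => i j; rewrite !mxE mulrnBl; ring.
have -> : 1 - u * (u * (c / v) ^+ 2) = (1 + c * u / v) * (1 + c * u / (- v)) by field.
rewrite scale_scalar_mx; congr (_%:M).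
by rewrite -invfM mulVf // mulf_neq0.
Qed.

Lemma scaled_QYBE : unitary_QYBE_solution (holo_pts (disc e) r) (fun v => (v / c) *: r v).
Proof.
split=> [v v' hv hv' hw|v hv hv']; first by apply: QYB_scale; exact: ext_QYB hv hv' hw r_QYB.
have Dv := holo_sym hv hv'; have v0 := dom_neq0 H Dv; have c0 := nf_c0 NF.
rewrite flipZ (dom_flip H Dv) -scalemxAl -scalemxAr mulmxN (nf_sqr NF Dv) tens11.
rewrite !scalerN scalerA -scaleNr scale_scalar_mx; congr (_%:M); field.
by rewrite v0 c0.
Qed.

Lemma cinfty_filter : Filter (cinfty R).
Proof.
split; first by exists 0.
  move=> P Q [M hP] [M' hQ]; exists (Num.max M M') => u; rewrite -[_ < _]/(_ < _) => hu; split.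
    by apply: hP; apply: le_lt_trans hu; rewrite rc_le le_max lexx.
  by apply: hQ; apply: le_lt_trans hu; rewrite rc_le le_max lexx orbT.
by move=> P Q PQ [M hP]; exists M => u /hP/PQ.
Qed.

Lemma quantumR_limit v : holo_pts (disc e) r v ->
  quantumR r c u v @[u --> cinfty R] --> (v / c) *: r v.
Proof.
move=> hv; have v0 := holo_neq0 hv; have c0 := nf_c0 NF.
have IF := cinfty_filter.
pose t u : C := (1 + c * u / v)^-1.
have big (B : R) : \forall u \near cinfty R, (B%:C%C : C) < `|1 + c * u / v|.
  have [k k0 kE] := normC_rc (c / v).
  have kp : (0 : C) < `|c / v| by rewrite normr_gt0 mulf_neq0 ?invr_neq0.
  move: (kp); rewrite kE -[0 : C]/((0 : R)%:C%C) rc_lt => kp'.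
  exists ((B + 1) / k) => u hu.
  have h1 : ((B + 1)%:C%C : C) < `|c * u / v|.
    rewrite mulrAC normrM kE.
    have -> : ((B + 1)%:C%C : C) = k%:C%C * ((B + 1) / k)%:C%C.
      by rewrite -rcM mulrC divfK // gt_eqF.
    by rewrite ltr_pM2l // -kE.
  have := lerB_normD (c * u / v) 1; rewrite normr1 addrC.
  rewrite [c * u / v + 1]addrC => h2; apply: lt_le_trans h2.
  by rewrite addrC -ltrBlDr opprK; move: h1; rewrite rcD.
have tl : tends (cinfty R) t 0.
  apply/(tends_norm0 IF) => eps e0; have [d d0 ->] := posC e0.
  apply: filterS (big d^-1) => u hu.
  have dp : (0 : C) < (d^-1)%:C%C by rewrite -[0 : C]/((0 : R)%:C%C) rc_lt invr_gt0.
  have -> : (d%:C%C : C) = ((d^-1)%:C%C)^-1.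
    apply: (mulIf (lt0r_neq0 dp)); rewrite mulVf ?lt0r_neq0 // -rcM mulfV //.
    by rewrite gt_eqF.
  by rewrite /t normfV ltf_pV2 // posrE // (lt_trans dp hu).
have h : tends (cinfty R) (fun u => t u *: (1%:M : AA) + ((v / c) * (1 - t u)) *: r v)
    (0 *: (1%:M : AA) + ((v / c) * (1 - 0)) *: r v).
  apply: tendsD; apply: tendsZ; [exact: tl|exact: tends_cst| |exact: tends_cst].
  by apply: tendsM; [exact: tends_cst|apply: tendsB => //; exact: tends_cst].
have [h'] : tends (cinfty R) (fun u => quantumR r c u v) ((v / c) *: r v); last exact: h'.
move: h; rewrite scale0r add0r subr0 mulr1; apply: (tends_near IF).
apply: filterS (big 0) => u; rewrite normr_gt0 => hu.
rewrite /quantumR tens11 scalerDr; rewrite scalerA; congr (_ + _ *: _).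
rewrite /t; field; rewrite v0 c0 /=.
by have := mulf_neq0 hu v0; rewrite mulrDl mul1r divfK // andbT.
Qed.

End FromNormalForm.

(** * The classical solution *)

Section ClassicalPart.
Variables (R : realType) (N : nat).
Local Notation C := (Cplx R).
Local Notation A := 'M[C]_N.
Local Notation AA := 'M[C]_(N * N).
Variables (e : R) (r : C -> AA).
Local Notation D := (sym_dom e r).
Hypotheses (hN : (1 < N)%N) (he : 0 < e) (H : AYBE_domain e D r).
Variables (c : C) (b : A) (F : C -> A).
Hypothesis NF : AYBE_normal_form D r c b F.
Let N0 : N%:R != 0 :> C := NC_neq0 R hN.

Definition rbar v : AA := r v - (b *t 1%:M - 1%:M *t b) - (c / (N%:R * v))%:M.

Lemma ptr2_scalar (k : C) : ptr2 (k%:M : AA) = (N%:R * k)%:M.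
Proof. by rewrite -tens_scalarl ptr2_tens mxtrace1 scale_scalar_mx. Qed.

Lemma ptr1_scalar (k : C) : ptr1 (k%:M : AA) = (N%:R * k)%:M.
Proof. by rewrite -tens_scalarr ptr1_tens mxtrace1 scale_scalar_mx. Qed.

Lemma r_flip v : D v -> flip (r v) = - r (- v).
Proof. by move=> Dv; rewrite -(dom_flip H (dom_opp H Dv)) opprK. Qed.

Lemma ptr1_rbar v : D v -> ptr1 (rbar v) = 0.
Proof.
move=> Dv; have v0 := dom_neq0 H Dv.
rewrite /rbar !linearB /= ptr1_scalar !ptr1_tens mxtrace1 (nf_btr NF) scale0r oppr0 add0r opprK.
have -> : ptr1 (r v) = - ptr2 (r (- v)).
  by rewrite -[in LHS](flipK (r v)) r_flip // flipN linearN.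
rewrite (nf_alpha NF (dom_opp H Dv)).
have -> : N%:R * (c / (N%:R * v)) = c / v by field; rewrite v0 N0.
have -> : c / - v = - (c / v) by field.
rewrite raddfN /=; move: (_ *: b) (_%:M) => x y.
by apply/matrixP => i j; rewrite !mxE; ring.
Qed.

Lemma ptr2_rbar v : D v -> ptr2 (rbar v) = 0.
Proof.
move=> Dv; have v0 := dom_neq0 H Dv.
rewrite /rbar !linearB /= ptr2_scalar !ptr2_tens mxtrace1 (nf_btr NF) scale0r oppr0 subr0.
rewrite (nf_alpha NF Dv).
have -> : N%:R * (c / (N%:R * v)) = c / v by field; rewrite v0 N0.
by move: (_ *: b) (_%:M) => x y; apply/matrixP => i j; rewrite !mxE; ring.
Qed.

Lemma rbar_CYB v v' : D v -> D v' -> D (v + v') -> CYB (rbar v) (rbar (v + v')) (rbar v').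
Proof.
move=> h h' h''; apply: CYB_shift; [exact: (nf_bcomm NF h)|exact: (nf_bcomm NF h'')|exact: (nf_bcomm NF h')|exact: (r_CYB H h h' h'')].
Qed.

Lemma rbar_sym v : D v -> lie (b *t 1%:M + 1%:M *t b) (rbar v) = 0.
Proof.
move=> Dv; rewrite /rbar lieDr lieNr lie_scalarr subr0 lieDr lieNr (nf_bcomm NF Dv) sub0r.
rewrite /lie mulmxDl !mulmxBr !mulmxBl !mulmxDr -!tensmxM !mulmx1 !mul1mx.
move: (_ *t 1%:M) (b *t b) (1%:M *t _) => x y z.
by apply/matrixP => i j; rewrite !mxE; ring.
Qed.

(** F commutes with b, so the shift by b (x) 1 - 1 (x) b is invariant as well. *)
Lemma rbar_FF w v : D v -> (F w *t F w) *m rbar v = rbar v *m (F w *t F w).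
Proof.
move=> Dv; have hr := nf_FF NF w Dv.
have hb : (F w *t F w) *m (b *t 1%:M - 1%:M *t b) = (b *t 1%:M - 1%:M *t b) *m (F w *t F w).
  by rewrite mulmxBr mulmxBl -!tensmxM !mulmx1 !mul1mx (nf_Fb NF).
rewrite /rbar; move: (F w *t F w) (b *t _ - _) (r v) (c / _) hr hb => f s x k hr hb.
by rewrite 2!mulmxBr 2!mulmxBl hr hb mul_scalar_mx mul_mx_scalar.
Qed.

Lemma rbar_mero : meromorphic_on (disc e) r -> meromorphic_on (disc e) rbar.
Proof.
move=> mr z dz.
apply: mero_sub; first apply: mero_sub; first exact: mr.
  exists 0%N, (fun=> b *t 1%:M - 1%:M *t b); split.
    by apply: holo_at_der; apply: filterE => w; exists 0; exact: hasder_cst.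
  by apply: filterE => w; rewrite expr0 scale1r.
have q0 : N%:R *: 'X != 0 :> {poly C} by rewrite scaler_eq0 negb_or N0 polyX_eq0.
have := @mero_quot R _ (fun=> c%:M : AA) (N%:R *: 'X) z q0 (fun w => ex_intro _ 0 (hasder_cst _ w)).
apply: mero_near_eq; apply: filterE => w.
by rewrite hornerZ hornerX scale_scalar_mx mulrC.
Qed.

Lemma holo_rbar v : holo_pts (disc e) rbar v -> tends (nbhs v) rbar (rbar v).
Proof. by move=> [_ /holo_cvg]. Qed.

Lemma rbar_solution : meromorphic_on (disc e) r -> CYBE_sl_solution (disc e) rbar.
Proof.
move=> mr; split; first exact: rbar_mero.
  move=> v hv; have t := holo_rbar hv.
  apply: (in_tens_sl N0).
    exact: (lim_D H hv.1 (tends_lin _ (@ptr1 _ N) t) ptr1_rbar).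
  exact: (lim_D H hv.1 (tends_lin _ (@ptr2 _ N) t) ptr2_rbar).
by move=> v v' hv hv' hw; exact: (ext_CYB H hv hv' hw rbar_CYB).
Qed.

Lemma rbar_symmetry : infinitesimal_symmetry (holo_pts (disc e) rbar) rbar b.
Proof.
move=> v hv; have t := holo_rbar hv.
have t' : tends (nbhs v) (fun w => lie (b *t 1%:M + 1%:M *t b) (rbar w))
    (lie (b *t 1%:M + 1%:M *t b) (rbar v)).
  have nf := @nbhs_filter _ v.
  by apply: (tendsB nf); apply: (tends_mulmx nf) => //; exact: (tends_cst nf).
exact: (lim_D H hv.1 t' rbar_sym).
Qed.

Lemma holo_rbar_FF w v : holo_pts (disc e) rbar v ->
  (F w *t F w) *m rbar v = rbar v *m (F w *t F w).
Proof.
move=> hv; have t := holo_rbar hv; have nf := @nbhs_filter _ v.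
apply/eqP; rewrite -subr_eq0; apply/eqP.
have t' : tends (nbhs v) (fun u => (F w *t F w) *m rbar u - rbar u *m (F w *t F w))
    ((F w *t F w) *m rbar v - rbar v *m (F w *t F w)).
  by apply: (tendsB nf); apply: (tends_mulmx nf) => //; exact: (tends_cst nf).
by apply: (lim_D H hv.1 t') => u Du; rewrite rbar_FF // subrr.
Qed.

End ClassicalPart.

(** * The rational representative *)

Section PolynomialFunctions.
Variable R : realType.
Local Notation C := (Cplx R).

Definition polyfun n m (f : C -> 'M[C]_(n, m)) :=
  exists P : 'M[{poly C}]_(n, m), forall v, f v = hmx P v.

Lemma polyfunD n m (f g : C -> 'M[C]_(n, m)) :
  polyfun f -> polyfun g -> polyfun (fun v => f v + g v).
Proof. by move=> [P fP] [Q gQ]; exists (P + Q) => v; rewrite hmxD fP gQ. Qed.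

Lemma polyfunB n m (f g : C -> 'M[C]_(n, m)) :
  polyfun f -> polyfun g -> polyfun (fun v => f v - g v).
Proof. by move=> [P fP] [Q gQ]; exists (P - Q) => v; rewrite hmxB fP gQ. Qed.

Lemma polyfunM n m l (f : C -> 'M[C]_(n, m)) (g : C -> 'M[C]_(m, l)) :
  polyfun f -> polyfun g -> polyfun (fun v => f v *m g v).
Proof. by move=> [P fP] [Q gQ]; exists (P *m Q) => v; rewrite hmxM fP gQ. Qed.

Lemma polyfunZ n m (p : {poly C}) (f : C -> 'M[C]_(n, m)) :
  polyfun f -> polyfun (fun v => p.[v] *: f v).
Proof. by move=> [P fP]; exists (p *: P) => v; rewrite hmxZ fP. Qed.

Lemma polyfun_lin n m k l (L : {linear 'M[C]_(n, m) -> 'M[C]_(k, l)}) (f : C -> 'M[C]_(n, m)) :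
  polyfun f -> polyfun (fun v => L (f v)).
Proof.
move=> [P fP].
exists (\sum_i \sum_j P i j *: map_mx polyC (L (delta_mx i j))) => v.
have S (I : finType) (Q : I -> 'M[{poly C}]_(k, l)) : hmx (\sum_i Q i) v = \sum_i hmx (Q i) v.
  exact: (raddf_sum (map_mx (horner_eval v))).
rewrite fP [hmx P v]matrix_sum_delta linear_sum S; apply: eq_bigr => i _.
rewrite linear_sum S; apply: eq_bigr => j _.
by rewrite linearZ /= hmxZ hmxC hmxE.
Qed.

Lemma polyfun_dilate n m (a : C) (f : C -> 'M[C]_(n, m)) :
  polyfun f -> polyfun (fun t => f (a * t)).
Proof.
move=> [P fP]; exists (map_mx (fun p => p \Po (a *: 'X)) P) => t.
by rewrite fP; apply/matrixP => i j; rewrite !hmxE mxE horner_comp hornerZ hornerX.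
Qed.

Lemma polyfun_eq0 n m (f : C -> 'M[C]_(n, m)) z v :
  polyfun f -> (\forall w \near z^', f w = 0) -> f v = 0.
Proof.
move=> [P fP] h; have <- : hmx (0 : 'M[{poly C}]_(n, m)) v = 0.
  by apply/matrixP => i j; rewrite hmxE !mxE horner0.
rewrite fP (@hmx_near_eq _ _ _ P 0 z) //; apply: filterS h => w; rewrite fP => ->.
by apply/matrixP => i j; rewrite hmxE !mxE horner0.
Qed.

End PolynomialFunctions.

Section RationalPart.
Variables (R : realType) (N : nat).
Local Notation C := (Cplx R).
Local Notation A := 'M[C]_N.
Local Notation AA := 'M[C]_(N * N).
Local Notation AAA := 'M[C]_(N * N * N).
Variables (e : R) (r : C -> AA).
Local Notation D := (sym_dom e r).
Hypotheses (hN : (1 < N)%N) (he : 0 < e) (H : AYBE_domain e D r).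
Variables (c : C) (b : A) (F : C -> A).
Hypothesis NF : AYBE_normal_form D r c b F.
Let N0 : N%:R != 0 :> C := NC_neq0 R hN.
Local Notation rbar := (rbar r c b).

Lemma FVr v : F v *m F (- v) = 1%:M.
Proof. by rewrite -(nf_FD NF) subrr (nf_F0 NF). Qed.

Lemma FVl v : F (- v) *m F v = 1%:M.
Proof. by rewrite -(nf_FD NF) addNr (nf_F0 NF). Qed.

Definition gauge v (t : AA) : AA := (1%:M *t F v) *m t *m (1%:M *t F (- v)).

Lemma gaugeB v s t : gauge v (s - t) = gauge v s - gauge v t.
Proof. by rewrite /gauge mulmxBr mulmxBl. Qed.

Lemma gauge_scalar v (k : C) : gauge v k%:M = k%:M.
Proof.
by rewrite /gauge mul_mx_scalar -scalemxAl -tensmxM FVr mulmx1 tens11 scalemx1.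
Qed.

Lemma gauge_sym v : gauge v (b *t 1%:M - 1%:M *t b) = b *t 1%:M - 1%:M *t b.
Proof.
rewrite gaugeB /gauge -!tensmxM !mulmx1 !mul1mx FVr.
by rewrite -(nf_Fb NF) -mulmxA FVr mulmx1.
Qed.

Lemma gauge_ptr1 v t : ptr1 (gauge v t) = F v *m ptr1 t *m F (- v).
Proof.
rewrite /gauge; elim/tens_ind: t => [a d|s t hs ht].
  by rewrite -!tensmxM mul1mx mulmx1 !ptr1_tens -scalemxAr -scalemxAl.
by rewrite mulmxDr mulmxDl !linearD /= hs ht mulmxDl.
Qed.

Lemma gauge_ptr2 v t : ptr2 (gauge v t) = ptr2 t.
Proof.
rewrite /gauge; elim/tens_ind: t => [a d|s t hs ht].
  rewrite -!tensmxM mul1mx mulmx1 !ptr2_tens mxtrace_mulC mulmxA FVl mul1mx.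
  by [].
by rewrite mulmxDr mulmxDl !linearD /= hs ht.
Qed.

(** F v2 F (v1 - v2) = F v1, so the composite conjugation is by F v1 (x) F v1. *)
Lemma gauge_undo v1 v2 t : (F v1 *t F v1) *m t = t *m (F v1 *t F v1) ->
  t = (F v1 *t F v2) *m gauge (v1 - v2) t *m (F (- v1) *t F (- v2)).
Proof.
move=> ht; rewrite /gauge !mulmxA -tensmxM mulmx1 -(nf_FD NF) [v2 + _]addrC subrK.
rewrite ht -!mulmxA -tensmxM mul1mx -(nf_FD NF).
have -> : - (v1 - v2) + - v2 = - v1 by ring.
by rewrite -tensmxM FVr tens11 mulmx1.
Qed.

(** On the positions 12, 13, 23 the three transformations are conjugation by
  1 (x) F v (x) F (v + v'): on 23 this is F v (x) F v times 1 (x) F v', and the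
  first factor commutes with z. *)
Lemma gauge_CYB x y z v v' : (F v *t F v) *m z = z *m (F v *t F v) ->
  CYB x y z -> CYB (gauge v x) (gauge (v + v') y) (gauge v' z).
Proof.
move=> hz.
pose p : AAA := 1%:M *t F v *t F (v + v').
pose q : AAA := 1%:M *t F (- v) *t F (- (v + v')).
have pq : p *m q = 1%:M by rewrite /p /q tens3M mulmx1 !FVr tens111.
have qp : q *m p = 1%:M by rewrite /p /q tens3M mulmx1 !FVl tens111.
have c12 a (t : AA) : (1%:M *t 1%:M *t a) *m t12 t = t12 t *m (1%:M *t 1%:M *t a) :> AAA.
  by apply/eqP; rewrite -subr_eq0 -[_ - _]/(lie _ _) comm12_3.
have c13 a (t : AA) : (1%:M *t a *t 1%:M) *m t13 t = t13 t *m (1%:M *t a *t 1%:M) :> AAA.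
  by apply/eqP; rewrite -subr_eq0 -[_ - _]/(lie _ _) comm13_2.
have conj (s t : AAA) : p *m s *m q = t -> s = q *m t *m p.
  by move=> <-; rewrite !mulmxA qp mul1mx -mulmxA qp mulmx1.
apply: (CYB_conj pq) qp => //; apply: conj.
- have -> : p = (1%:M *t F v *t 1%:M) *m (1%:M *t 1%:M *t F (v + v')).
    by rewrite tens3M !mulmx1 mul1mx.
  have -> : q = (1%:M *t 1%:M *t F (- (v + v'))) *m (1%:M *t F (- v) *t 1%:M).
    by rewrite tens3M !mulmx1 !mul1mx.
  rewrite /gauge !t12M !t12_tens -!mulmxA; congr (_ *m _).
  by rewrite mulmxA c12 -mulmxA; congr (_ *m _); rewrite mulmxA tens3M !mulmx1 FVr tens111 mul1mx.
- have -> : p = (1%:M *t 1%:M *t F (v + v')) *m (1%:M *t F v *t 1%:M).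
    by rewrite tens3M !mulmx1 !mul1mx.
  have -> : q = (1%:M *t F (- v) *t 1%:M) *m (1%:M *t 1%:M *t F (- (v + v'))).
    by rewrite tens3M !mulmx1 !mul1mx.
  rewrite /gauge !t13M !t13_tens -!mulmxA; congr (_ *m _).
  by rewrite mulmxA c13 -mulmxA; congr (_ *m _); rewrite mulmxA tens3M !mulmx1 FVr tens111 mul1mx.
- have -> : p = t23 ((1%:M *t F v') *m (F v *t F v)).
    by rewrite -tensmxM mul1mx -(nf_FD NF) t23_tens [v' + v]addrC.
  have -> : q = t23 ((F (- v) *t F (- v)) *m (1%:M *t F (- v'))).
    by rewrite -tensmxM mulmx1 -(nf_FD NF) t23_tens /q opprD.
  rewrite -!t23M; congr t23; rewrite /gauge -!mulmxA; congr (_ *m _).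
  by rewrite mulmxA hz -mulmxA; congr (_ *m _); rewrite mulmxA -tensmxM FVr tens11 mul1mx.
Qed.


(** The factor N v in the denominator clears the scalar term c / (N v); it makes d
  vanish at 0, which rhobar_CYB uses. *)
Lemma gauge_rat : exists (d : {poly C}) (P : 'M[{poly C}]_(N * N)),
  [/\ d != 0, d.[0] = 0 & forall v, D v -> d.[v] *: gauge v (rbar v) = hmx P v].
Proof.
have [d [P [d0 dP]]] := nf_rat NF.
pose x : {poly C} := N%:R *: 'X.
exists (x * d), (x *: P - (x * d) *: map_mx polyC (b *t 1%:M - 1%:M *t b)
  - (c *: d) *: map_mx polyC 1%:M).
split.
- by rewrite mulf_neq0 // scaler_eq0 negb_or N0 polyX_eq0.
- by rewrite /x hornerM hornerZ hornerX mulr0 mul0r.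
- move=> v Dv; have v0 := dom_neq0 H Dv.
  rewrite !hmxB !hmxZ !hmxC -(dP v Dv) -/(gauge v (r v)).
  have xv : x.[v] = N%:R * v by rewrite /x hornerZ hornerX.
  rewrite /rbar 2!gaugeB gauge_sym gauge_scalar hornerM [(c *: d).[v]]hornerZ xv.
  rewrite 2!scalerBr scalerA !scale_scalar_mx mulr1; congr (_ - _ - _%:M).
  by field; rewrite v0 N0.
Qed.

End RationalPart.

Section Representative.
Variables (R : realType) (N : nat).
Local Notation C := (Cplx R).
Local Notation A := 'M[C]_N.
Local Notation AA := 'M[C]_(N * N).
Local Notation AAA := 'M[C]_(N * N * N).
Variables (e : R) (r : C -> AA).
Local Notation D := (sym_dom e r).
Hypotheses (hN : (1 < N)%N) (he : 0 < e) (H : AYBE_domain e D r).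
Variables (c : C) (b : A) (F : C -> A).
Hypothesis NF : AYBE_normal_form D r c b F.
Let FF : ProperFilter (0 : C)^' := Proper_dnbhs_numFieldType (0 : C).
Let N0 : N%:R != 0 :> C := NC_neq0 R hN.
Local Notation rbar := (rbar r c b).
Local Notation gauge := (gauge F).
Variables (d : {poly C}) (P : 'M[{poly C}]_(N * N)).
Hypotheses (d0 : d != 0) (dz : d.[0] = 0)
  (dP : forall v, D v -> d.[v] *: gauge v (rbar v) = hmx P v).

Definition rhobar v : AA := (d.[v])^-1 *: hmx P v.

Lemma rhobar_gauge v : D v -> d.[v] != 0 -> rhobar v = gauge v (rbar v).
Proof. by move=> Dv dv; rewrite /rhobar -dP // scalerA mulVf // scale1r. Qed.

Lemma polyfun_num : polyfun (hmx P).
Proof. by exists P. Qed.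

(** The numerator has vanishing partial traces near 0, hence everywhere. *)
Lemma rhobar_ptr1 v : ptr1 (rhobar v) = 0.
Proof.
rewrite /rhobar linearZ /= (@polyfun_eq0 _ _ _ (fun w => ptr1 (hmx P w)) 0) ?scaler0 //.
  exact: (polyfun_lin (@ptr1 C N) polyfun_num).
apply: filterS (near_dom he H) => w Dw.
by rewrite -dP // linearZ /= gauge_ptr1 (ptr1_rbar hN H NF) // mulmx0 mul0mx scaler0.
Qed.

Lemma rhobar_ptr2 v : ptr2 (rhobar v) = 0.
Proof.
rewrite /rhobar linearZ /= (@polyfun_eq0 _ _ _ (fun w => ptr2 (hmx P w)) 0) ?scaler0 //.
  exact: (polyfun_lin (@ptr2 C N) polyfun_num).
apply: filterS (near_dom he H) => w Dw.
by rewrite -dP // linearZ /= (gauge_ptr2 NF) (ptr2_rbar hN H NF) // scaler0.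
Qed.

Lemma rhobar_mero z : meromorphic_at rhobar z.
Proof. exact: (mero_quot z d0 (hmx_hasder P)). Qed.

Lemma rhobar_rational : Defs.rational rhobar.
Proof.
exists d, P; split=> // v _.
by apply/matrixP => i j; rewrite !mxE mulrC.
Qed.

(** The left side of the CYBE for the tensors k^-1 x, l^-1 y, m^-1 z, with its
  denominators cleared. *)
Definition cleared_CYB (k l m : C) (x y z : AA) : AAA :=
  m *: lie (t12 x) (t13 y) - l *: lie (t23 z) (t12 x) + k *: lie (t13 y) (t23 z).

Lemma lieZ n (k l : C) (p q : 'M[C]_n) : lie (k *: p) (l *: q) = (k * l) *: lie p q.
Proof.
by rewrite /lie -!(scalemxAl, scalemxAr) !scalerA scalerBr [l * k]mulrC.
Qed.

Lemma cleared_CYBE k l m x y z :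
  cleared_CYB k l m (k *: x) (l *: y) (m *: z) = (k * l * m) *:
    (lie (t12 x) (t13 y) - lie (t23 z) (t12 x) + lie (t13 y) (t23 z)).
Proof.
rewrite /cleared_CYB.
have -> : t12 (k *: x) = k *: t12 x :> AAA by rewrite linearZ.
have -> : t13 (l *: y) = l *: t13 y :> AAA by rewrite linearZ.
have -> : t23 (m *: z) = m *: t23 z :> AAA by rewrite linearZ.
rewrite !lieZ; move: (lie _ (t13 y)) (lie _ (t12 x)) (lie _ (t23 z)) => X Y Z.
rewrite !scalerA !scalerDr scalerN.
have -> : m * (k * l) = k * l * m by ring.
have -> : l * (m * k) = k * l * m by ring.
have -> : k * (l * m) = k * l * m by ring.
by [].
Qed.

(** By homogeneity it suffices to consider the points (t v, t v') for t near 0. *)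
Lemma rhobar_CYB v v' : d.[v] != 0 -> d.[v'] != 0 -> d.[v + v'] != 0 ->
  CYB (rhobar v) (rhobar (v + v')) (rhobar v').
Proof.
move=> dv dv' dw.
have nz u : d.[u] != 0 -> u != 0 by apply: contraNneq => ->; rewrite dz.
(* T is a polynomial in t that vanishes near 0, since 0 is in the closure of D *)
pose f a t : C := (d \Po (a *: 'X)).[t].
have fE a t : f a t = d.[a * t] by rewrite /f horner_comp hornerZ hornerX.
pose T t := cleared_CYB (f v t) (f (v + v') t) (f v' t)
  (hmx P (v * t)) (hmx P ((v + v') * t)) (hmx P (v' * t)).
have pT : polyfun T.
  have p12 a : polyfun (fun t => t12 (hmx P (a * t)) : AAA) :=
    polyfun_lin (@t12 C N) (polyfun_dilate a polyfun_num).
  have p13 a : polyfun (fun t => t13 (hmx P (a * t)) : AAA) :=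
    polyfun_lin (@t13 C N) (polyfun_dilate a polyfun_num).
  have p23 a : polyfun (fun t => t23 (hmx P (a * t)) : AAA) :=
    polyfun_lin (@t23 C N) (polyfun_dilate a polyfun_num).
  have pl n (g h : C -> 'M[C]_n) : polyfun g -> polyfun h -> polyfun (fun t => lie (g t) (h t)).
    by move=> pg ph; apply: polyfunB; exact: polyfunM.
  by apply: polyfunD; first apply: polyfunB; apply: polyfunZ; exact: pl.
have T0 : T 1 = 0.
  apply: (polyfun_eq0 (z := 0) 1 pT).
  have nD a : a != 0 -> \forall t \near (0 : C)^', D (a * t).
    move=> a0; have := near_affine (v := 0) a0 (near_dom he H).
    by apply: filterS => t; rewrite add0r.
  apply: filterS3 (nD _ (nz _ dv)) (nD _ (nz _ dv')) (nD _ (nz _ dw)) => t h h' hw.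
  rewrite /T !fE -(dP h) -(dP h') -(dP hw) cleared_CYBE.
  have hw' : D (v * t + v' * t) by rewrite -mulrDl.
  have := gauge_CYB NF (v' * t) (rbar_FF NF (v * t) h') (rbar_CYB H NF h h' hw').
  by rewrite -mulrDl /CYB => ->; rewrite scaler0.
have := T0; rewrite /T !fE !mulr1.
have E u : d.[u] != 0 -> hmx P u = d.[u] *: rhobar u.
  by move=> du; rewrite /rhobar scalerA mulfV // scale1r.
rewrite (E v) // (E v') // (E (v + v')) // cleared_CYBE => /eqP.
by rewrite scaler_eq0 !mulf_eq0 (negbTE dv) (negbTE dv') (negbTE dw) => /eqP.
Qed.

(** Where rhobar is holomorphic d may still vanish; the equation holds there by
  continuity. *)
Lemma rhobar_CYBE : CYBE (holo_pts setT rhobar) rhobar.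
Proof.
move=> v v' [_ hv] [_ hv'] [_ hw]; have two0 : (2 : C) != 0 := two_neq0 R.
have hl u (a : C) : a != 0 -> holomorphic_at rhobar u ->
    tends (0 : C)^' (fun h => rhobar (u + a * h)) (rhobar u).
  by move=> a0 /holo_cvg hu; exact: tends_affine a0 hu.
have nn u (a : C) : a != 0 -> \forall h \near (0 : C)^', d.[u + a * h] != 0.
  by move=> a0; exact: near_affine a0 (horner_near_neq0 u d0).
apply: (lim_CYB (hl _ _ (oner_neq0 C) hv) (hl _ _ two0 hw) (hl _ _ (oner_neq0 C) hv')).
apply: filterS3 (nn v _ (oner_neq0 C)) (nn v' _ (oner_neq0 C)) (nn (v + v') _ two0) => h h1 h2 h3.
have E : (v + v') + 2 * h = (v + 1 * h) + (v' + 1 * h) by ring.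
by rewrite E; apply: rhobar_CYB; rewrite -?E.
Qed.

Lemma F_cvg v : tends (nbhs v) F (F v).
Proof. by have [d' hd] := nf_Fder NF v; exact: hasder_cvg hd. Qed.

Lemma FN_cvg v : tends (nbhs v) (fun w => F (- w)) (F (- v)).
Proof. by have [d' /hasder_opp hd] := nf_Fder NF (- v); exact: hasder_cvg hd. Qed.

(** Up to a polynomial factor, rhobar + c / (N v) becomes c P at 0, where P is
  the permutation, which is nondegenerate; so it is generically nondegenerate. *)
Lemma rhobar_nondegenerate z : \forall v \near z^', Defs.nondegenerate sl (rhobar v).
Proof.
(* M is polynomial; away from the zeros of N v d it is a nonzero multiple of
  rhobar + c / (N v), and K, which tends to c P, shows that rl M is invertible
  near 0 *)
pose x : {poly C} := N%:R *: 'X.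
have xE v : x.[v] = N%:R * v by rewrite /x hornerZ hornerX.
pose M v : AA := x.[v] *: hmx P v + (c *: d).[v] *: 1%:M.
have ME v : v != 0 -> d.[v] != 0 -> M v = (x.[v] * d.[v]) *: (rhobar v + (c / (N%:R * v))%:M).
  move=> v0 dv; rewrite /M scalerDr scalerA mulfK // !scale_scalar_mx [(c *: d).[v]]hornerZ mulr1 xE.
  by congr (_ + _%:M); field; rewrite v0 N0.
have [Q QE] : polyfun (fun v => rl (M v)).
  have pM : polyfun M.
    apply: polyfunD; apply: polyfunZ; first exact: polyfun_num.
    by exists (map_mx polyC 1%:M) => v; rewrite hmxC.
  exact: (polyfun_lin (@rl C N) pM).
pose K v : AA := v *: (gauge v (r v) - (b *t 1%:M - 1%:M *t b)).
have KE v : D v -> d.[v] != 0 -> M v = (N%:R * d.[v]) *: K v.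
  move=> Dv dv; have v0 := dom_neq0 H Dv.
  rewrite ME // /K scalerA xE mulrAC rhobar_gauge // /rbar 2!(gaugeB _ v).
  by rewrite (gauge_sym NF) (gauge_scalar NF) subrK.
have Kl : tends (0 : C)^' K (c *: swap).
  have t0 : tends (0 : C)^' (fun v => F v) 1%:M.
    have := tends_affine (oner_neq0 C) (F_cvg 0); rewrite (nf_F0 NF).
    by apply: tends_ext => // h; rewrite add0r mul1r.
  have t1 : tends (0 : C)^' (fun v => F (- v)) 1%:M by exact: tends_opp0.
  have g0 := tends_tens FF (tends_cst FF (1%:M : A)) t0.
  have g1 := tends_tens FF (tends_cst FF (1%:M : A)) t1.
  have h := tends_mulmx FF (tends_mulmx FF g0 (nf_pole NF)) g1.
  have h' := tendsZ FF (tends_id0 C) (tends_cst FF (b *t 1%:M - 1%:M *t b : AA)).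
  apply: (tends_ext FF _ _ (tendsB FF h h')) => [v|].
    by rewrite /K [RHS]scalerBr /gauge -scalemxAr -scalemxAl.
  by rewrite tens11 mul1mx mulmx1 scale0r subr0.
have nu : \forall v \near (0 : C)^', rl (K v) \in unitmx.
  exact: tends_unit (rl_swap N (nf_c0 NF)) (tends_lin FF (@rl C N) Kl).
have Q0 : \det Q != 0.
  have /filter_ex[v [[Dv dv] uv]] :=
    near0_and (near0_and (near_dom he H) (horner_near_neq0 0 d0)) nu.
  apply/eqP => Q0; have := hmx_det Q v; rewrite Q0 horner0 -QE KE //.
  rewrite linearZ /= detZ => /esym/eqP; rewrite mulf_eq0 expf_eq0 mulf_eq0 (negbTE N0) (negbTE dv).
  rewrite andbF /=; move: uv; rewrite unitmxE unitfE => /negbTE -> .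
  by [].
have n0 : \forall v \near z^', v != 0.
  by apply: filterS (near_notin [:: 0] z) => v; rewrite inE.
apply: filterS3 (horner_near_neq0 z Q0) (horner_near_neq0 z d0) n0 => v qv dv v0.
apply: (nondegenerate_sl N0 (k := c / (N%:R * v))).
- exact: rhobar_ptr1.
- exact: rhobar_ptr2.
rewrite unitmxE unitfE; move: qv; rewrite hmx_det -QE (ME v v0 dv) linearZ /= detZ.
by rewrite mulf_eq0 negb_or => /andP[_ qv]; exact: qv.
Qed.

Lemma rhobar_solution : rational_nondegenerate_CYBE_sl_solution rhobar.
Proof.
split; [split| |].
- by move=> z _; exact: rhobar_mero.
- by move=> v _; exact: (in_tens_sl N0 (rhobar_ptr1 v) (rhobar_ptr2 v)).
- exact: rhobar_CYBE.
- exact: rhobar_rational.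
- by move=> z _; exact: rhobar_nondegenerate.
Qed.

Definition conj_end v : 'End(A) := linfun (mulmxr (F (- v)) \o mulmx (F v)).

Lemma conj_endE v a : conj_end v a = F v *m a *m F (- v).
Proof. by rewrite lfunE. Qed.

(** Conjugation preserves traces and commutators. *)
Lemma conj_end_sl v : aut_sl (conj_end v).
Proof.
have tr w a : \tr (F w *m a *m F (- w)) = \tr a.
  by rewrite mxtrace_mulC mulmxA (FVl NF) mul1mx.
split; last first.
  move=> x y _ _; rewrite /lie !conj_endE.
  have E p q : F v *m p *m F (- v) *m (F v *m q *m F (- v)) = F v *m (p *m q) *m F (- v).
    by rewrite !mulmxA -(mulmxA _ _ (F v)) (FVl NF) mulmx1.
  by rewrite !E mulmxBr mulmxBl.
apply/vspaceP => a; apply/memv_imgP/idP => [[x hx ->]|ha].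
  by move: hx; rewrite !mem_sl conj_endE tr.
exists (F (- v) *m a *m F v).
  by move: ha; rewrite !mem_sl -{2}(opprK v) tr.
by rewrite conj_endE !mulmxA (FVr NF) mul1mx -mulmxA (FVr NF) mulmx1.
Qed.

Lemma tens_mapD (f g : 'End(A)) s t : tens_map f g (s + t) = tens_map f g s + tens_map f g t.
Proof.
rewrite /tens_map; do 4!(rewrite -big_split; apply: eq_bigr => ? _).
by rewrite tcoefD scalerDl.
Qed.

Lemma tens_map_conj v w t : tens_map (conj_end v) (conj_end w) t =
  (F v *t F w) *m t *m (F (- v) *t F (- w)).
Proof.
elim/tens_ind: t => [x y|s t hs ht].
  by rewrite tens_map_tens !conj_endE -!tensmxM.
by rewrite tens_mapD hs ht mulmxDr mulmxDl.
Qed.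

Lemma rhobar_gauge_holo v : holo_pts setT rhobar v -> holo_pts (disc e) rbar v ->
  rhobar v = gauge v (rbar v).
Proof.
move=> [_ hv] [dv /holo_cvg hv']; have nf := @nbhs_filter _ v.
apply: (lim_eq (holo_cvg hv) (g := fun u => gauge u (rbar u))).
  have g0 := tends_tens nf (tends_cst nf (1%:M : A)) (F_cvg v).
  have g1 := tends_tens nf (tends_cst nf (1%:M : A)) (FN_cvg v).
  exact (tends_mulmx nf (tends_mulmx nf g0 hv') g1).
by apply: filterS2 (dom_dense H dv) (horner_near_neq0 v d0) => w; exact: rhobar_gauge.
Qed.

Lemma rhobar_equivalent : BD_equivalent (disc e) rhobar rbar.
Proof.
exists conj_end; split.
- by move=> v _; exact: conj_end_sl.
- move=> a _ v _; apply: holo_at_der; apply: filterE => w.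
  have [d1 h1] := nf_Fder NF w; have [d2 /hasder_opp h2] := nf_Fder NF (- w).
  have := hasderM (hasderM h1 (hasder_cst a w)) h2.
  by move=> h; eexists; apply: hasder_ext h => // u; rewrite conj_endE.
- move=> v1 v2 _ _ hr hr'; rewrite rhobar_gauge_holo // tens_map_conj.
  exact: (gauge_undo NF v2 (holo_rbar_FF H NF v1 hr')).
Qed.

End Representative.
Theorem theorem0p2 (R : realType) (N : nat) (hN : (1 < N)%N)
    (e : R) (he : 0 < e) (r : Cplx R -> 'M[Cplx R]_(N * N))
    (hr : nondegenerate_unitary_AYBE_solution (disc e) r) :
  exists (rbar : Cplx R -> 'M[Cplx R]_(N * N)) (b : 'M[Cplx R]_N) (c : Cplx R),
    [/\ (forall v, holo_pts (disc e) r v ->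
          r v = rbar v + b *t 1%:M - 1%:M *t b
                + (c / (N%:R * v)) *: (1%:M *t 1%:M)),
        (CYBE_sl_solution (disc e) rbar /\
         exists rho, rational_nondegenerate_CYBE_sl_solution rho /\
                     BD_equivalent (disc e) rho rbar),
        (b \in sl /\ infinitesimal_symmetry (holo_pts (disc e) rbar) rbar b),
        c != 0
      & [/\ (forall u, unitary_QYBE_solution
                         (quantumR_dom (holo_pts (disc e) r) c u)
                         (quantumR r c u)),
            unitary_QYBE_solution (holo_pts (disc e) r)
              (fun v => (v / c) *: r v)
          & (forall v, holo_pts (disc e) r v ->
              quantumR r c u v @[u --> cinfty R] --> (v / c) *: r v)]].
Proof.
have hN0 : (0 < N)%N := ltnW hN.
have H := sym_dom_domain hN0 he hr.
have [c [b [F NF]]] := normal_form_exists hN0 he H.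
have mr : meromorphic_on (disc e) r by case: hr.
have [d [P [d0 dz dP]]] := gauge_rat hN H NF.
exists (rbar r c b), b, c; split.
- move=> v _; rewrite /rbar tens11 scalemx1.
  by rewrite -[_ + _ - _ in RHS]addrA addrAC subrK subrK.
- split; first exact: (rbar_solution hN H NF mr).
  exists (rhobar d P); split.
    exact: (rhobar_solution hN he H NF d0 dz dP).
  exact: (rhobar_equivalent H NF d0 dP).
- split; last exact: (rbar_symmetry H NF).
  by rewrite mem_sl (nf_btr NF).
- exact: (nf_c0 NF).
- split.
  + exact: (quantumR_QYBE hN H NF).
  + exact: (scaled_QYBE hN H NF).
  + by move=> v hv; exact: (quantumR_limit hN NF hv).
Qed.
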